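(* The functor $\nabla:\mathbf{S}\to\mathbf{S}^c$ is Reedy admissible. That is, $\nabla$ preserves colimits, and for every map $(A,B,\nabla A\to B)\to(A',B',\nabla A'\to B')$ in $\mathcal{P}$ such that $A\to A'$ is a trivial cofibration of simplicial sets and $\nabla A'\cup_{\nabla A}B\to B'$ is a trivial cofibration of cyclic sets, the map $B\to B'$ is a weak equivalence of cyclic sets.
   Context: $\mathbf{S}$ is the category of simplicial sets with its standard (Kan–Quillen) model structure. $\mathrm{Top}^{S^1}$ is the category of spaces (in a usual convenient category, e.g. compactly generated weak Hausdorff spaces) with continuous $S^1$-action. Cyclic sets. A cyclic set is a simplicial set $X$ together with maps $t_n:X_n\to X_n$ with $t_n^{n+1}=\mathrm{id}$, $d_it_n=t_{n-1}d_{i+1}$ ($0\le i<n$), $d_nt_n=d_0$, $s_it_n=t_{n+1}s_{i+1}$ ($0\le i<n$), $s_nt_n=t_{n+1}^2s_0$; equivalently a set-valued functor on Connes' cyclic category $\Lambda^{\mathrm{op}}$. The category of cyclic sets is $\mathbf{S}^c$. The geometric realization of the underlying simplicial set of a cyclic set $X$ carries a natural $S^1$-action; the resulting $S^1$-space is $|X|_c$. For the representable cyclic sets $\Lambda[n]$ one has $|\Lambda[n]|_c\cong S^1\times|\Delta[n]|$ with $S^1$ rotating the first factor, and $|X|_c=X\otimes_{\Lambda^{\mathrm{op}}}|\Lambda[\bullet]|_c$. The functor $|-|_c:\mathbf{S}^c\to\mathrm{Top}^{S^1}$ has right adjoint $S_c$, $S_c(Y)_n=\hom_{S^1}(|\Lambda[n]|_c,Y)$.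 For $r\ge1$, $\Phi_r(X)=(\mathrm{Sd}_rX)^{\mathbb{Z}/r}$, where $\mathrm{Sd}_r$ is the $r$-fold edgewise subdivision, $(\mathrm{Sd}_rX)_k=X_{r(k+1)-1}$, with generator of $\mathbb{Z}/r$ acting on $k$-simplices by $(t_{r(k+1)-1})^{k+1}$; $|\Phi_r(X)|_s\cong|X|_c^{\mathbb{Z}/r}$. $\mathbf{S}^c$ has Spalinski's model structure: $f$ is a weak equivalence (fibration) if $\Phi_r(f)$ is a weak equivalence (fibration) of simplicial sets for all $r\ge1$, and a cofibration if it has the left lifting property with respect to trivial fibrations. The functor $\nabla$. Let $\nabla_n=S_c(|\Delta[n]|)$, where $|\Delta[n]|$ has trivial $S^1$-action; this is a cosimplicial cyclic set. Define $\nabla:\mathbf{S}\to\mathbf{S}^c$ by $\nabla X=X\otimes_{\Delta^{\mathrm{op}}}\nabla_*$ (coend). The category $\mathcal{P}$. Objects are triples $(A,B,\nabla A\to B)$ with $A$ a simplicial set, $B$ a cyclic set and $\nabla A\to B$ a map of cyclic sets; morphisms are pairs of maps $A\to A'$, $B\to B'$ making the square with $\nabla A\to\nabla A'$ commute. *)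

(* Defs.v *)
From HB Require Import structures.
From Stdlib Require Import Relations.
From mathcomp Require Import all_boot all_order all_algebra generic_quotient.
From mathcomp Require Import all_classical all_reals all_analysis.
From mathcomp Require Import zify ring.

Set Implicit Arguments.
Unset Strict Implicit.
Unset Printing Implicit Defensive.

Import Order.TTheory GRing.Theory Num.Theory.
Import numFieldNormedType.Exports.

Record category := Category {
  ob :> Type;
  hom : ob -> ob -> Type;
  idm : forall a, hom a a;
  cmp : forall a b c, hom b c -> hom a b -> hom a c;
  cmp1m : forall a b (f : hom a b), cmp (idm b) f = f;
  cmpm1 : forall a b (f : hom a b), cmp f (idm a) = f;
  cmpA : forall a b c d (h : hom c d) (g : hom b c) (f : hom a b),
    cmp h (cmp g f) = cmp (cmp h g) f }.
Arguments hom {_} _ _.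
Arguments idm {_} _.
Arguments cmp {_ _ _ _} _ _.

Notation "g \oc f" := (cmp g f) (at level 50, left associativity).

Record functor (C D : category) := Functor {
  fob :> C -> D;
  fmap : forall a b, hom a b -> hom (fob a) (fob b);
  fmap1 : forall a, fmap (idm a) = idm (fob a);
  fmapM : forall a b c (g : hom b c) (f : hom a b),
    fmap (g \oc f) = fmap g \oc fmap f }.
Arguments fmap {_ _} _ {_ _} _.

Definition op (C : category) : category :=
  @Category C (fun a b => hom b a) (@idm C) (fun a b c g f => f \oc g)
    (fun a b f => cmpm1 f) (fun a b f => cmp1m f)
    (fun a b c d h g f => esym (cmpA f g h)).

Definition Sets : category :=
  @Category Type (fun A B => A -> B) (fun A x => x)
    (fun A B C g f x => g (f x)) (fun _ _ _ => erefl) (fun _ _ _ => erefl)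
    (fun _ _ _ _ _ _ _ => erefl).

Record nattrans (C D : category) (F G : functor C D) := NatTrans {
  nt :> forall a, hom (F a) (G a);
  ntP : forall a b (f : hom a b), nt b \oc fmap F f = fmap G f \oc nt a }.

Lemma nattrans_eq (C D : category) (F G : functor C D) (u v : nattrans F G) :
  (forall a, u a = v a) -> u = v.
Proof.
case: u v => [u uP] [v vP] /= uv; have e : u = v by apply: functional_extensionality_dep.
by rewrite e in uP *; congr NatTrans; exact: Prop_irrelevance.
Qed.

Lemma nt_id_subproof (C D : category) (F : functor C D) a b (f : hom a b) :
  idm (F b) \oc fmap F f = fmap F f \oc idm (F a).
Proof. by rewrite cmp1m cmpm1. Qed.

Lemma nt_cmp_subproof (C D : category) (F G H : functor C D)
    (v : nattrans G H) (u : nattrans F G) a b (f : hom a b) :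
  (v b \oc u b) \oc fmap F f = fmap H f \oc (v a \oc u a).
Proof. by rewrite -cmpA ntP cmpA ntP -cmpA. Qed.

Definition nt_id (C D : category) (F : functor C D) : nattrans F F :=
  NatTrans (nt_id_subproof F).

Definition nt_cmp (C D : category) (F G H : functor C D)
    (v : nattrans G H) (u : nattrans F G) : nattrans F H :=
  NatTrans (nt_cmp_subproof v u).

Definition functor_category (C D : category) : category.
Proof.
apply: (@Category (functor C D) (@nattrans C D) (@nt_id C D) (@nt_cmp C D)).
- by move=> F G u; apply: nattrans_eq => a; exact: cmp1m.
- by move=> F G u; apply: nattrans_eq => a; exact: cmpm1.
- by move=> F G H K w v u; apply: nattrans_eq => a; exact: cmpA.
Defined.

Definition has_lift (C : category) (a b x y : C) (i : hom a b) (p : hom x y) :=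
  forall (u : hom a x) (v : hom b y), p \oc u = v \oc i ->
  exists h : hom b x, h \oc i = u /\ p \oc h = v.

Definition is_pushout (C : category) (a b c q : C) (f : hom a b) (g : hom a c)
    (i : hom b q) (j : hom c q) :=
  i \oc f = j \oc g /\
  forall (x : C) (u : hom b x) (v : hom c x), u \oc f = v \oc g ->
  exists! w : hom q x, w \oc i = u /\ w \oc j = v.

Definition is_cocone (J C : category) (F : functor J C) (l : C)
    (k : forall j, hom (F j) l) :=
  forall i j (e : hom i j), k j \oc fmap F e = k i.

Definition is_colimit (J C : category) (F : functor J C) (l : C)
    (k : forall j, hom (F j) l) :=
  is_cocone k /\
  forall (x : C) (c : forall j, hom (F j) x), is_cocone c ->
  exists! w : hom l x, forall j, w \oc k j = c j.

Definition functor_comp (C D E : category) (G : functor D E) (F : functor C D) :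
  functor C E.
Proof.
apply: (@Functor C E (fun a => G (F a)) (fun a b f => fmap G (fmap F f))).
- by move=> a; rewrite !fmap1.
- by move=> a b c g f; rewrite !fmapM.
Defined.

Definition preserves_colimits (C D : category) (G : functor C D) :=
  forall (J : category) (F : functor J C) (l : C) (k : forall j, hom (F j) l),
  is_colimit k ->
  is_colimit (F := functor_comp G F) (fun j => fmap G (k j)).

Definition dhom (m n : nat) :=
  {f : {ffun 'I_m.+1 -> 'I_n.+1} | [forall i : 'I_m.+1, forall j : 'I_m.+1, (i <= j) ==> (f i <= f j)]}.

Definition dfun (m n : nat) (f : dhom m n) : 'I_m.+1 -> 'I_n.+1 := val f.
Coercion dfun : dhom >-> Funclass.

Lemma dhom_mono m n (f : dhom m n) (i j : 'I_m.+1) : i <= j -> f i <= f j.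
Proof. by rewrite /dfun; have /forallP/(_ i)/forallP/(_ j)/implyP := valP f. Qed.

Lemma dhom_eq m n (f g : dhom m n) : (forall i, f i = g i :> nat) -> f = g.
Proof. by move=> fg; apply/val_inj/ffunP => i; apply/val_inj/fg. Qed.

Lemma mk_dhom_subproof m n (f : 'I_m.+1 -> 'I_n.+1) :
  (forall i j : 'I_m.+1, i <= j -> f i <= f j) ->
  [forall i : 'I_m.+1, forall j : 'I_m.+1, (i <= j) ==> (finfun f i <= finfun f j)].
Proof.
by move=> H; apply/forallP => i; apply/forallP => j; apply/implyP; rewrite !ffunE; apply: H.
Qed.

Definition mk_dhom m n (f : 'I_m.+1 -> 'I_n.+1)
    (fP : forall i j : 'I_m.+1, i <= j -> f i <= f j) : dhom m n :=
  exist _ (finfun f) (mk_dhom_subproof fP).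

Lemma mk_dhomE m n f fP i : @mk_dhom m n f fP i = f i.
Proof. exact: ffunE. Qed.

Lemma did_subproof n (i j : 'I_n.+1) : i <= j -> i <= j. Proof. by []. Qed.
Definition did n : dhom n n := mk_dhom (@did_subproof n).

Lemma dcomp_subproof m n p (g : dhom n p) (f : dhom m n) (i j : 'I_m.+1) :
  i <= j -> g (f i) <= g (f j).
Proof. by move=> ij; apply/dhom_mono/dhom_mono. Qed.
Definition dcomp m n p (g : dhom n p) (f : dhom m n) : dhom m p :=
  mk_dhom (@dcomp_subproof _ _ _ g f).

(* objects: n stands for the ordinal [n] = {0, ..., n} *)
Definition Delta : category.
Proof.
apply: (@Category nat dhom did dcomp).
- by move=> a b f; apply: dhom_eq => i; rewrite !mk_dhomE.
- by move=> a b f; apply: dhom_eq => i; rewrite !mk_dhomE.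
- by move=> a b c d h g f; apply: dhom_eq => i; rewrite !mk_dhomE.
Defined.

Lemma coface_subproof n (i : 'I_n.+2) (j k : 'I_n.+1) :
  j <= k -> lift i j <= lift i k.
Proof. by rewrite leq_bump2. Qed.
Definition coface n (i : 'I_n.+2) : dhom n n.+1 := mk_dhom (@coface_subproof n i).

Lemma codegen_ltn n (i : 'I_n.+1) (j : 'I_n.+2) : unbump i j < n.+1.
Proof. by rewrite /unbump; case: i j => i Hi [j Hj] /=; case: ltnP => /=; lia. Qed.
Lemma codegen_subproof n (i : 'I_n.+1) (j k : 'I_n.+2) :
  j <= k -> Ordinal (codegen_ltn i j) <= Ordinal (codegen_ltn i k).
Proof. by rewrite /= /unbump; do 2 case: ltnP => /=; lia. Qed.
Definition codegen n (i : 'I_n.+1) : dhom n.+1 n := mk_dhom (@codegen_subproof n i).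

Definition SSet : category := functor_category (op Delta) Sets.

Definition face (X : SSet) n (i : 'I_n.+2) : X n.+1 -> X n := fmap X (coface i).
Definition degen (X : SSet) n (i : 'I_n.+1) : X n -> X n.+1 := fmap X (codegen i).

Lemma sset_fmapM (X : functor (op Delta) Sets) m n p (g : dhom n p) (f : dhom m n) x :
  fmap X (dcomp g f : @hom (op Delta) p m) x = fmap X (f : @hom (op Delta) n m) (fmap X (g : @hom (op Delta) p n) x).
Proof. by have /(congr1 (fun h => h x)) := fmapM X (f : @hom (op Delta) n m) (g : @hom (op Delta) p n). Qed.

Definition subsset (X : SSet) (P : forall n, X n -> Prop)
    (Pclosed : forall m n (a : dhom m n) x, P n x -> P m (fmap X a x)) : SSet.
Proof.
apply: (@Functor (op Delta) Sets (fun n => {x : X n | P n x})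
  (fun n m (a : dhom m n) x => exist _ _ (Pclosed _ _ a _ (svalP x)))).
- move=> n; apply: funext => -[x Px]; apply: eq_exist => /=.
  by rewrite (fmap1 X n).
- move=> n m p b a; apply: funext => -[x Px]; apply: eq_exist => /=.
  exact: sset_fmapM.
Defined.

Definition is_horn n (k : 'I_n.+1) m (f : dhom m n) :=
  exists2 j : 'I_n.+1, j != k & forall i, f i != j.

Definition simplex (n : nat) : SSet.
Proof.
apply: (@Functor (op Delta) Sets (fun m => dhom m n) (fun m p (a : dhom p m) f => dcomp f a)).
- by move=> m; apply: funext => f; apply: dhom_eq => i; rewrite !mk_dhomE.
- by move=> m p q b a; apply: funext => f; apply: dhom_eq => i; rewrite !mk_dhomE.
Defined.

Lemma horn_subproof n (k : 'I_n.+1) m p (a : dhom p m) (f : simplex n m) :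
  is_horn k f -> is_horn k (fmap (simplex n) a f).
Proof. by case=> j jk fj; exists j => // i; rewrite mk_dhomE. Qed.
Definition horn n (k : 'I_n.+1) : SSet :=
  subsset (fun p m a f => @horn_subproof n k m p a f).

Definition subsset_incl (X : SSet) (P : forall n, X n -> Prop)
    (Pclosed : forall m n (a : dhom m n) x, P n x -> P m (fmap X a x)) :
  hom (subsset Pclosed) X :=
  @NatTrans _ _ (subsset Pclosed) X (fun n => @sval _ _) (fun _ _ _ => erefl).

Definition horn_incl n (k : 'I_n.+1) : hom (horn k) (simplex n) :=
  subsset_incl _.

Definition kan_fibration (X Y : SSet) (p : hom X Y) :=
  forall n (k : 'I_n.+2), has_lift (horn_incl k) p.

Definition sset_cofibration (X Y : SSet) (f : hom X Y) :=
  forall n, injective (f n).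

(* [quot r]: quotient of [T] by the equivalence relation generated by [r] *)
Section Quot.
Variables (T : choiceType) (r : T -> T -> Prop).

Definition generated : rel T := fun x y => `[< clos_refl_sym_trans T r x y >].

Lemma generated_refl : reflexive generated.
Proof. by move=> x; apply/asboolP/rst_refl. Qed.
Lemma generated_sym : symmetric generated.
Proof. by move=> x y; apply/asboolP/asboolP; exact: rst_sym. Qed.
Lemma generated_trans : transitive generated.
Proof. by move=> y x z /asboolP xy /asboolP yz; apply/asboolP/(rst_trans _ _ _ _ _ xy yz). Qed.

Canonical generated_equiv := EquivRel generated generated_refl generated_sym generated_trans.

Definition quot := {eq_quot generated_equiv}%qT.
Definition qclass (x : T) : quot := (\pi_quot x)%qT.

Lemma qclassP (x y : T) : r x y -> qclass x = qclass y.
Proof. by move=> rxy; apply/eqquotP/asboolP/rst_step. Qed.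

Lemma quotW (q : quot) : exists x, q = qclass x.
Proof. by exists (repr q); rewrite /qclass reprK. Qed.

Lemma qclass_compat (U : Type) (f : T -> U) x y :
  (forall x y, r x y -> f x = f y) -> qclass x = qclass y -> f x = f y.
Proof.
move=> rf /eqquotP/asboolP; elim=> [a b /rf //|//|a b _ ->//|a b c _ -> _ -> //].
Qed.
End Quot.

(* defined on representatives; the expected map when [f] is compatible with the
   generating relations, see [qmapE] *)
Definition qmap (T T' : choiceType) (r : T -> T -> Prop) (r' : T' -> T' -> Prop)
  (f : T -> T') (q : quot r) : quot r' := qclass r' (f (repr q)).

Lemma qmapE (T T' : choiceType) (r : T -> T -> Prop) (r' : T' -> T' -> Prop)
    (f : T -> T') x : (forall x y, r x y -> r' (f x) (f y)) ->
  qmap r' f (qclass r x) = qclass r' (f x).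
Proof.
move=> rf; apply: (qclass_compat (r := r) (f := fun x => qclass r' (f x))).
  by move=> a b /rf/qclassP.
exact: reprK.
Qed.

Local Open Scope classical_set_scope.
Local Open Scope ring_scope.

Definition std_simplex (R : realType) (n : nat) : set 'rV[R]_n.+1 :=
  [set u | (forall i, 0 <= u 0 i) /\ \sum_i u 0 i = 1].

Definition tsimplex (R : realType) n : topologicalType := set_type (@std_simplex R n).

(* affine extension of the map of vertices [f] *)
Definition push (R : realType) m n (f : 'I_m.+1 -> 'I_n.+1) (u : 'rV[R]_m.+1) : 'rV[R]_n.+1 :=
  \row_j \sum_(i | f i == j) u 0 i.

Lemma push_simplex (R : realType) m n (f : 'I_m.+1 -> 'I_n.+1) (u : tsimplex R m) :
  std_simplex (push f (val u)).
Proof.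
have [u0 u1] := set_valP u; split=> [j|]; first by rewrite mxE sumr_ge0.
rewrite -[RHS]u1 (partition_big f xpredT) //=; apply: eq_bigr => j _.
by rewrite mxE.
Qed.

Definition tmap (R : realType) m n (f : 'I_m.+1 -> 'I_n.+1) (u : tsimplex R m) :
    tsimplex R n :=
  exist _ (push f (val u)) (mem_set (push_simplex f u)).

Lemma tmapE (R : realType) m n (f : 'I_m.+1 -> 'I_n.+1) (u : tsimplex R m) j :
  val (tmap f u) 0 j = \sum_(i | f i == j) val u 0 i.
Proof. by rewrite mxE. Qed.

Lemma tsimplex_eq (R : realType) n (u v : tsimplex R n) : (forall j, val u 0 j = val v 0 j) -> u = v.
Proof. by move=> uv; apply/val_inj/rowP. Qed.

Lemma tmap_id (R : realType) n (f : 'I_n.+1 -> 'I_n.+1) (u : tsimplex R n) :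
  (forall i, f i = i) -> tmap f u = u.
Proof.
move=> fE; apply: tsimplex_eq => j; rewrite tmapE (eq_bigl (pred1 j)) ?big_pred1_eq //.
by move=> i /=; rewrite fE.
Qed.

Lemma tmap_comp (R : realType) m n p (g : 'I_n.+1 -> 'I_p.+1) (f : 'I_m.+1 -> 'I_n.+1)
  (u : tsimplex R m) : tmap g (tmap f u) = tmap (g \o f) u.
Proof.
apply: tsimplex_eq => j; rewrite !tmapE (partition_big f (fun i => g i == j)) //=.
apply: eq_bigr => i gi; rewrite tmapE; apply: eq_bigl => k.
by case: eqP => [->|]; rewrite ?gi ?andbF.
Qed.

Lemma eq_tmap (R : realType) m n (f g : 'I_m.+1 -> 'I_n.+1) (u : tsimplex R m) :
  f =1 g -> tmap f u = tmap g u.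
Proof. by move=> /funext ->. Qed.

Lemma sum_continuous (R : realType) (T : topologicalType) (I : Type) (s : seq I) (P : pred I)
  (f : I -> T -> R) : (forall i, continuous (f i)) -> continuous (fun x => \sum_(i <- s | P i) f i x).
Proof.
move=> fc; elim: s => [|i s IHs].
  by under [X in continuous X]funext do rewrite big_nil; exact: cst_continuous.
under [X in continuous X]funext do rewrite big_cons.
by case: (P i) => // x; apply: cvgD; [exact: fc | exact: IHs].
Qed.

Lemma set_type_continuous (T U : topologicalType) (A : set U) (f : T -> set_type A) :
  continuous (fun x => val (f x)) -> continuous f.
Proof.
move=> /continuousP fc; apply/continuousP => V [W oW <-].
by rewrite -comp_preimage; exact: fc.
Qed.

Lemma row_continuous (R : realType) (T : topologicalType) n (f : T -> 'rV[R]_n) :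
  (forall i, continuous (fun x => f x 0 i)) -> continuous f.
Proof.
move=> fc x A [P xP PA]; rewrite /= nbhs_filterE /=.
suff : \forall y \near x, forall i j, P i j (f y i j).
  by apply: filterS => y /PA.
apply: filter_forall => i; apply: filter_forall => j.
by rewrite ord1; apply: (fc j x); rewrite -(ord1 i).
Qed.

Lemma simplex_coord_continuous (R : realType) n (i : 'I_n.+1) :
  continuous (fun u : tsimplex R n => val u 0 i).
Proof.
move=> u; apply: (@continuous_comp _ _ _ (val : tsimplex R n -> 'rV[R]_n.+1) (fun x => x 0 i)).
  exact: initial_continuous.
exact: coord_continuous.
Qed.

Lemma tmap_continuous (R : realType) m n (f : 'I_m.+1 -> 'I_n.+1) :
  continuous (@tmap R m n f).
Proof.
apply: set_type_continuous; apply: row_continuous => j.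
rewrite (_ : (fun _ => _) = fun u : tsimplex R m => \sum_(i | f i == j) val u 0 i).
  by apply: sum_continuous => i; exact: simplex_coord_continuous.
by apply: funext => u; rewrite tmapE.
Qed.

(* The geometric realization |X| is the quotient of the disjoint union, over all n
   and all x in X_n, of copies of the topological n-simplex. *)
Definition cells (R : realType) (X : SSet) : topologicalType :=
  {s : {classic {n : nat & X n}} & tsimplex R (projT1 s)}.

Definition cell (R : realType) (X : SSet) n (x : X n) (u : tsimplex R n) : cells R X :=
  existT (fun s : {classic {n : nat & X n}} => tsimplex R (projT1 s)) (existT _ n x) u.

Inductive glue (R : realType) (X : SSet) : cells R X -> cells R X -> Prop :=
| Glue m n (a : dhom m n) (x : X n) (u : tsimplex R m) :
    glue (cell (fmap X a x) u) (cell x (tmap a u)).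

Definition realization (R : realType) (X : SSet) : topologicalType :=
  quotient_topology (quot (@glue R X)).

Definition cells_map (R : realType) (X Y : SSet) (f : hom X Y) (c : cells R X) : cells R Y :=
  cell (f _ (projT2 (projT1 c))) (projT2 c).

Definition realization_map (R : realType) (X Y : SSet) (f : hom X Y) :
  realization R X -> realization R Y := qmap (@glue R Y) (cells_map f).

Lemma cells_map_glue (R : realType) (X Y : SSet) (f : hom X Y) (c d : cells R X) :
  glue c d -> glue (cells_map f c) (cells_map f d).
Proof.
case=> m n a x u; rewrite /cells_map /=.
have /(congr1 (fun h => h x)) /= -> := ntP f (a : @hom (op Delta) n m).
exact: Glue.
Qed.

Lemma realization_mapE (R : realType) (X Y : SSet) (f : hom X Y) (c : cells R X) :
  realization_map f (qclass _ c) = qclass _ (cells_map f c).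
Proof. exact/qmapE/cells_map_glue. Qed.

Definition unit_interval (R : realType) : topologicalType := set_type `[0%R, 1%R : R]%classic.
Definition cube (R : realType) n : topologicalType :=
  set_type [set v : 'rV[R]_n | forall i, 0 <= v 0 i <= 1].
Definition cube_boundary (R : realType) n (v : cube R n) :=
  exists i, val v 0 i = 0 \/ val v 0 i = 1.

Definition joined (R : realType) (X : topologicalType) (x y : X) :=
  exists p : unit_interval R -> X, [/\ continuous p,
    forall t, val t = 0 -> p t = x & forall t, val t = 1 -> p t = y].

(* representatives of elements of pi_n(X, x), and homotopy relative to the boundary *)
Definition spheroid (R : realType) (X : topologicalType) n (x : X) (a : cube R n -> X) :=
  continuous a /\ forall v, cube_boundary v -> a v = x.

Definition homotopic (R : realType) (X : topologicalType) n (x : X) (a b : cube R n -> X) :=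
  exists h : cube R n * unit_interval R -> X, [/\ continuous h,
    forall v t, val t = 0 -> h (v, t) = a v,
    forall v t, val t = 1 -> h (v, t) = b v
    & forall v t, cube_boundary v -> h (v, t) = x].

(* bijection on pi_0 and, for n > 0 and every base point, on pi_n (the map induced
   on pi_n is automatically a group homomorphism) *)
Definition weak_homotopy_equivalence (R : realType) (X Y : topologicalType) (f : X -> Y) :=
  [/\ continuous f,
      forall x x', joined R (f x) (f x') -> joined R x x',
      forall y, exists x, joined R (f x) y
    & forall n (x : X), (0 < n)%N ->
        (forall a b : cube R n -> X, spheroid x a -> spheroid x b ->
           homotopic (f x) (f \o a) (f \o b) -> homotopic x a b) /\
        (forall c : cube R n -> Y, spheroid (f x) c ->
           exists2 a, spheroid x a & homotopic (f x) (f \o a) c)].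

Definition sset_weq (R : realType) (X Y : SSet) (f : hom X Y) :=
  weak_homotopy_equivalence R (realization_map (R := R) f).

Definition sset_trivial_cofibration (R : realType) (X Y : SSet) (f : hom X Y) :=
  sset_cofibration f /\ sset_weq R f.

Local Close Scope ring_scope.
Local Close Scope classical_set_scope.

(* [cyc] in degree n is t_n *)
Record cset := CSetPack {
  csset :> functor (op Delta) Sets;
  cyc : forall n, csset n -> csset n;
  cyc_order : forall n x, iter n.+1 (@cyc n) x = x;
  face_cyc : forall n (i : 'I_n.+1) (x : csset n.+1),
    face (widen_ord (leqnSn n.+1) i) (cyc x) = cyc (face (lift ord0 i) x);
  face_cyc_max : forall n (x : csset n.+1), face ord_max (cyc x) = face ord0 x;
  degen_cyc : forall n (i : 'I_n) (x : csset n),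
    degen (widen_ord (leqnSn n) i) (cyc x) = cyc (degen (lift ord0 i) x);
  degen_cyc_max : forall n (x : csset n),
    degen ord_max (cyc x) = cyc (cyc (degen ord0 x)) }.

Record cset_map (X Y : cset) := CSetMap {
  cmap :> nattrans X Y;
  cmap_cyc : forall n (x : X n), cmap n (cyc x) = cyc (cmap n x) }.

Lemma cset_map_eq (X Y : cset) (f g : cset_map X Y) :
  (forall n, f n = g n) -> f = g.
Proof.
case: f g => [f fP] [g gP] /= fg; have e : f = g by apply: nattrans_eq.
by rewrite e in fP *; congr CSetMap; exact: Prop_irrelevance.
Qed.

Definition cset_id (X : cset) : cset_map X X :=
  @CSetMap X X (nt_id X) (fun _ _ => erefl).

Lemma cset_cmp_subproof (X Y Z : cset) (g : cset_map Y Z) (f : cset_map X Y) n (x : X n) :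
  nt_cmp g f n (cyc x) = cyc (nt_cmp g f n x).
Proof. by rewrite /= !cmap_cyc. Qed.
Definition cset_cmp (X Y Z : cset) (g : cset_map Y Z) (f : cset_map X Y) : cset_map X Z :=
  CSetMap (cset_cmp_subproof g f).

Definition CSet : category.
Proof.
by apply: (@Category cset cset_map cset_id cset_cmp) => *; apply: cset_map_eq.
Defined.

(* the extension f~ : nat -> nat of f : [m] -> [n] with f~(i + m + 1) = f~(i) + n + 1 *)
Definition dlift m n (f : dhom m n) (i : nat) : nat :=
  f (inord (i %% m.+1)) + (i %/ m.+1) * n.+1.

Lemma dlift_small m n (f : dhom m n) (i : 'I_m.+1) : dlift f i = f i.
Proof. by rewrite /dlift modn_small // divn_small // mul0n addn0 inord_val. Qed.

Lemma dliftD m n (f : dhom m n) i q : dlift f (i + q * m.+1) = dlift f i + q * n.+1.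
Proof. by rewrite /dlift [i + _]addnC modnMDl divnMDl // mulnDl; lia. Qed.

Lemma dlift_lt m n (f : dhom m n) q i : (dlift f i < q * n.+1) = (i < q * m.+1).
Proof.
have fn := ltn_ord (f (inord (i %% m.+1))).
rewrite -[in RHS]ltn_divLR // /dlift; apply/idP/idP => h; first by rewrite -(ltn_pmul2r (ltn0Sn n)) (leq_ltn_trans (leq_addl _ _) h).
by apply: leq_trans (leq_mul h (leqnn n.+1)); rewrite mulSn ltn_add2r.
Qed.

Lemma dlift_mono m n (f : dhom m n) i j : i <= j -> dlift f i <= dlift f j.
Proof.
move=> ij; have [q_lt|q_ge] := ltnP (i %/ m.+1) (j %/ m.+1).
  have h1 : dlift f i < (j %/ m.+1) * n.+1 by rewrite dlift_lt -ltn_divLR.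
  by apply/ltnW/(leq_trans h1); rewrite leqNgt dlift_lt -leqNgt leq_trunc_div.
have e : i %/ m.+1 = j %/ m.+1 by apply/eqP; rewrite eqn_leq q_ge leq_div2r.
rewrite /dlift e leq_add2r dhom_mono // !inordK ?ltn_mod //.
by rewrite -(leq_add2l (j %/ m.+1 * m.+1)) -{1}e -!divn_eq.
Qed.

Lemma dliftM m n p (g : dhom n p) (f : dhom m n) i :
  dlift (dcomp g f) i = dlift g (dlift f i).
Proof. by rewrite [dlift f i]/dlift dliftD dlift_small /dlift mk_dhomE. Qed.

Lemma dlift_id n i : dlift (did n) i = i.
Proof. by rewrite /dlift mk_dhomE inordK ?ltn_mod // addnC -divn_eq. Qed.

Lemma dlift_inj m n (f g : dhom m n) : (forall i, dlift f i = dlift g i) -> f = g.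
Proof. by move=> fg; apply: dhom_eq => i; rewrite -!dlift_small. Qed.

(* [sd r] is the functor inducing the (r + 1)-fold edgewise subdivision: it sends [k] to
   [(r + 1)(k + 1) - 1], viewed as the concatenation of r + 1 copies of [k], and f to
   the concatenation of r + 1 copies of f. *)
Definition sd_deg (r k : nat) : nat := (r.+1 * k.+1).-1.

Lemma sd_ltn r m n (f : dhom m n) (j : 'I_(sd_deg r m).+1) : dlift f j < (sd_deg r n).+1.
Proof. by rewrite [(sd_deg r n).+1](_ : _ = r.+1 * n.+1) // dlift_lt; apply: ltn_ord j. Qed.

Lemma sd_subproof r m n (f : dhom m n) (i j : 'I_(sd_deg r m).+1) :
  i <= j -> Ordinal (sd_ltn f i) <= Ordinal (sd_ltn f j).
Proof. exact: dlift_mono. Qed.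
Definition sd_map r m n (f : dhom m n) : dhom (sd_deg r m) (sd_deg r n) :=
  mk_dhom (@sd_subproof r m n f).

Lemma dlift_sd r m n (f : dhom m n) i : dlift (sd_map r f) i = dlift f i.
Proof.
have e k : (sd_deg r k).+1 = r.+1 * k.+1 by [].
set S := (sd_deg r m).+1.
have {2}-> : i = i %% S + (i %/ S * r.+1) * m.+1 by rewrite -mulnA -e addnC -divn_eq.
by rewrite {1}/dlift mk_dhomE /= inordK ?ltn_mod // dliftD -mulnA -e.
Qed.

Definition sd (r : nat) : functor Delta Delta.
Proof.
apply: (@Functor Delta Delta (sd_deg r) (@sd_map r)).
- by move=> n; apply: dlift_inj => i; rewrite dlift_sd !dlift_id.
- by move=> m n p g f; apply: dlift_inj => i; rewrite dlift_sd !dliftM !dlift_sd.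
Defined.

Definition op_functor (C D : category) (F : functor C D) : functor (op C) (op D).
Proof.
apply: (@Functor (op C) (op D) F (fun a b (f : @hom C b a) => fmap F f)).
- by move=> a; exact: (fmap1 F a).
- by move=> a b c g f; exact: (fmapM F f g).
Defined.

(* [Sd r] is Sd_(r+1) *)
Definition Sd (r : nat) (X : SSet) : SSet := functor_comp X (op_functor (sd r)).

(* every monotone map is a composite of cofaces and codegeneracies *)
Lemma delta_ind (P : forall m n, dhom m n -> Prop) :
  (forall n, P n n (did n)) -> (forall n i, P n n.+1 (coface i)) ->
  (forall n i, P n.+1 n (codegen i)) ->
  (forall m n p (g : dhom n p) (f : dhom m n), P _ _ g -> P _ _ f -> P _ _ (dcomp g f)) ->
  forall m n (f : dhom m n), P m n f.
Proof.
move=> P1 Pd Ps PM m n; move: {-1}(m + n) (leqnn (m + n)) => N.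
elim: N m n => [|N IHN] m n.
  rewrite leqn0 addn_eq0 => /andP[/eqP -> /eqP ->] f.
  by rewrite (_ : f = did 0) //; apply: dhom_eq => i; rewrite !ord1.
move=> mnN f.
have [/existsP[j /forallP fj]|surj] := boolP [exists j, forall i, f i != j].
  case: n => [|n] in mnN f j fj *.
    by have := fj ord0; rewrite ord1 (ord1 j) eqxx.
  have g_lt i : unbump j (f i) < n.+1.
    have := ltn_ord (f i); have := ltn_ord j; have /eqP/val_eqP/= := fj i.
    by rewrite /unbump; case: ltnP => /=; lia.
  have g_mono (i k : 'I_m.+1) : i <= k -> Ordinal (g_lt i) <= Ordinal (g_lt k).
    by move/(dhom_mono f) => /=; rewrite /unbump; do 2 case: ltnP => /=; lia.
  rewrite (_ : f = dcomp (coface j) (mk_dhom g_mono)).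
    by apply: PM => //; apply: IHN; lia.
  apply: dhom_eq => i; rewrite !mk_dhomE /= unbumpK // inE.
  by have /eqP/val_eqP := fj i.
have {}surj j : exists i, f i = j.
  move: surj; rewrite negb_exists => /forallP/(_ j); rewrite negb_forall => /existsP[i].
  by rewrite negbK => /eqP; exists i.
case: m => [|m] in mnN f surj *.
  have n0 : n = 0.
    have [i fi] := surj ord0; have [k fk] := surj ord_max.
    by have := congr1 val fk; rewrite (ord1 k) -(ord1 i) fi /=.
  move: f surj {mnN}; rewrite n0 => f _.
  by rewrite (_ : f = did 0) //; apply: dhom_eq => i; rewrite !ord1.
have [/existsP[i /eqP fi]|inj] :=
    boolP [exists i : 'I_m.+1, f (widen_ord (leqnSn _) i) == f (lift ord0 i)].
  rewrite (_ : f = dcomp (dcomp f (coface (lift ord0 i))) (codegen i)).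
    by apply: PM => //; apply: IHN; lia.
  apply: dhom_eq => j; rewrite !mk_dhomE; have [ji|ji] := eqVneq (j : nat) i.+1.
    rewrite (_ : j = lift ord0 i) -?fi; last by apply: val_inj.
    by congr (nat_of_ord (f _)); apply: val_inj; rewrite /= /bump /unbump; lia.
  congr (nat_of_ord (f _)); apply: val_inj; rewrite /= /bump /unbump.
  by case: (ltnP i j) => /=; lia.
pose F i := nat_of_ord (f (inord i)).
have Flt i : i < m.+1 -> F i < F i.+1.
  move=> im; move: inj; rewrite negb_exists => /forallP/(_ (Ordinal im)).
  have -> : widen_ord (leqnSn m.+1) (Ordinal im) = inord i.
    by apply: val_inj; rewrite /= inordK // ltnW.
  have -> : lift ord0 (Ordinal im) = inord i.+1 by apply: val_inj; rewrite /= inordK.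
  move=> ne; rewrite ltn_neqAle; apply/andP; split=> //.
  by apply: dhom_mono; rewrite !inordK ?leqnSn // ltnW.
have Fle i j : i <= j -> j < m.+2 -> F i <= F j.
  by move=> ij jm; apply: dhom_mono; rewrite !inordK // (leq_ltn_trans ij).
have F_id i : i < m.+2 -> F i = i.
  elim: i => [_|i IHi im].
    have [j fj] := surj ord0; have := Fle 0 j (leq0n _) (ltn_ord j).
    have -> : F j = 0 by rewrite /F inord_val fj.
    by rewrite leqn0 => /eqP.
  have Fi := IHi (ltnW im); apply/eqP; rewrite eqn_leq -{3}Fi Flt // andbT.
  have lt_in : i.+1 < n.+1 by rewrite -{1}Fi (leq_ltn_trans (Flt _ im)) // ltn_ord.
  have [j fj] := surj (Ordinal lt_in).
  have Fj : F j = i.+1 by rewrite /F inord_val fj.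
  rewrite -{2}Fj; apply: (Fle) => //; rewrite ltnNge; apply/negP => ji.
  by have := Fle j i ji (ltnW im); rewrite Fj Fi ltnn.
have mn : n = m.+1.
  apply/eqP; rewrite eqn_leq; apply/andP; split; last first.
    by rewrite -(F_id m.+1) // -ltnS ltn_ord.
  have [j fj] := surj ord_max; have := F_id j (ltn_ord j).
  by rewrite /F inord_val fj /= => ->; rewrite -ltnS.
move: f @F F_id {surj inj Flt Fle mnN}; rewrite mn => f F F_id.
rewrite (_ : f = did _) //; apply: dhom_eq => i; rewrite mk_dhomE.
by have := F_id i (ltn_ord i); rewrite /F inord_val.
Qed.

Section Cyc.
Variable X : cset.

(* f commutes with powers of the cyclic operators, up to changing f *)
Definition good m n (f : dhom m n) := forall c, exists c' (g : dhom m n),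
  (forall i, dlift g (i + c') = dlift f i + c) /\
  (forall x : X n, fmap X f (iter c (@cyc X n) x) = iter c' (@cyc X m) (fmap X g x)).

Lemma goodM m n p (g : dhom n p) (f : dhom m n) : good g -> good f -> good (dcomp g f).
Proof.
move=> gg gf c; have [d [g' [g'P Xg]]] := gg c; have [e [f' [f'P Xf]]] := gf d.
exists e, (dcomp g' f'); split=> [i|x]; first by rewrite !dliftM f'P g'P.
by rewrite !sset_fmapM Xg Xf.
Qed.

Lemma good_did n : good (did n).
Proof.
by move=> c; exists c, (did n); split=> [i|x]; rewrite ?dlift_id // !(fmap1 X n).
Qed.

Lemma good_step m n (Q : dhom m n -> Prop) :
  (forall f, Q f -> exists c' (g : dhom m n), Q g /\
    (forall i, dlift g (i + c') = dlift f i + 1) /\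
    (forall x : X n, fmap X f (cyc x) = iter c' (@cyc X m) (fmap X g x))) ->
  forall f, Q f -> good f.
Proof.
move=> H f Qf c.
suff [d [g [_ ?]]] : exists c' (g : dhom m n), Q g /\
    (forall i, dlift g (i + c') = dlift f i + c) /\
    (forall x : X n, fmap X f (iter c (@cyc X n) x) = iter c' (@cyc X m) (fmap X g x)).
  by exists d, g.
elim: c => [|c [d [g [Qg [gP Xg]]]]].
  by exists 0, f; split=> //; split=> // i; rewrite !addn0.
have [e [h [Qh [hP Xh]]]] := H g Qg.
exists (d + e), h; split=> //; split=> [i|x].
  by rewrite addnA hP gP addn1 addnS.
by rewrite iterSr Xg Xh iterD.
Qed.

Lemma dlift_shiftP m n (f g : dhom m n) c d :
  (forall i : 'I_m.+1, dlift g (i + c) = dlift f i + d) ->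
  forall i, dlift g (i + c) = dlift f i + d.
Proof.
move=> h i; have := h (Ordinal (ltn_pmod i (ltn0Sn m))) => /= e.
by rewrite (divn_eq i m.+1) [_ * _ + _]addnC addnAC !dliftD e addnAC.
Qed.

Lemma dlift1 m n (f : dhom m n) k : k < m.+1 -> dlift f k = f (inord k).
Proof. by move=> km; rewrite /dlift modn_small // divn_small // addn0. Qed.

Lemma dliftN m n (f : dhom m n) k : m < k -> dlift f k = dlift f (k - m.+1) + n.+1.
Proof. by move=> mk; rewrite -[in LHS](subnK mk) -{2}[m.+1]mul1n dliftD mul1n. Qed.

Lemma good_coface n i : good (@coface n i).
Proof.
apply: (@good_step _ _ (fun f => exists j, f = coface j)); last by exists i.
move=> _ [j ->]; have [jn|nj] := ltnP j n.+1.
  exists 1, (coface (lift ord0 (Ordinal jn))); split; first by eexists.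
  split=> [|x].
    apply: dlift_shiftP => k; rewrite dlift_small mk_dhomE.
    have [kn|nk] := ltnP (k + 1) n.+1.
      rewrite dlift1 // mk_dhomE /= inordK // /bump /=; lia.
    rewrite dliftN ?dlift1 ?mk_dhomE /= ?inordK /bump; have := ltn_ord k; lia.
  by rewrite /= -face_cyc; congr (face _ _); apply: val_inj.
exists 0, (coface ord0); split; first by eexists.
have -> : j = ord_max by apply: val_inj; rewrite /=; have := ltn_ord j; lia.
split=> [|x]; last exact: face_cyc_max.
apply: dlift_shiftP => k; rewrite addn0 !dlift_small !mk_dhomE /= /bump /=.
by have := ltn_ord k; lia.
Qed.

Lemma good_codegen n i : good (@codegen n i).
Proof.
apply: (@good_step _ _ (fun f => exists j, f = codegen j)); last by exists i.
move=> _ [j ->]; have [jn|nj] := ltnP j n.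
  exists 1, (codegen (lift ord0 (Ordinal jn))); split; first by eexists.
  split=> [|x].
    apply: dlift_shiftP => k; rewrite dlift_small mk_dhomE.
    have [kn|nk] := ltnP (k + 1) n.+2.
      rewrite dlift1 // mk_dhomE /= inordK // /unbump /bump /=; lia.
    rewrite dliftN ?dlift1 ?mk_dhomE /= ?inordK /unbump /bump /=; have := ltn_ord k; lia.
  by rewrite /= -degen_cyc; congr (degen _ _); apply: val_inj.
exists 2, (codegen ord0); split; first by eexists.
have -> : j = ord_max by apply: val_inj; rewrite /=; have := ltn_ord j; lia.
split=> [|x]; last exact: degen_cyc_max.
apply: dlift_shiftP => k; rewrite dlift_small mk_dhomE.
have [kn|nk] := ltnP (k + 2) n.+2.
  rewrite dlift1 // mk_dhomE /= inordK // /unbump /=; lia.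
rewrite dliftN ?dlift1 ?mk_dhomE /= ?inordK /unbump /=; have := ltn_ord k; lia.
Qed.

Lemma all_good m n (f : dhom m n) : good f.
Proof.
move: m n f; apply: delta_ind.
- exact: good_did.
- exact: good_coface.
- exact: good_codegen.
- by move=> *; apply: goodM.
Qed.

Lemma dlift_shift_uniq m n (f g : dhom m n) c d :
  (forall i, dlift f (i + c) = dlift g (i + d)) -> c <= d.
Proof.
move=> fg; rewrite leqNgt; apply/negP => dc.
have h : d < c * m.+1 by rewrite (leq_trans dc) // leq_pmulr.
have e := fg (c * m.+1 - d.+1).
have : dlift g (c * m.+1 - d.+1 + d) < c * n.+1 by rewrite dlift_lt; lia.
by rewrite -e dlift_lt; lia.
Qed.

Lemma cyc_sd r m n (f : dhom m n) (x : X (sd_deg r n)) :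
  fmap X (sd_map r f) (iter n.+1 (@cyc X _) x) = iter m.+1 (@cyc X _) (fmap X (sd_map r f) x).
Proof.
have [c [g [gP ->]]] := all_good (sd_map r f) n.+1.
have gfP i : dlift g (i + c) = dlift (sd_map r f) (i + m.+1).
  by rewrite gP !dlift_sd; have := dliftD f i 1; rewrite !mul1n => ->.
have cm : c = m.+1.
  by apply/eqP; rewrite eqn_leq (dlift_shift_uniq gfP) (dlift_shift_uniq (fun i => esym (gfP i))).
rewrite cm in gfP *; congr (iter _ _ (fmap X _ _)); apply: dlift_inj => i.
apply/eqP; rewrite -(eqn_add2r (m.+1 * (sd_deg r n).+1)) -!dliftD.
have -> : i + m.+1 * (sd_deg r m).+1 = (i + m.+1 * sd_deg r m) + m.+1 by rewrite mulnS; lia.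
by rewrite gfP.
Qed.
End Cyc.

(* fixed by the generator t^(k+1) of the cyclic group of order r + 1 *)
Definition cyc_fixed (r : nat) (X : cset) (k : nat) (x : Sd r X k) : Prop :=
  iter k.+1 (@cyc X (sd_deg r k)) x = x.

Lemma cyc_fixed_closed r (X : cset) m n (a : dhom m n) (x : Sd r X n) :
  cyc_fixed x -> cyc_fixed (fmap (Sd r X) a x).
Proof. by rewrite /cyc_fixed => xP; rewrite -[in RHS]xP [RHS]cyc_sd. Qed.

Definition Phi_ob (r : nat) (X : cset) : SSet := subsset (@cyc_fixed_closed r X).

Lemma cmap_iter (X Y : cset) (f : cset_map X Y) n c (x : X n) :
  f n (iter c (@cyc X n) x) = iter c (@cyc Y n) (f n x).
Proof. by elim: c => //= c <-; rewrite cmap_cyc. Qed.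

Lemma Phi_map_subproof r (X Y : cset) (f : cset_map X Y) k (x : Sd r X k) :
  cyc_fixed x -> @cyc_fixed r Y k (f (sd_deg r k) x).
Proof. by rewrite /cyc_fixed -cmap_iter => ->. Qed.

Definition Phi_comp r (X Y : cset) (f : cset_map X Y) k (x : Phi_ob r X k) : Phi_ob r Y k :=
  exist _ (f (sd_deg r k) (sval x)) (@Phi_map_subproof r X Y f k _ (svalP x)).

Lemma Phi_comp_natural r (X Y : cset) (f : cset_map X Y) m n (a : dhom m n) (x : Phi_ob r X n) :
  Phi_comp f (fmap (Phi_ob r X) a x) = fmap (Phi_ob r Y) a (Phi_comp f x).
Proof.
apply: eq_exist => /=.
by have /(congr1 (fun h => h (sval x))) := ntP f (sd_map r a : @hom (op Delta) (sd_deg r n) (sd_deg r m)).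
Qed.

Definition Phi_map (r : nat) (X Y : cset) (f : cset_map X Y) :
    @hom SSet (Phi_ob r X) (Phi_ob r Y) :=
  @NatTrans (op Delta) Sets (Phi_ob r X) (Phi_ob r Y) (@Phi_comp r X Y f)
    (fun n m (a : dhom m n) => funext (Phi_comp_natural f a)).

(* [Phi r] is Phi_(r+1): the index r ranges over all of nat, so as to cover exactly the
   orders r >= 1 *)
Definition Phi (r : nat) : functor CSet SSet.
Proof.
apply: (@Functor CSet SSet (Phi_ob r) (@Phi_map r)).
- by move=> X; apply: nattrans_eq => k; apply: funext => -[x xP]; apply: eq_exist.
- by move=> X Y Z g f; apply: nattrans_eq => k; apply: funext => -[x xP]; apply: eq_exist.
Defined.

Definition cset_weq (R : realType) (X Y : CSet) (f : hom X Y) :=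
  forall r, sset_weq R (fmap (Phi r) f).
Definition cset_fibration (X Y : CSet) (f : hom X Y) :=
  forall r, kan_fibration (fmap (Phi r) f).
Definition cset_trivial_fibration (R : realType) (X Y : CSet) (f : hom X Y) :=
  cset_weq R f /\ cset_fibration f.
Definition cset_cofibration (R : realType) (A B : CSet) (i : hom A B) :=
  forall (X Y : CSet) (p : hom X Y), cset_trivial_fibration R p -> has_lift i p.
Definition cset_trivial_cofibration (R : realType) (A B : CSet) (i : hom A B) :=
  cset_cofibration R i /\ cset_weq R i.

Local Open Scope classical_set_scope.
Local Open Scope ring_scope.

Lemma idfun_continuous (T : topologicalType) : continuous (fun x : T => x).
Proof. by move=> x; exact: cvg_id. Qed.
Lemma fst_continuous (T U : topologicalType) : continuous (fst : T * U -> T).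
Proof. by move=> x; exact: cvg_fst. Qed.
Lemma snd_continuous (T U : topologicalType) : continuous (snd : T * U -> U).
Proof. by move=> x; exact: cvg_snd. Qed.
Lemma pair_continuous (T U V : topologicalType) (f : T -> U) (g : T -> V) :
  continuous f -> continuous g -> continuous (fun x => (f x, g x)).
Proof. by move=> fc gc x; exact: cvg_pair (fc x) (gc x). Qed.
Lemma comp_continuous (T U V : topologicalType) (f : T -> U) (g : U -> V) :
  continuous f -> continuous g -> continuous (fun x => g (f x)).
Proof. by move=> fc gc x; exact: continuous_comp (fc x) (gc (f x)). Qed.
Lemma val_continuous (T : topologicalType) (A : set T) : continuous (val : set_type A -> T).
Proof. exact: initial_continuous. Qed.

Definition top_map (X Y : topologicalType) := {f : X -> Y | continuous f}.

Definition top_id (X : topologicalType) : top_map X X := exist _ (fun x => x) (@idfun_continuous X).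

Definition top_comp (X Y Z : topologicalType) (g : top_map Y Z) (f : top_map X Y) : top_map X Z :=
  exist _ (fun x => sval g (sval f x)) (comp_continuous (svalP f) (svalP g)).

Lemma top_map_eq (X Y : topologicalType) (f g : top_map X Y) : sval f =1 sval g -> f = g.
Proof. by case: f g => [f fc] [g gc] /= /funext fg; exact: eq_exist. Qed.

Definition Top : category.
Proof.
by apply: (@Category topologicalType top_map top_id top_comp) => *; apply: top_map_eq.
Defined.

Definition set_elt (T : Type) (A : set T) (x : T) (Ax : A x) : set_type A :=
  exist _ x (mem_set Ax).

Definition circle (R : realType) : topologicalType :=
  set_type [set z : R * R | z.1 ^+ 2 + z.2 ^+ 2 = 1].

Lemma rot_subproof (R : realType) (z w : circle R) :
  [set z : R * R | z.1 ^+ 2 + z.2 ^+ 2 = 1]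
    ((val z).1 * (val w).1 - (val z).2 * (val w).2,
     (val z).1 * (val w).2 + (val z).2 * (val w).1).
Proof.
have /= zP := set_valP z; have /= wP := set_valP w; rewrite /= in zP wP *.
move: (val z).1 (val z).2 (val w).1 (val w).2 zP wP => a b c d zP wP.
transitivity ((a ^+ 2 + b ^+ 2) * (c ^+ 2 + d ^+ 2)); first by ring.
by rewrite zP wP mulr1.
Qed.

Definition circle_mul (R : realType) (z w : circle R) : circle R :=
  set_elt (rot_subproof z w).

Lemma circle1_subproof (R : realType) :
  [set z : R * R | z.1 ^+ 2 + z.2 ^+ 2 = 1] (1, 0).
Proof. by rewrite /= expr1n expr0n addr0. Qed.
Definition circle1 (R : realType) : circle R := set_elt (circle1_subproof R).

Lemma cexp_subproof (R : realType) (s : R) :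
  [set z : R * R | z.1 ^+ 2 + z.2 ^+ 2 = 1] (cos (pi *+ 2 * s), sin (pi *+ 2 * s)).
Proof. exact: cos2Dsin2. Qed.
(* exp (2 pi i s), the circle being the unit circle of the complex plane *)
Definition cexp (R : realType) (s : R) : circle R := set_elt (cexp_subproof s).

Lemma circle_eq (R : realType) (z w : circle R) :
  (val z).1 = (val w).1 -> (val z).2 = (val w).2 -> z = w.
Proof. by move=> e1 e2; apply: val_inj; rewrite [val z]surjective_pairing [val w]surjective_pairing e1 e2. Qed.

Lemma circle_mulA (R : realType) (x y z : circle R) :
  circle_mul x (circle_mul y z) = circle_mul (circle_mul x y) z.
Proof. by apply: circle_eq => /=; ring. Qed.
Lemma circle_mul1 (R : realType) (x : circle R) : circle_mul (circle1 R) x = x.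
Proof. by apply: circle_eq => /=; ring. Qed.
Lemma circle_mulr1 (R : realType) (x : circle R) : circle_mul x (circle1 R) = x.
Proof. by apply: circle_eq => /=; ring. Qed.
Lemma cexpD (R : realType) (s t : R) : cexp (s + t) = circle_mul (cexp s) (cexp t).
Proof. by apply: circle_eq => /=; rewrite mulrDr ?cosD ?sinD // addrC. Qed.
Lemma cexp0 (R : realType) : cexp (0 : R) = circle1 R.
Proof. by apply: circle_eq => /=; rewrite mulr0 ?cos0 ?sin0. Qed.
Lemma cexp1 (R : realType) : cexp (1 : R) = circle1 R.
Proof. by apply: circle_eq => /=; rewrite mulr1 ?cos2pi ?sin2pi. Qed.

Lemma cexp_continuous (R : realType) : continuous (@cexp R).
Proof.
apply: set_type_continuous => /=.
have h : continuous (fun s : R => pi *+ 2 * s) by move=> s; exact: mulrl_continuous.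
apply: pair_continuous.
  exact: comp_continuous h (@continuous_cos R).
exact: comp_continuous h (@continuous_sin R).
Qed.

Lemma circle_mul_continuous (R : realType) :
  continuous (fun zw : circle R * circle R => circle_mul zw.1 zw.2).
Proof.
apply: set_type_continuous => /=.
have c1 : continuous (fun zw : circle R * circle R => val zw.1).
  exact: comp_continuous (@fst_continuous _ _) (@val_continuous _ _).
have c2 : continuous (fun zw : circle R * circle R => val zw.2).
  exact: comp_continuous (@snd_continuous _ _) (@val_continuous _ _).
have c11 := comp_continuous c1 (@fst_continuous _ _).
have c12 := comp_continuous c1 (@snd_continuous _ _).
have c21 := comp_continuous c2 (@fst_continuous _ _).
have c22 := comp_continuous c2 (@snd_continuous _ _).
apply: pair_continuous => x.
  by apply: cvgB; apply: cvgM; [exact: c11|exact: c21|exact: c12|exact: c22].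
by apply: cvgD; apply: cvgM; [exact: c11|exact: c22|exact: c12|exact: c21].
Qed.

Record circle_space (R : realType) := CircleSpace {
  cspace :> topologicalType;
  cact : circle R -> cspace -> cspace;
  cact_continuous : continuous (fun zx : circle R * cspace => cact zx.1 zx.2);
  cact1 : forall x, cact (circle1 R) x = x;
  cactM : forall z w x, cact (circle_mul z w) x = cact z (cact w x) }.

Record circle_map (R : realType) (X Y : circle_space R) := CircleMap {
  cfun :> X -> Y;
  cfun_continuous : continuous cfun;
  cfun_equivariant : forall z x, cfun (cact z x) = cact z (cfun x) }.

Lemma circle_map_eq (R : realType) (X Y : circle_space R) (f g : circle_map X Y) :
  f =1 g -> f = g.
Proof.
case: f g => [f fc fe] [g gc ge] /= /funext fg; rewrite fg in fc fe *.
by congr CircleMap; exact: Prop_irrelevance.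
Qed.

Definition circle_id (R : realType) (X : circle_space R) : circle_map X X :=
  @CircleMap R X X (fun x => x) (@idfun_continuous X) (fun _ _ => erefl).

Lemma circle_comp_subproof (R : realType) (X Y Z : circle_space R)
    (g : circle_map Y Z) (f : circle_map X Y) z x :
  g (f (cact z x)) = cact z (g (f x)).
Proof. by rewrite !cfun_equivariant. Qed.

Definition circle_comp (R : realType) (X Y Z : circle_space R)
    (g : circle_map Y Z) (f : circle_map X Y) : circle_map X Z :=
  @CircleMap R X Z (fun x => g (f x))
    (comp_continuous (@cfun_continuous R X Y f) (@cfun_continuous R Y Z g))
    (circle_comp_subproof g f).

Definition CircleTop (R : realType) : category.
Proof.
by apply: (@Category (circle_space R) (@circle_map R) (@circle_id R) (@circle_comp R))
  => *; apply: circle_map_eq.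
Defined.

Definition triv (R : realType) (X : topologicalType) : circle_space R :=
  @CircleSpace R X (fun _ x => x) (@snd_continuous (circle R) X)
    (fun _ => erefl) (fun _ _ _ => erefl).

Definition triv_map (R : realType) (X Y : topologicalType) (f : top_map X Y) :
    circle_map (triv R X) (triv R Y) :=
  @CircleMap R (triv R X) (triv R Y) (sval f) (svalP f) (fun _ _ => erefl).

Definition trivial_action (R : realType) : functor Top (CircleTop R).
Proof.
apply: (@Functor Top (CircleTop R) (@triv R) (@triv_map R)).
- by move=> X; apply: circle_map_eq.
- by move=> X Y Z g f; apply: circle_map_eq.
Defined.

Definition geom_map (R : realType) m n (a : dhom m n) :
    top_map (tsimplex R m) (tsimplex R n) :=
  exist _ (tmap a) (@tmap_continuous R m n a).

Definition geom_simplex (R : realType) : functor Delta Top.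
Proof.
apply: (@Functor Delta Top (tsimplex R) (@geom_map R)).
- by move=> n; apply: top_map_eq => u; apply: tmap_id => i; exact: mk_dhomE.
- move=> m n p g f; apply: top_map_eq => u /=; rewrite tmap_comp.
  by apply: eq_tmap => i; exact: mk_dhomE.
Defined.

(* [lam n] is |Lambda[n]|_c = S^1 x |Delta[n]|, the circle acting by rotation of the
   first factor. Its cocyclic structure: cofaces and codegeneracies act on the simplex
   factor, and the cocyclic operator is
     (z, (u_0, ..., u_n)) |-> (z exp(2 pi i u_n), (u_n, u_0, ..., u_(n-1))). *)
Definition lam_act (R : realType) n (z : circle R) (p : circle R * tsimplex R n) :
  circle R * tsimplex R n := (circle_mul z p.1, p.2).

Lemma lam_act_continuous (R : realType) n :
  continuous (fun zp : circle R * (circle R * tsimplex R n)%type => lam_act zp.1 zp.2).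
Proof.
have c1 := @fst_continuous (circle R) (circle R * tsimplex R n)%type.
have c2 := @snd_continuous (circle R) (circle R * tsimplex R n)%type.
have c21 := comp_continuous c2 (@fst_continuous _ _).
have c22 := comp_continuous c2 (@snd_continuous _ _).
apply: pair_continuous => //.
exact: comp_continuous (pair_continuous c1 c21) (@circle_mul_continuous R).
Qed.

Definition lam (R : realType) (n : nat) : circle_space R.
Proof.
apply: (@CircleSpace R (circle R * tsimplex R n)%type (@lam_act R n) (@lam_act_continuous R n)).
- by move=> [z u]; rewrite /lam_act circle_mul1.
- by move=> z w [y u]; rewrite /lam_act /= circle_mulA.
Defined.

Lemma lam_map_subproof (R : realType) m n (a : dhom m n) :
  continuous (fun p : lam R m => (p.1, tmap a p.2) : lam R n).
Proof.
apply: pair_continuous; first exact: fst_continuous.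
exact: comp_continuous (@snd_continuous _ _) (@tmap_continuous R m n a).
Qed.
Definition lam_map (R : realType) m n (a : dhom m n) : circle_map (lam R m) (lam R n) :=
  @CircleMap R (lam R m) (lam R n) _ (@lam_map_subproof R m n a) (fun _ _ => erefl).

Lemma lam_cyc_continuous (R : realType) n :
  continuous (fun p : lam R n =>
    (circle_mul p.1 (cexp (val p.2 0 ord_max)), tmap (@ordS n.+1) p.2) : lam R n).
Proof.
have c1 := @fst_continuous (circle R) (tsimplex R n).
have c2 := @snd_continuous (circle R) (tsimplex R n).
apply: pair_continuous.
  have c3 := comp_continuous c2 (@simplex_coord_continuous R n ord_max).
  have c4 := comp_continuous c3 (@cexp_continuous R).
  exact: comp_continuous (pair_continuous c1 c4) (@circle_mul_continuous R).
exact: comp_continuous c2 (@tmap_continuous R n n _).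
Qed.

Lemma lam_cyc_equivariant (R : realType) n z (p : lam R n) :
  (circle_mul (cact z p).1 (cexp (val (cact z p).2 0 ord_max)), tmap (@ordS n.+1) (cact z p).2)
  = cact z ((circle_mul p.1 (cexp (val p.2 0 ord_max)), tmap (@ordS n.+1) p.2) : lam R n).
Proof. by rewrite /= /lam_act /= circle_mulA. Qed.

Definition lam_cyc (R : realType) n : circle_map (lam R n) (lam R n) :=
  CircleMap (@lam_cyc_continuous R n) (@lam_cyc_equivariant R n).

Lemma lam_eq (R : realType) n (z w : circle R) (u v : tsimplex R n) :
  z = w -> u = v -> (z, u) = (w, v) :> lam R n.
Proof. by move=> -> ->. Qed.

Lemma tmap_last (R : realType) m n (f : 'I_m.+1 -> 'I_n.+1) (u : tsimplex R m) (j : 'I_n.+1) (i : 'I_m.+1) :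
  (forall k, (f k == j) = (k == i)) -> val (tmap f u) 0 j = val u 0 i.
Proof. by move=> h; rewrite tmapE (eq_bigl (pred1 i)) ?big_pred1_eq. Qed.

Lemma lam_face_cyc (R : realType) n (i : 'I_n.+1) (p : lam R n) :
  lam_cyc R n.+1 (lam_map R (coface (widen_ord (leqnSn n.+1) i)) p) =
  lam_map R (coface (lift ord0 i)) (lam_cyc R n p).
Proof.
case: p => z u; apply: lam_eq => /=; last first.
  rewrite !tmap_comp; apply: eq_tmap => k; apply: val_inj => /=; rewrite !mk_dhomE /= /bump /=.
  have := ltn_ord i; have := ltn_ord k => k_lt i_lt.
  have [kn|kn] := eqVneq (k : nat) n.
    rewrite kn modnn (_ : ((i <= n)%N + n).+1 = n.+2) ?modnn //; lia.
  by rewrite !modn_small //; lia.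
congr (circle_mul _ (cexp _)); apply: tmap_last => k.
rewrite -!val_eqE /= mk_dhomE /= /bump; have := ltn_ord i; have := ltn_ord k; lia.
Qed.

Lemma lam_face_cyc_max (R : realType) n (p : lam R n) :
  lam_cyc R n.+1 (lam_map R (coface ord_max) p) = lam_map R (coface ord0) p.
Proof.
case: p => z u; apply: lam_eq => /=; last first.
  rewrite !tmap_comp; apply: eq_tmap => k; apply: val_inj => /=; rewrite !mk_dhomE /= /bump /=.
  by have k_lt := ltn_ord k; rewrite modn_small; lia.
rewrite tmapE big1 ?cexp0 ?circle_mulr1 // => k /eqP/(congr1 val).
rewrite mk_dhomE /= /bump; have := ltn_ord k; lia.
Qed.

Lemma lam_degen_cyc (R : realType) n (i : 'I_n) (p : lam R n.+1) :
  lam_cyc R n (lam_map R (codegen (widen_ord (leqnSn n) i)) p) =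
  lam_map R (codegen (lift ord0 i)) (lam_cyc R n.+1 p).
Proof.
case: p => z u; apply: lam_eq => /=; last first.
  rewrite !tmap_comp; apply: eq_tmap => k; apply: val_inj => /=; rewrite !mk_dhomE /= /unbump /bump /=.
  have := ltn_ord i; have := ltn_ord k => k_lt i_lt.
  have [kn|kn] := eqVneq (k : nat) n.+1.
    rewrite kn modnn (_ : (n.+1 - (i < n.+1)).+1 = n.+1) ?modnn //; lia.
  by rewrite !modn_small //; lia.
congr (circle_mul _ (cexp _)); apply: tmap_last => k.
rewrite -!val_eqE /= mk_dhomE /= /unbump; have := ltn_ord i; have := ltn_ord k; lia.
Qed.

Lemma lam_degen_cyc_max (R : realType) n (p : lam R n.+1) :
  lam_cyc R n (lam_map R (codegen ord_max) p) =
  lam_map R (codegen ord0) (lam_cyc R n.+1 (lam_cyc R n.+1 p)).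
Proof.
case: p => z u; apply: lam_eq => /=; last first.
  rewrite !tmap_comp; apply: eq_tmap => k; apply: val_inj => /=; rewrite !mk_dhomE /= /unbump /=.
  have k_lt := ltn_ord k.
  have [kn|kn] := eqVneq (k : nat) n.+1.
    by rewrite kn (modnn n.+2) /= ltnSn subn1 /= subSS subn0 modnn.
  have [kn'|kn'] := eqVneq (k : nat) n.
    by rewrite kn' ltnn subn0 (modnn n.+1) (modn_small (ltnSn n.+1)) (modnn n.+2).
  rewrite !modn_small //; lia.
rewrite -circle_mulA; congr (circle_mul _ _); rewrite -cexpD; congr cexp.
rewrite tmapE (bigD1 ord_max) /=; last by rewrite -val_eqE mk_dhomE /= /unbump ltnSn subn1.
have hn : (n < n.+2)%N by [].
congr (_ + _); rewrite (@tmap_last _ _ _ _ _ _ (Ordinal hn)).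
  rewrite (eq_bigl (pred1 (Ordinal hn))) ?big_pred1_eq // => k.
  rewrite -[RHS]/(nat_of_ord k == n) -!val_eqE /= mk_dhomE /= /unbump.
  by have := ltn_ord k; lia.
move=> k; rewrite -[RHS]/(nat_of_ord k == n) -val_eqE /=; have k_lt := ltn_ord k.
have [kn|kn] := eqVneq (k : nat) n.+1; first by rewrite kn modnn; lia.
by rewrite modn_small; lia.
Qed.

Lemma lam_cyc_iter (R : realType) n c (z : circle R) (u : tsimplex R n) : (c <= n.+1)%N ->
  iter c (lam_cyc R n) (z, u) =
  (circle_mul z (cexp (\sum_(i < n.+1 | (n.+1 - c <= i)%N) val u 0 i)), tmap (iter c (@ordS n.+1)) u) :> lam R n.
Proof.
elim: c => [_|c IHc cn] /=.
  rewrite tmap_id // big_pred0 ?cexp0 ?circle_mulr1 // => i.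
  by rewrite subn0 leqNgt ltn_ord.
rewrite IHc 1?ltnW //=; apply: lam_eq => /=; last by rewrite tmap_comp.
rewrite -circle_mulA -cexpD; congr (circle_mul _ (cexp _)).
have hc : (n - c < n.+1)%N by lia.
rewrite (@tmap_last _ _ _ _ _ _ (Ordinal hc)).
  rewrite [RHS](bigD1 (Ordinal hc)) /=; last by lia.
  rewrite addrC; congr (_ + _); apply: eq_bigl => i.
  rewrite -[i != _]/(nat_of_ord i != (n - c)%N); lia.
have ordE d (k : 'I_n.+1) : val (iter d (@ordS n.+1) k) = ((k + d) %% n.+1)%N.
  elim: d => [|d IHd] /=; first by rewrite addn0 modn_small.
  by rewrite IHd -addn1 modnDml addn1 addnS.
move=> k; rewrite -!val_eqE /= ordE; have k_lt := ltn_ord k.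
have [kc|kc] := ltnP (k + c) n.+1; first by rewrite modn_small; lia.
rewrite -(subnK kc) modnDr modn_small; lia.
Qed.

Lemma lam_cyc_order (R : realType) n (p : lam R n) : iter n.+1 (lam_cyc R n) p = p.
Proof.
case: p => z u; rewrite lam_cyc_iter //; apply: lam_eq.
  rewrite subnn -[RHS]circle_mulr1 -cexp1; congr (circle_mul _ (cexp _)).
  by have [_ <-] := set_valP u.
apply: tmap_id => i; apply: val_inj.
have ordE d (k : 'I_n.+1) : val (iter d (@ordS n.+1) k) = ((k + d) %% n.+1)%N.
  elim: d => [|d IHd] /=; first by rewrite addn0 modn_small.
  by rewrite IHd -addn1 modnDml addn1 addnS.
by rewrite ordE modnDr modn_small.
Qed.

Local Close Scope ring_scope.
Local Close Scope classical_set_scope.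

Lemma lam_map_id (R : realType) n : lam_map R (did n) = circle_id (lam R n).
Proof.
by apply: circle_map_eq => -[z u]; apply: lam_eq => //=; apply: tmap_id => i; exact: mk_dhomE.
Qed.

Lemma lam_map_comp (R : realType) m n p (g : dhom n p) (f : dhom m n) :
  lam_map R (dcomp g f) = circle_comp (lam_map R g) (lam_map R f).
Proof.
apply: circle_map_eq => -[z u]; apply: lam_eq => //=; rewrite tmap_comp.
by apply: eq_tmap => i; exact: mk_dhomE.
Qed.

Definition Sc_sset (R : realType) (Y : circle_space R) : functor (op Delta) Sets.
Proof.
apply: (@Functor (op Delta) Sets (fun n => circle_map (lam R n) Y)
  (fun n m (a : dhom m n) (f : circle_map (lam R n) Y) => circle_comp f (lam_map R a))).
- by move=> n; apply: funext => f; apply: circle_map_eq => p;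
  exact: (congr1 (fun h : circle_map _ _ => f (h p)) (lam_map_id R n)).
- by move=> n m p b a; apply: funext => f; apply: circle_map_eq => q;
  exact: (congr1 (fun h : circle_map _ _ => f (h q)) (lam_map_comp R a b)).
Defined.

Definition Sc_cyc (R : realType) (Y : circle_space R) n (f : Sc_sset Y n) : Sc_sset Y n :=
  circle_comp f (lam_cyc R n).

Lemma Sc_cyc_iter (R : realType) (Y : circle_space R) n c (f : Sc_sset Y n) p :
  iter c (@Sc_cyc R Y n) f p = f (iter c (lam_cyc R n) p).
Proof. by elim: c f p => //= c IHc f p; rewrite IHc -iterSr. Qed.

(* the hom from |Lambda[n]|_c to Y in degree n, t_n being composition with [lam_cyc] *)
Definition Sc_ob (R : realType) (Y : circle_space R) : cset.
Proof.
apply: (@CSetPack (Sc_sset Y) (@Sc_cyc R Y)).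
- by move=> n f; apply: circle_map_eq => p; rewrite Sc_cyc_iter lam_cyc_order.
- by move=> n i f; apply: circle_map_eq => p; exact: (congr1 (cfun f) (lam_face_cyc i p)).
- by move=> n f; apply: circle_map_eq => p; exact: (congr1 (cfun f) (lam_face_cyc_max p)).
- by move=> n i f; apply: circle_map_eq => p; exact: (congr1 (cfun f) (lam_degen_cyc i p)).
- by move=> n f; apply: circle_map_eq => p; exact: (congr1 (cfun f) (lam_degen_cyc_max p)).
Defined.

Definition Sc_nt (R : realType) (Y Z : circle_space R) (g : circle_map Y Z) :
  nattrans (Sc_ob Y) (Sc_ob Z).
Proof.
apply: (@NatTrans _ _ (Sc_ob Y) (Sc_ob Z) (fun n f => circle_comp g f)).
by move=> m n a; apply: funext => f; apply: circle_map_eq.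
Defined.

Definition Sc_map (R : realType) (Y Z : circle_space R) (g : circle_map Y Z) :
  cset_map (Sc_ob Y) (Sc_ob Z).
Proof. by apply: (@CSetMap _ _ (Sc_nt g)) => n f; apply: circle_map_eq. Defined.

Definition Sc (R : realType) : functor (CircleTop R) CSet.
Proof.
apply: (@Functor (CircleTop R) CSet (@Sc_ob R) (@Sc_map R)).
- by move=> Y; apply: cset_map_eq => n; apply: funext => f; apply: circle_map_eq.
- by move=> Y Z W h g; apply: cset_map_eq => n; apply: funext => f; apply: circle_map_eq.
Defined.

Definition nabla_simplex (R : realType) : functor Delta CSet :=
  functor_comp (Sc R) (functor_comp (trivial_action R) (geom_simplex R)).

(* The coend of X : Delta^op -> Sets and B : Delta -> CSet, computed degreewise:
   [tensor_level X k] is the quotient of the disjoint union over n of X_n x (B_n)_k by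
   (a^* x, y) ~ (x, a_* y). *)
Section Coend.
Variable B : functor Delta CSet.

Definition Bob n : cset := B n.
Definition Bmap m n (a : dhom m n) : cset_map (Bob m) (Bob n) := fmap B a.

Lemma Bmap_id n : Bmap (did n) = cset_id (Bob n).
Proof. exact: (fmap1 B n). Qed.
Lemma Bmap_comp m n p (g : dhom n p) (f : dhom m n) :
  Bmap (dcomp g f) = cset_cmp (Bmap g) (Bmap f).
Proof. exact: (@fmapM _ _ B m n p g f). Qed.

Definition tensor_pre (X : SSet) (k : nat) := {classic {n : nat & (X n * Bob n k)%type}}.

Definition tensor_elt (X : SSet) k n (x : X n) (y : Bob n k) : tensor_pre X k :=
  existT (fun n : nat => (X n * Bob n k)%type) n (x, y).

Inductive tensor_rel (X : SSet) k : tensor_pre X k -> tensor_pre X k -> Prop :=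
| TensorRel m n (a : dhom m n) (x : X n) (y : Bob m k) :
    tensor_rel (tensor_elt (fmap X a x) y) (tensor_elt x (Bmap a k y)).

Definition tensor_level (X : SSet) k := quot (@tensor_rel X k).

Definition tensor (X : SSet) k n (x : X n) (y : Bob n k) : tensor_level X k :=
  qclass _ (tensor_elt x y).

Definition tensor_on (X Y : SSet) k l (f : forall n, X n -> Y n) (g : forall n, Bob n k -> Bob n l)
    (q : tensor_pre X k) : tensor_pre Y l :=
  tensor_elt (f _ (projT2 q).1) (g _ (projT2 q).2).

Definition tensor_map (X Y : SSet) k l (f : forall n, X n -> Y n) (g : forall n, Bob n k -> Bob n l) :
    tensor_level X k -> tensor_level Y l :=
  qmap (@tensor_rel Y l) (tensor_on f g).

Lemma tensor_mapE (X Y : SSet) k l (f : hom X Y) (g : forall n, Bob n k -> Bob n l) :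
  (forall m n (a : dhom m n) y, g n (Bmap a k y) = Bmap a l (g m y)) ->
  forall n (x : X n) (y : Bob n k), tensor_map f g (tensor x y) = tensor (f n x) (g n y).
Proof.
move=> gP n x y; rewrite /tensor_map /tensor qmapE // => _ _ [p q a z w].
rewrite /tensor_on /= gP.
have /(congr1 (fun h => h z)) /= -> := ntP f (a : @hom (op Delta) q p).
exact: TensorRel.
Qed.

Lemma tensor_ind (X : SSet) k (P : tensor_level X k -> Prop) :
  (forall n (x : X n) (y : Bob n k), P (tensor x y)) -> forall q, P q.
Proof. by move=> H q; have [[n [x y]] ->] := quotW q; exact: H. Qed.

Lemma Bmap_natural m n (a : dhom m n) k l (b : dhom l k) (y : Bob m k) :
  fmap (Bob n) b (Bmap a k y) = Bmap a l (fmap (Bob m) b y).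
Proof. by have /(congr1 (fun h => h y)) /= -> := ntP (Bmap a) (b : @hom (op Delta) k l). Qed.

Lemma tensor_faceE (X : SSet) k l (b : dhom l k) n (x : X n) (y : Bob n k) :
  tensor_map (idm X) (fun n => fmap (Bob n) b) (tensor x y) = tensor x (fmap (Bob n) b y).
Proof. by rewrite tensor_mapE // => *; exact: Bmap_natural. Qed.

Lemma tensor_cycE (X : SSet) k n (x : X n) (y : Bob n k) :
  tensor_map (idm X) (fun n => @cyc (Bob n) k) (tensor x y) = tensor x (cyc y).
Proof. by rewrite tensor_mapE // => *; rewrite cmap_cyc. Qed.

Lemma tensor_funE (X Y : SSet) (f : hom X Y) k n (x : X n) (y : Bob n k) :
  tensor_map f (fun n => id) (tensor x y) = tensor (f n x) y.
Proof. by rewrite tensor_mapE. Qed.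

Definition tensor_sset (X : SSet) : functor (op Delta) Sets.
Proof.
apply: (@Functor (op Delta) Sets (tensor_level X)
  (fun k l (b : dhom l k) => tensor_map (idm X) (fun n => fmap (Bob n) b))).
- move=> k; apply: funext; apply: tensor_ind => n x y; rewrite tensor_faceE.
  by rewrite [fmap _ _](fmap1 (Bob n) k).
- move=> k l m c b; apply: funext; apply: tensor_ind => n x y.
  rewrite -[RHS]/(tensor_map (idm X) (fun n => fmap (Bob n) c)
    (tensor_map (idm X) (fun n => fmap (Bob n) b) (tensor x y))).
  rewrite !tensor_faceE; exact: (congr1 (@tensor X m n x) (sset_fmapM (X := Bob n) _ _ y)).
Defined.

Definition tensor_cyc (X : SSet) k : tensor_sset X k -> tensor_sset X k :=
  tensor_map (idm X) (fun n => @cyc (Bob n) k).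

Lemma tensor_fmapE (X : SSet) k l (b : dhom l k) n (x : X n) (y : Bob n k) :
  fmap (tensor_sset X) (b : @hom (op Delta) k l) (tensor x y) = tensor x (fmap (Bob n) b y).
Proof. exact: tensor_faceE. Qed.

Lemma tensor_cycE' (X : SSet) k n (x : X n) (y : Bob n k) :
  @tensor_cyc X k (tensor x y) = tensor x (cyc y).
Proof. exact: tensor_cycE. Qed.

Lemma tensor_cyc_iter (X : SSet) k c n (x : X n) (y : Bob n k) :
  iter c (@tensor_cyc X k) (tensor x y) = tensor x (iter c (@cyc (Bob n) k) y).
Proof. by elim: c => //= c ->; exact: tensor_cycE. Qed.

Definition tensor_ob (X : SSet) : cset.
Proof.
apply: (@CSetPack (tensor_sset X) (@tensor_cyc X)).
- by move=> k; apply: tensor_ind => n x y; rewrite tensor_cyc_iter cyc_order.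
- move=> k i; apply: tensor_ind => n x y; rewrite /face.
  by rewrite !(tensor_cycE', tensor_fmapE); exact: (congr1 (tensor x) (face_cyc _ y)).
- move=> k; apply: tensor_ind => n x y; rewrite /face.
  by rewrite !(tensor_cycE', tensor_fmapE); exact: (congr1 (tensor x) (face_cyc_max y)).
- move=> k i; apply: tensor_ind => n x y; rewrite /degen.
  by rewrite !(tensor_cycE', tensor_fmapE); exact: (congr1 (tensor x) (degen_cyc _ y)).
- move=> k; apply: tensor_ind => n x y; rewrite /degen.
  by rewrite !(tensor_cycE', tensor_fmapE); exact: (congr1 (tensor x) (degen_cyc_max y)).
Defined.

Definition tensor_nt (X Y : SSet) (f : hom X Y) : nattrans (tensor_ob X) (tensor_ob Y).
Proof.
apply: (@NatTrans (op Delta) Sets (tensor_ob X) (tensor_ob Y)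
  (fun k => tensor_map f (fun n => id))).
move=> k l b; apply: funext; apply: tensor_ind => n x y.
rewrite -[LHS]/(tensor_map f (fun=> id) (fmap (tensor_sset X) b (tensor x y))).
rewrite -[RHS]/(fmap (tensor_sset Y) b (tensor_map f (fun=> id) (tensor x y))).
by rewrite !(tensor_funE, tensor_fmapE).
Defined.

Definition tensor_hom (X Y : SSet) (f : hom X Y) : cset_map (tensor_ob X) (tensor_ob Y).
Proof.
apply: (@CSetMap _ _ (tensor_nt f)) => k; apply: tensor_ind => n x y.
rewrite -[LHS]/(tensor_map f (fun=> id) (tensor_cyc (tensor x y))).
rewrite -[RHS]/(tensor_cyc (tensor_map f (fun=> id) (tensor x y))).
by rewrite !(tensor_funE, tensor_cycE').
Defined.

Definition tensor_functor : functor SSet CSet.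
Proof.
apply: (@Functor SSet CSet tensor_ob tensor_hom).
- by move=> X; apply: cset_map_eq => k; apply: funext; apply: tensor_ind => n x y; exact: tensor_funE.
- move=> X Y Z g f; apply: cset_map_eq => k; apply: funext; apply: tensor_ind => n x y.
  rewrite -[RHS]/(tensor_map g (fun=> id) (tensor_map f (fun=> id) (tensor x y))).
  by rewrite !tensor_funE; exact: tensor_funE.
Defined.
End Coend.

Definition nabla (R : realType) : functor SSet CSet := tensor_functor (nabla_simplex R).

(* the category P of the functor N: triples (A, B, N A -> B) *)
Record P_ob (N : functor SSet CSet) := POb {
  gsset : SSet;
  gcset : CSet;
  gmap : hom (N gsset) gcset }.

Record P_map (N : functor SSet CSet) (x y : P_ob N) := PMap {
  gmap_sset : hom (gsset x) (gsset y);
  gmap_cset : hom (gcset x) (gcset y);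
  gmapP : gmap_cset \oc gmap x = gmap y \oc fmap N gmap_sset }.

(* the map induced from the pushout of N A' <- N A -> B to B' is a trivial cofibration *)
Definition corner_trivial_cofibration (R : realType) (N : functor SSet CSet)
    (x y : P_ob N) (f : P_map x y) :=
  exists (Q : CSet) (i : hom (N (gsset y)) Q) (j : hom (gcset x) Q) (u : hom Q (gcset y)),
    [/\ is_pushout (fmap N (gmap_sset f)) (gmap x) i j,
        u \oc i = gmap y, u \oc j = gmap_cset f
      & cset_trivial_cofibration R u].

Definition Reedy_admissible (R : realType) (N : functor SSet CSet) :=
  preserves_colimits N /\
  forall (x y : P_ob N) (f : P_map x y),
    sset_trivial_cofibration R (gmap_sset f) ->
    corner_trivial_cofibration R f ->
    cset_weq R (gmap_cset f).

(* Main.v *)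
From HB Require Import structures.
From mathcomp Require Import all_boot all_order all_algebra generic_quotient.
From mathcomp Require Import all_classical all_reals all_analysis.
From mathcomp Require Import zify ring lra.
Require Import Defs.

(** Colimits: nabla is left adjoint to C |-> hom(nabla_n, C).

    Let A -> A' be a trivial cofibration, and write G = Phi_r nabla. As B -> B' factors through
    the pushout Q of B <- nabla A -> nabla A', by a weak equivalence Q -> B', it is enough that
    |Phi_r B| is a deformation retract of |Phi_r Q|. Since nabla preserves monomorphisms,
    Phi_r Q is the pushout of Phi_r B <- G A -> G A', so it is enough that |G A| is a deformation
    retract of |G A'|.

    A k-simplex of G A is a class x (x) y with x in A_n and y a Z/r-invariant map from
    Delta^(r(k+1)-1) to Delta^n. Evaluating y on the first block of vertices gives
    rho : |G A| -> |A|, and x |-> x (x) pr, with pr reducing vertices modulo n + 1, gives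
    iota : |A| -> |G A|. The affine join y * pr is a simplex of which y and pr are faces, so
    straight lines in it deform the identity of |G A| to iota rho, naturally in A. Hence discs
    of |G A'| with boundary in |G A| compress into |G A|, because those of |A'| compress
    into |A|. For a monomorphism, such compressions can be chosen compatibly on all
    simplices. *)

Set Implicit Arguments.
Unset Strict Implicit.
Unset Printing Implicit Defensive.

Import Order.TTheory GRing.Theory Num.Theory.
Import numFieldNormedType.Exports.
Local Open Scope classical_set_scope.
Local Open Scope ring_scope.

(** * Continuity on subsets *)

(** The hypothesis on A -> A' concerns homotopy sets only, while gluing along a pushout needs an
    honest deformation, stationary on the subspace. Compression of discs mediates between the two:
    it follows from a weak equivalence, it is carried along by homotopies natural in A, and, applied
    to one simplex at a time relative to its boundary, it produces the deformation.

    The second obstacle is that taking fixed points need not commute with a coend. Every class x (x)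
    y has a unique reduced form, in which x is nondegenerate and the image of y lies in no proper
    face. The cyclic operators preserve reducedness, so a fixed class has a fixed representative.

    Finally, no simplicial operator relates y to pr. The join is available because the simplices of
    nabla_n are arbitrary continuous maps: y * pr is again one of them, in dimension r(k+n+2)-1, and
    it is invariant because y and pr are.

    Discs are unit balls of ['rV], whose norm is the sup norm; they are therefore cubes, and
    topological simplices are compared with them radially. *)

Lemma within_comp (T U V : topologicalType) (A : set U) (B : set T) (f : U -> V) (g : T -> U) :
  {within A, continuous f} -> {within B, continuous g} -> (forall x, B x -> A (g x)) ->
  {within B, continuous (fun x => f (g x))}.
Proof.
move=> /subspace_continuousP fc /subspace_continuousP gc BA.
apply/subspace_continuousP => x Bx W /(fc _ (BA _ Bx)) Wx.
have h : \forall y \near x, B y -> A (g y) -> W (f (g y)) := gc x Bx _ Wx.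
apply: filterS h => y h By; apply: h => //; exact: BA.
Qed.

Lemma within_pair (T U V : topologicalType) (B : set T) (f : T -> U) (g : T -> V) :
  {within B, continuous f} -> {within B, continuous g} ->
  {within B, continuous (fun x => (f x, g x))}.
Proof. by move=> fc gc; apply: pair_continuous. Qed.

Lemma within_eq (T U : topologicalType) (B : set T) (f g : T -> U) :
  (forall x, B x -> f x = g x) -> {within B, continuous f} -> {within B, continuous g}.
Proof. by move=> fg; apply: subspace_eq_continuous => x /set_mem; exact: fg. Qed.

Lemma withinP (T U : topologicalType) (f : T -> U) : continuous f <-> {within setT, continuous f}.
Proof. by split=> h; [exact: (continuous_subspaceT h)|exact: (iffRL (continuous_subspace_setT f) h)]. Qed.

Lemma continuous_within (T U : topologicalType) (B : set T) (f : T -> U) :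
  continuous f -> {within B, continuous f}.
Proof. exact: continuous_subspaceT. Qed.

Lemma continuous_comp_within (T U V : topologicalType) (B : set T) (f : U -> V) (g : T -> U) :
  continuous f -> {within B, continuous g} -> {within B, continuous (fun x => f (g x))}.
Proof. by move=> /withinP fc gc; exact: (within_comp fc gc). Qed.

Lemma within_comp_continuous (T U V : topologicalType) (A : set U) (f : U -> V) (g : T -> U) :
  {within A, continuous f} -> continuous g -> (forall x, A (g x)) -> continuous (fun x => f (g x)).
Proof. by move=> fc /withinP gc Ag; apply/withinP/(within_comp fc gc). Qed.

Lemma within_paste (T U : topologicalType) (A B C : set T) (f : T -> U) :
  closed A -> closed B -> (forall x, C x -> A x \/ B x) ->
  {within A `&` C, continuous f} -> {within B `&` C, continuous f} ->
  {within C, continuous f}.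
Proof.
move=> Ac Bc CAB /subspace_continuousP fA /subspace_continuousP fB.
apply/subspace_continuousP => x Cx W fx.
(* Outside the closed set [D] the condition holds vacuously on a neighbourhood; this settles the
   points that lie in only one of the two pieces. *)
have sub (D : set T) : closed D ->
    (forall y, (D `&` C) y -> f @ within (D `&` C) (nbhs y) --> f y) ->
    \forall y \near x, D y -> C y -> W (f y).
  move=> Dc fD; have [Dx|nDx] := pselect (D x).
    have h : \forall y \near x, (D `&` C) y -> W (f y) := fD x (conj Dx Cx) _ fx.
    by apply: filterS h => y h Dy Cy; exact: h.
  have : nbhs x (~` D) by apply: open_nbhs_nbhs; split => //; rewrite openC.
  by apply: filterS => y nDy /nDy.
have hA := sub A Ac fA; have hB := sub B Bc fB.
rewrite /= nbhs_simpl /= /within /=; apply: filterS2 hA hB => y hA hB Cy.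
by case: (CAB y Cy) => ?; [exact: hA|exact: hB].
Qed.

Lemma within_paste_fin (T U : topologicalType) (I : finType) (A : I -> set T) (C : set T) (f : T -> U) :
  (forall i, closed (A i)) -> (forall x, C x -> exists i, A i x) ->
  (forall i, {within A i `&` C, continuous f}) -> {within C, continuous f}.
Proof.
move=> Ac CA fA; apply/subspace_continuousP => x Cx W fx.
have : \forall y \near x, forall i, A i y -> C y -> W (f y).
  apply: filter_forall => i; have [Dx|nDx] := pselect (A i x).
    have /subspace_continuousP fi := fA i.
    have h : \forall y \near x, (A i `&` C) y -> W (f y) := fi x (conj Dx Cx) _ fx.
    by apply: filterS h => y h Dy Cy; exact: h.
  have : nbhs x (~` A i) by apply: open_nbhs_nbhs; split => //; rewrite openC.
  by apply: filterS => y nDy /nDy.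
move=> h; rewrite /within /= nbhs_simpl /=; apply: filterS h => y h Cy.
by have [i Ai] := CA y Cy; exact: (h i).
Qed.

Section RealFunctions.
Variables (R : realType) (T : topologicalType).
Implicit Types f g : T -> R.

Lemma contD f g : continuous f -> continuous g -> continuous (fun x => f x + g x).
Proof. by move=> fc gc x; apply: cvgD; [exact: fc|exact: gc]. Qed.
Lemma contB f g : continuous f -> continuous g -> continuous (fun x => f x - g x).
Proof. by move=> fc gc x; apply: cvgB; [exact: fc|exact: gc]. Qed.
Lemma contM f g : continuous f -> continuous g -> continuous (fun x => f x * g x).
Proof. by move=> fc gc x; apply: cvgM; [exact: fc|exact: gc]. Qed.
Lemma contV f : continuous f -> (forall x, f x != 0) -> continuous (fun x => (f x)^-1).
Proof. by move=> fc f0 x; apply: cvgV => //; exact: fc. Qed.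
Lemma cont_max f g : continuous f -> continuous g -> continuous (fun x => Num.max (f x) (g x)).
Proof. by move=> fc gc x; apply: continuous_max; [exact: fc|exact: gc]. Qed.
Lemma cont_min f g : continuous f -> continuous g -> continuous (fun x => Num.min (f x) (g x)).
Proof. by move=> fc gc x; apply: continuous_min; [exact: fc|exact: gc]. Qed.
Lemma cont_cst (c : R) : continuous (fun _ : T => c).
Proof. exact: cst_continuous. Qed.
Lemma cont_norm (V : normedModType R) (f : T -> V) : continuous f -> continuous (fun x => `|f x|).
Proof. by move=> fc x; apply: cvg_norm; exact: fc. Qed.
Lemma contZ (V : normedModType R) f (v : T -> V) : continuous f -> continuous v ->
  continuous (fun x => f x *: v x).
Proof. by move=> fc vc x; apply: cvgZ; [exact: fc|exact: vc]. Qed.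
Lemma contDv (V : normedModType R) (v w : T -> V) : continuous v -> continuous w ->
  continuous (fun x => v x + w x).
Proof. by move=> fc vc x; apply: cvgD; [exact: fc|exact: vc]. Qed.

Lemma closed_le f g : continuous f -> continuous g -> closed [set x | f x <= g x].
Proof.
move=> fc gc; rewrite (_ : mkset _ = (fun x => g x - f x) @^-1` [set y | 0 <= y]).
  by apply: closed_comp; [move=> x _; exact: contB | exact: closed_ge].
by apply/funext => x /=; rewrite subr_ge0.
Qed.
End RealFunctions.

(** * Maps out of a realization *)

Section Realization.
Variable R : realType.
Local Notation I := (unit_interval R).

Definition rpt (X : SSet) n (x : X n) (u : tsimplex R n) : realization R X :=
  qclass (@glue R X) (cell x u).

Lemma rpt_ind (X : SSet) (P : realization R X -> Prop) :
  (forall n (x : X n) u, P (rpt x u)) -> forall p, P p.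
Proof. by move=> h p; have [[[n x] u] ->] := quotW p; exact: h. Qed.

Lemma rpt_glue (X : SSet) m n (a : dhom m n) (x : X n) (u : tsimplex R m) :
  rpt (fmap X a x) u = rpt x (tmap a u).
Proof. exact/qclassP/Glue. Qed.

Lemma realization_map_rpt (X Y : SSet) (f : hom X Y) n (x : X n) (u : tsimplex R n) :
  realization_map f (rpt x u) = rpt (f n x) u.
Proof. exact: realization_mapE. Qed.

Lemma rpt_continuous (X : SSet) n (x : X n) : continuous (fun u : tsimplex R n => rpt x u).
Proof.
have h1 : continuous (fun u : tsimplex R n => cell x u).
  exact: (@existT_continuous _ (fun s : {classic {n : nat & X n}} => tsimplex R (projT1 s))
    (existT _ n x)).
exact: (@comp_continuous _ _ (realization R X) _ _ h1 (@pi_continuous _ (quot (@glue R X)))).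
Qed.

Lemma realization_rec (X : SSet) (Z : topologicalType) (h : forall n, X n -> tsimplex R n -> Z) :
  (forall n x, continuous (h n x)) ->
  (forall m n (a : dhom m n) (x : X n) u, h m (fmap X a x) u = h n x (tmap a u)) ->
  exists H : realization R X -> Z, continuous H /\ forall n x u, H (rpt x u) = h n x u.
Proof.
move=> hc hP; pose g (c : cells R X) := h _ (projT2 (projT1 c)) (projT2 c).
have gP a b : glue a b -> g a = g b by case=> m n e x u; exact: hP.
pose H (q : realization R X) := g (repr (q : quot (@glue R X))).
have HE c : H (qclass (@glue R X) c) = g c.
  by apply: (qclass_compat gP); rewrite /qclass reprK.
exists H; split; last by move=> n x u; rewrite HE.
apply/quotient_continuous.
have -> : H \o \pi_(realization R X)%qT = g by apply: funext => c; exact: HE.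
by apply: (@sigT_continuous _ (fun s : {classic {n : nat & X n}} => tsimplex R (projT1 s)) Z
  (fun s => h (projT1 s) (projT2 s))) => -[n x]; exact: hc.
Qed.

(** Clamping makes the passage from real times to the unit interval total and continuous, so that
    homotopies can be written with real parameters. *)
Definition ui_of (t : R) : R := Num.max 0 (Num.min 1 t).
Lemma ui_subproof t : `[0, 1]%classic (ui_of t).
Proof.
rewrite /= in_itv /= /ui_of le_max lexx /= ge_max ler01 /=.
by rewrite ge_min lexx.
Qed.
Definition ui (t : R) : I := set_elt (ui_subproof t).

Lemma val_ui (t : R) : 0 <= t <= 1 -> val (ui t) = t.
Proof. by case/andP=> t0 t1; rewrite /= /ui_of; rewrite min_r // max_r. Qed.

Lemma ui_val (t : I) : ui (val t) = t.
Proof. by apply: val_inj; apply: val_ui; have := set_valP t; rewrite /= in_itv. Qed.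

Lemma ui_range (t : I) : 0 <= val t <= 1.
Proof. by have := set_valP t; rewrite /= in_itv. Qed.

Lemma ui_continuous : continuous ui.
Proof.
apply: set_type_continuous => /=; apply: cont_max; first exact: cont_cst.
by apply: cont_min; [exact: cont_cst | exact: idfun_continuous].
Qed.

(** The product of a quotient map with the interval is handled by currying: a homotopy is a map into
    a path space with the compact-open topology. The paths are indexed by all of [R], which is
    locally compact and regular, and restricted to the interval afterwards. *)
Lemma realization_rec_htpy (X : SSet) (Z : topologicalType)
    (h : forall n, X n -> tsimplex R n * I -> Z) :
  (forall n x, continuous (h n x)) ->
  (forall m n (a : dhom m n) (x : X n) u t, h m (fmap X a x) (u, t) = h n x (tmap a u, t)) ->
  exists H : realization R X * I -> Z, continuous H /\
    forall n x u t, H (rpt x u, t) = h n x (u, t).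
Proof.
move=> hc hP.
pose k n (x : X n) (u : tsimplex R n) : {compact-open, R -> Z} := fun t => h n x (u, ui t).
have kc n x : continuous (fun p : tsimplex R n * R => h n x (p.1, ui p.2)).
  apply: (comp_continuous _ (hc n x)); apply: pair_continuous; first exact: fst_continuous.
  exact: comp_continuous (@snd_continuous _ _) ui_continuous.
have [|m n a x u|K [Kc KE]] := @realization_rec X {compact-open, R -> Z} k.
- by move=> n x; exact: (continuous_curry (kc n x)).1.
- by apply: funext => t; exact: hP.
exists (fun p => K p.1 (val p.2)); split; last by move=> n x u t; rewrite /= KE /k ui_val.
apply: (comp_continuous (f := fun p : realization R X * I => (p.1, val p.2 : R))
  (g := uncurry K)).
  apply: pair_continuous; first exact: fst_continuous.
  exact: comp_continuous (@snd_continuous _ _) (@val_continuous _ _).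
apply: continuous_uncurry_regular => //.
- exact: locally_compactR.
- exact: uniform_regular.
apply: rpt_ind => n x u; rewrite KE; exact: (continuous_curry (kc n x)).2.
Qed.

End Realization.

(** * Deforming discs *)

Lemma within_if (R : realType) (T U : topologicalType) (C : set T) (a b : T -> R) (f g : T -> U) :
  continuous a -> continuous b ->
  {within [set x | a x <= b x] `&` C, continuous f} ->
  {within [set x | b x <= a x] `&` C, continuous g} ->
  (forall x, C x -> a x = b x -> f x = g x) ->
  {within C, continuous (fun x => if a x <= b x then f x else g x)}.
Proof.
move=> ac bc fc gc fg.
apply: (@within_paste _ _ [set x | a x <= b x] [set x | b x <= a x]); try exact: closed_le.
- by move=> x _; case: (leP (a x) (b x)) => [|/ltW]; [left|right].
- by apply: within_eq fc => x [/= -> _].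
- apply: within_eq gc => x [/= ba Cx]; case: ifP => // ab.
  by rewrite fg //; apply/eqP; rewrite eq_le ab ba.
Qed.

Section Ball.
Variables (R : realType) (n : nat).
Local Notation V := 'rV[R]_n.

Definition disc : set V := [set v | `|v| <= 1].
Definition sphere : set V := [set v | `|v| = 1].
Definition cyl : set (V * R) := [set p | `|p.1| <= 1 /\ 0 <= p.2 <= 1].
Definition side : set (V * R) := [set p | `|p.1| = 1 /\ 0 <= p.2 <= 1].
Definition topside : set (V * R) := [set p | cyl p /\ (p.2 = 1 \/ `|p.1| = 1)].

(* [p |-> (pos p, depth p)] is a retraction of the cylinder onto its bottom and its side:
   at time [t] the disc is dilated by [1 + t], and what leaves it climbs the side. *)
Definition pos (p : V * R) : V := ((1 + p.2) / Num.max 1 ((1 + p.2) * `|p.1|)) *: p.1.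
Definition depth (p : V * R) : R := Num.max 0 ((1 + p.2) * `|p.1| - 1).

Lemma fst_cont : continuous (fst : V * R -> V). Proof. exact: fst_continuous. Qed.
Lemma snd_cont : continuous (snd : V * R -> R). Proof. exact: snd_continuous. Qed.

Lemma stretch_cont : continuous (fun p : V * R => (1 + p.2) * `|p.1|).
Proof.
apply: contM; first by apply: contD; [exact: cont_cst | exact: snd_cont].
by apply: cont_norm; exact: fst_cont.
Qed.

Lemma pos_cont : continuous pos.
Proof.
apply: contZ; last exact: fst_cont.
apply: contM; first by apply: contD; [exact: cont_cst | exact: snd_cont].
apply: contV.
  by apply: cont_max; [exact: cont_cst | exact: stretch_cont].
by move=> p; rewrite gt_eqF // lt_max ltr01.
Qed.

Lemma depth_cont : continuous depth.
Proof.
apply: cont_max; first exact: cont_cst.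
by apply: contB; [exact: stretch_cont | exact: cont_cst].
Qed.

Lemma pos_norm (p : V * R) : 0 <= p.2 ->
  `|pos p| = Num.min 1 ((1 + p.2) * `|p.1|).
Proof.
move=> t0; have h0 : 0 <= (1 + p.2) * `|p.1| by rewrite mulr_ge0 // addr_ge0.
rewrite /pos normrZ ger0_norm; last by rewrite divr_ge0 ?addr_ge0 // le_max ler01.
rewrite mulrAC; case: leP => h; last by rewrite divr1.
by rewrite divff // gt_eqF // (lt_le_trans ltr01).
Qed.

Lemma pos_disc (p : V * R) : 0 <= p.2 -> `|pos p| <= 1.
Proof. by move=> t0; rewrite pos_norm // ge_min lexx. Qed.

Lemma depth_pos (p : V * R) : 0 <= p.2 -> depth p = 0 \/ `|pos p| = 1.
Proof.
move=> t0; rewrite pos_norm // /depth; case: (leP ((1 + p.2) * `|p.1|) 1) => h.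
  by left; rewrite max_l // subr_le0.
by right.
Qed.

Lemma depth_range (p : V * R) : cyl p -> 0 <= depth p <= p.2.
Proof.
case: p => v t [/= v1 /andP[t0 t1]]; rewrite /depth /= le_max lexx ge_max t0 /=.
by have := ler_wpM2l (addr_ge0 ler01 t0) v1; rewrite mulr1 lerBlDl.
Qed.

Lemma pos0 v : `|v| <= 1 -> pos (v, 0) = v.
Proof. by move=> v1; rewrite /pos /= addr0 !mul1r max_l // invr1 scale1r. Qed.
Lemma depth0 v : `|v| <= 1 -> depth (v, 0) = 0.
Proof. by move=> v1; rewrite /depth /= addr0 mul1r max_l // subr_le0. Qed.
Lemma pos1 v t : `|v| = 1 -> 0 <= t -> pos (v, t) = v.
Proof.
move=> v1 t0; have h : 1 <= 1 + t by rewrite lerDl.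
by rewrite /pos /= v1 mulr1 max_r // divff ?scale1r // gt_eqF // (lt_le_trans ltr01).
Qed.
Lemma depth1 v t : `|v| = 1 -> 0 <= t -> depth (v, t) = t.
Proof. by move=> v1 t0; rewrite /depth /= v1 mulr1 addrAC subrr add0r max_r. Qed.

(** Homotopy extension from the sphere to the disc, by composition with the retraction ([pos],
    [depth]). The last clause says that no new values appear; [sphere_deform] uses it to remain in
    the disc. *)
Lemma box_fill (Y : topologicalType) (a : V -> Y) (b : V * R -> Y) :
  {within disc, continuous a} -> {within side, continuous b} ->
  (forall v, `|v| = 1 -> b (v, 0) = a v) ->
  exists e : V * R -> Y, [/\ {within cyl, continuous e},
    forall v, `|v| <= 1 -> e (v, 0) = a v,
    forall v t, `|v| = 1 -> 0 <= t <= 1 -> e (v, t) = b (v, t)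
    & forall p, cyl p -> (exists2 v, `|v| <= 1 & e p = a v) \/
        (exists2 q, side q & e p = b q)].
Proof.
move=> ac bc ab.
have posside p : cyl p -> depth p != 0 -> side (pos p, depth p).
  move=> cp; have [_ /andP[t0 t1]] := cp; have /andP[d0 dt] := depth_range cp.
  by move=> d_neq0; case: (depth_pos t0) => [/eqP|h]; rewrite ?(negPf d_neq0) //=;
    split => //=; rewrite d0 (le_trans dt).
have possph p : cyl p -> 0 < depth p -> `|pos p| = 1.
  by move=> cp dp; case: (posside p cp) => //; rewrite gt_eqF.
exists (fun p => if depth p <= 0 then a (pos p) else b (pos p, depth p)); split.
- apply: (@within_paste _ _ [set p : V * R | (1 + p.2) * `|p.1| <= 1] [set p : V * R | 1 <= (1 + p.2) * `|p.1|]).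
  + by apply: closed_le; [exact: stretch_cont | exact: cont_cst].
  + by apply: closed_le; [exact: cont_cst | exact: stretch_cont].
  + by move=> p _; case: (leP ((1 + p.2) * `|p.1|) 1) => [|/ltW]; [left|right].
  + apply: (@within_eq _ _ _ (fun p => a (pos p))).
      by move=> p [/= h _]; rewrite /depth max_l ?lexx // subr_le0.
    apply: (within_comp ac); first exact/continuous_within/pos_cont.
    by move=> p [_ [_ /andP[t0 _]]]; exact: pos_disc.
  + have sphp p : cyl p -> 1 <= (1 + p.2) * `|p.1| -> `|pos p| = 1.
      by move=> [_ /andP[t0 _]] h; rewrite pos_norm // min_l.
    apply: (@within_eq _ _ _ (fun p => b (pos p, depth p))).
      move=> p [/= h cp]; case: ifP => // dp.
      have -> : depth p = 0.
        by apply/eqP; rewrite eq_le dp; case/andP: (depth_range cp).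
      by rewrite ab // sphp.
    apply: (within_comp bc).
      by apply/continuous_within/pair_continuous; [exact: pos_cont|exact: depth_cont].
    move=> p [/= h cp]; have [_ /andP[t0 t1]] := cp; have /andP[d0 dt] := depth_range cp.
    by split; rewrite /= ?sphp // d0 (le_trans dt).
- by move=> v v1; rewrite depth0 // lexx pos0.
- move=> v t v1 /andP[t0 t1]; rewrite depth1 // pos1 //; case: ifP => // t0'.
  by rewrite (_ : t = 0) ?ab //; apply/eqP; rewrite eq_le t0 t0'.
- move=> p cp; have [_ /andP[t0 _]] := cp; case: leP => dp; [left|right].
    by exists (pos p) => //; exact: pos_disc.
  by exists (pos p, depth p) => //; apply: posside => //; rewrite gt_eqF.
Qed.

Variables (X Y : topologicalType) (i : X -> Y).

Definition pair_map (g : V -> Y) (f : V -> X) := [/\ {within disc, continuous g},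
  {within sphere, continuous f} & forall v, `|v| = 1 -> i (f v) = g v].

(* A map of pairs from (disc, sphere) to [i : X -> Y] which deforms into [X]; [F] lifts to
   [X] the part of the deformation over the top and the side of the cylinder. *)
Definition compressible (g : V -> Y) (f : V -> X) := exists (G : V * R -> Y) (F : V * R -> X),
  [/\ {within cyl, continuous G}, {within topside, continuous F},
      forall v, `|v| <= 1 -> G (v, 0) = g v, forall v, `|v| = 1 -> F (v, 0) = f v
    & forall p, topside p -> i (F p) = G p].

Definition pair_homotopy (g g' : V -> Y) (f f' : V -> X) := exists (G : V * R -> Y) (F : V * R -> X),
  [/\ {within cyl, continuous G}, {within side, continuous F},
      forall v, `|v| <= 1 -> G (v, 0) = g v /\ G (v, 1) = g' v,
      forall v, `|v| = 1 -> F (v, 0) = f v /\ F (v, 1) = f' v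
    & forall p, side p -> i (F p) = G p].

Lemma halves_cont : continuous (fun p : V * R => (p.1, 2 * p.2)) /\
  continuous (fun p : V * R => (p.1, 2 * p.2 - 1)).
Proof.
have h : continuous (fun p : V * R => 2 * p.2).
  by apply: contM; [exact: cont_cst|exact: snd_cont].
split; apply: pair_continuous => //; try exact: fst_cont.
by apply: contB => //; exact: cont_cst.
Qed.

Lemma concat_cont (Z : topologicalType) (C D E : set (V * R)) (G H : V * R -> Z) :
  {within D, continuous G} -> {within E, continuous H} ->
  (forall v t, C (v, t) -> t <= 2^-1 -> D (v, 2 * t)) ->
  (forall v t, C (v, t) -> 2^-1 <= t -> E (v, 2 * t - 1)) ->
  (forall v, C (v, 2^-1) -> G (v, 1) = H (v, 0)) ->
  {within C, continuous (fun p => if p.2 <= 2^-1 then G (p.1, 2 * p.2) else H (p.1, 2 * p.2 - 1))}.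
Proof.
move=> Gc Hc CD CE GH; have [h1 h2] := halves_cont; apply: within_if.
- exact: snd_cont.
- exact: cont_cst.
- by apply: (within_comp Gc); [exact: continuous_within | move=> [v t] [/= ? ?]; exact: CD].
- by apply: (within_comp Hc); [exact: continuous_within | move=> [v t] [/= ? ?]; exact: CE].
- by move=> [v t] /= + tE; rewrite {}tE divff ?subrr //; exact: GH.
Qed.

(** The two deformations are run one after the other. During the first half [topside] consists of
    the side only, which is exactly where a homotopy of pairs has a lift to [X]. *)
Lemma compressible_homotopy g g' f f' :
  pair_homotopy g g' f f' -> compressible g' f' -> compressible g f.
Proof.
move=> [G [F [Gc Fc G01 F01 GF]]] [G' [F' [Gc' Fc' G0' F0' GF']]].
have cut (v : V) (t : R) : 0 <= t -> t <= 2^-1 -> 0 <= 2 * t <= 1 by move=> *; lra.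
have cut' (v : V) (t : R) : 2^-1 <= t -> t <= 1 -> 0 <= 2 * t - 1 <= 1 by move=> *; lra.
have half1 : (2^-1 : R) <> 1 by move=> h; lra.
exists (fun p => if p.2 <= 2^-1 then G (p.1, 2 * p.2) else G' (p.1, 2 * p.2 - 1)).
exists (fun p => if p.2 <= 2^-1 then F (p.1, 2 * p.2) else F' (p.1, 2 * p.2 - 1)); split.
- apply: (concat_cont Gc Gc').
  + by move=> v t [/= v1 /andP[t0 t1]] th; split => //=; exact: cut.
  + by move=> v t [/= v1 /andP[t0 t1]] th; split => //=; exact: cut'.
  + by move=> v [/= v1 _]; rewrite (G01 v v1).2 G0'.
- apply: (concat_cont Fc Fc').
  + move=> v t [[/= v1 /andP[t0 t1]] tv] th; split => /=; last exact: cut.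
    by case: tv => // tE; exfalso; lra.
  + move=> v t [[/= v1 /andP[t0 t1]] tv] th; split; first by split => //=; exact: cut'.
    by case: tv => /= h; [left; rewrite h; lra|right].
  + by move=> v [_ [//|/= v1]]; rewrite (F01 v v1).2 F0'.
- by move=> v v1 /=; rewrite invr_ge0 ler0n mulr0 (G01 v v1).1.
- by move=> v v1 /=; rewrite invr_ge0 ler0n mulr0 (F01 v v1).1.
- move=> [v t] [[/= v1 /andP[t0 t1]] tv]; case: leP => th.
    apply: GF; split => /=; last exact: cut.
    by case: tv => // tE; exfalso; lra.
  apply: GF'; split; first by split => //=; apply: cut' => //; exact: ltW.
  by case: tv => /= h; [left; rewrite h; lra|right].
Qed.

(** A deformation of the sphere within itself extends over the disc, again within the disc, and the
    pair is precomposed with it. This serves to normalize [f] before compressing. *)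
Lemma sphere_deform (c : V * R -> V) g f :
  {within side, continuous c} -> (forall p, side p -> `|c p| = 1) ->
  (forall v, `|v| = 1 -> c (v, 0) = v) -> pair_map g f ->
  exists g', pair_map g' (fun v => f (c (v, 1))) /\
    pair_homotopy g g' f (fun v => f (c (v, 1))).
Proof.
move=> cc c1 c0 [gc fc gf].
have idc : {within disc, continuous (fun v : V => v)} by exact/continuous_within/idfun_continuous.
have [e [ec e0 e1 eP]] := box_fill idc cc c0.
have ed p : cyl p -> `|e p| <= 1.
  by move=> /eP[[v v1 ->]|[q sq ->]]; rewrite ?(c1 _ sq).
have at1 : continuous (fun v : V => (v, 1 : R)).
  by apply: pair_continuous; [exact: idfun_continuous|exact: cst_continuous].
have cyl1 v : disc v -> cyl (v, 1) by move=> v1; split => //=; rewrite ler01 lexx.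
have side1 v : sphere v -> side (v, 1) by move=> v1; split => //=; rewrite ler01 lexx.
exists (fun v => g (e (v, 1))); split; last first.
  exists (fun p => g (e p)), (fun p => f (c p)); split.
  - exact: within_comp gc ec _.
  - exact: within_comp fc cc _.
  - by move=> v v1; rewrite e0.
  - by move=> v v1; rewrite c0.
  - by move=> [v t] [/= v1 t1]; rewrite gf ?c1 // e1.
split.
- apply: (within_comp gc _ (fun v d => ed _ (cyl1 v d))).
  by apply: (within_comp ec) => //; exact: continuous_within.
- apply: (within_comp fc _ (fun v d => c1 _ (side1 v d))).
  by apply: (within_comp cc) => //; exact: continuous_within.
- move=> v v1; rewrite gf; last exact: c1 (side1 v v1).
  by rewrite e1 // ler01 lexx.
Qed.

End Ball.

(** Vanishing of the relative homotopy of [i] in a form without base points. For [n = 0] the sphere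
    is empty, and the condition is surjectivity on path components. *)
Definition compress (R : realType) (X Y : topologicalType) (i : X -> Y) :=
  forall n (g : 'rV[R]_n -> Y) (f : 'rV[R]_n -> X), pair_map i g f -> compressible i g f.

(** * Weak homotopy equivalences and discs *)

Lemma rV_norm_le (R : realType) n (v : 'rV[R]_n) (r : R) : 0 <= r ->
  (`|v| <= r) = [forall j, `|v 0 j| <= r].
Proof.
move=> r0; rewrite [`|v|]mx_normrE; apply/bigmax_leP/forallP => [[_ h] j|h].
  exact: (h (0, j)).
by split=> // -[k j] _ /=; rewrite ord1.
Qed.

Lemma rV_coord_le (R : realType) n (v : 'rV[R]_n) j : `|v 0 j| <= `|v|.
Proof. by have := lexx `|v|; rewrite {1}rV_norm_le // => /forallP. Qed.

Lemma rV_norm_eq1 (R : realType) n (v : 'rV[R]_n) :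
  `|v| <= 1 -> `|v| = 1 <-> exists j, `|v 0 j| = 1.
Proof.
move=> v1; split=> [v1'|[j vj]]; last first.
  by apply/eqP; rewrite eq_le v1 -vj rV_coord_le.
have v0 : mx_norm v != 0 by rewrite -[mx_norm v]/`|v| v1' oner_eq0.
have [[k j] /= e] := mx_norm_neq0 v0.
by exists j; rewrite (ord1 k) in e; rewrite -e.
Qed.

Section Cubes.
Variables (R : realType) (n : nat).
Local Notation V := 'rV[R]_n.

(** In the sup norm the disc is the cube [-1, 1]^n; it is rescaled to [0, 1]^n, and clamped outside
    the disc. *)
Definition to_cube_val (v : V) : V := \row_j ui_of ((v 0 j + 1) / 2).
Lemma to_cube_subproof v : [set v : V | forall i, 0 <= v 0 i <= 1] (to_cube_val v).
Proof. by move=> i; rewrite mxE; have := ui_subproof ((v 0 i + 1) / 2); rewrite /= in_itv. Qed.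
Definition to_cube (v : V) : cube R n := set_elt (to_cube_subproof v).
Definition of_cube (c : cube R n) : V := \row_j (2 * val c 0 j - 1).

Lemma cube_range (c : cube R n) j : 0 <= val c 0 j <= 1.
Proof. exact: (set_valP c). Qed.

Lemma ui_of_id (t : R) : 0 <= t <= 1 -> ui_of t = t.
Proof. by move=> t1; have := val_ui t1. Qed.

Lemma of_cubeK (v : V) : `|v| <= 1 -> of_cube (to_cube v) = v.
Proof.
move=> v1; apply/rowP => j; rewrite mxE /= mxE ui_of_id; first by lra.
have := le_trans (rV_coord_le v j) v1; rewrite ler_norml; lra.
Qed.

Lemma of_cube_disc c : `|of_cube c| <= 1.
Proof.
rewrite rV_norm_le //; apply/forallP => j; rewrite mxE ler_norml.
by have := cube_range c j; lra.
Qed.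

Lemma of_cube_boundary c : cube_boundary c <-> `|of_cube c| = 1.
Proof.
split=> [[j h]|/(iffLR (rV_norm_eq1 (of_cube_disc c))) [j]].
  apply/(rV_norm_eq1 (of_cube_disc c)); exists j; rewrite mxE.
  by case: h => ->; rewrite ?mulr0 ?mulr1 ?sub0r ?normrN ?normr1 //; rewrite (_ : 2 - 1 = 1) ?normr1 //; lra.
rewrite mxE => h; exists j; have := cube_range c j; case: (ler0P (2 * val c 0 j - 1)) h => /= _ h _.
  by left; lra.
by right; lra.
Qed.

Lemma to_cube_boundary v : `|v| <= 1 -> cube_boundary (to_cube v) <-> `|v| = 1.
Proof. by move=> v1; rewrite of_cube_boundary of_cubeK. Qed.

Lemma to_cube_cont : continuous to_cube.
Proof.
apply: set_type_continuous => /=; apply: row_continuous => j.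
rewrite (_ : (fun x => _) = fun v : V => ui_of ((v 0 j + 1) / 2)); last first.
  by apply: funext => v; rewrite mxE.
apply: (comp_continuous (f := fun v : V => (v 0 j + 1) / 2)).
  apply: contM; last exact: cont_cst.
  by apply: contD; [exact: coord_continuous | exact: cont_cst].
exact: comp_continuous (@ui_continuous R) (@val_continuous _ _).
Qed.

Lemma of_cube_cont : continuous of_cube.
Proof.
apply: row_continuous => j.
rewrite (_ : (fun x => _) = fun c : cube R n => 2 * val c 0 j - 1); last first.
  by apply: funext => v; rewrite mxE.
apply: contB; last exact: cont_cst.
apply: contM; first exact: cont_cst.
exact: comp_continuous (@val_continuous _ _) (@coord_continuous _ _ _ 0 j).
Qed.

Definition cyl_to (p : V * R) : cube R n * unit_interval R := (to_cube p.1, ui p.2).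
Definition cyl_of (p : cube R n * unit_interval R) : V * R := (of_cube p.1, val p.2).

Lemma cyl_to_cont : continuous cyl_to.
Proof.
apply: pair_continuous.
  exact: comp_continuous (@fst_continuous _ _) to_cube_cont.
exact: comp_continuous (@snd_continuous _ _) (@ui_continuous R).
Qed.
Lemma cyl_of_cont : continuous cyl_of.
Proof.
apply: pair_continuous.
  exact: comp_continuous (@fst_continuous _ _) of_cube_cont.
exact: comp_continuous (@snd_continuous _ _) (@val_continuous _ _).
Qed.
Lemma cyl_of_cyl p : cyl (cyl_of p).
Proof. by split; [exact: of_cube_disc | exact: ui_range]. Qed.

Variables (X Y : topologicalType) (i : X -> Y).
Hypothesis whe : weak_homotopy_equivalence R i.

Lemma whe_surj (x0 : X) (c : V -> Y) : (0 < n)%N ->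
  {within @disc R n, continuous c} -> (forall v, `|v| = 1 -> c v = i x0) ->
  exists (a : V -> X) (h : V * R -> Y),
    [/\ continuous a, forall v, `|v| <= 1 -> `|v| = 1 -> a v = x0, continuous h,
        forall v, `|v| <= 1 -> h (v, 0) = c v /\ h (v, 1) = i (a v)
      & forall v t, `|v| = 1 -> 0 <= t <= 1 -> h (v, t) = i x0].
Proof.
move=> n0 cc cx; have [_ _ _ /(_ n x0 n0) [_ surj]] := whe.
have [|a [ac ax] [h [hc h0 h1 hx]]] := surj (fun q => c (of_cube q)).
  split; first exact: (within_comp_continuous cc of_cube_cont of_cube_disc).
  by move=> v /of_cube_boundary; exact: cx.
(* Time is reversed: the homotopy supplied by surjectivity runs from [i \o a] to [c]. *)
exists (fun v => a (to_cube v)), (fun p => h (cyl_to (p.1, 1 - p.2))); split.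
- exact: comp_continuous to_cube_cont ac.
- by move=> v v1 /(to_cube_boundary v1); exact: ax.
- apply: (comp_continuous _ (comp_continuous cyl_to_cont hc)); apply: pair_continuous.
    exact: fst_continuous.
  by apply: contB; [exact: cont_cst | exact: snd_continuous].
- move=> v v1; rewrite /cyl_to /= subr0 subrr; split.
    by rewrite h1 ?of_cubeK // val_ui // ler01 lexx.
  by rewrite h0 // val_ui // ler01 lexx.
- move=> v t v1 t1; apply: hx; apply/to_cube_boundary => //; by rewrite v1.
Qed.

Lemma whe_inj (x0 : X) (a : V -> X) (h : V * R -> Y) :
  {within @disc R n, continuous a} -> (forall v, `|v| = 1 -> a v = x0) ->
  {within @cyl R n, continuous h} ->
  (forall v, `|v| <= 1 -> h (v, 0) = i (a v) /\ h (v, 1) = i x0) ->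
  (forall v t, `|v| = 1 -> 0 <= t <= 1 -> h (v, t) = i x0) ->
  exists k : V * R -> X, [/\ continuous k,
    forall v, `|v| <= 1 -> k (v, 0) = a v /\ k (v, 1) = x0
  & forall v t, `|v| = 1 -> 0 <= t <= 1 -> k (v, t) = x0].
Proof.
(* For [n = 0] the homotopy is a path, and injectivity on path components takes the place of
   injectivity on homotopy groups. *)
move=> ac ax hc h01 hx; have [n0|n_gt0] := posnP n.
  have v0 (v : V) : v = 0 by apply/rowP => j; have := ltn_ord j; rewrite {2}n0.
  have vN (v : V) : `|v| = 0 by rewrite (v0 v) normr0.
  have [_ inj _ _] := whe.
  have [|p [pc p0 p1]] := inj (a 0) x0.
    exists (fun t => h (0, val t)); split.
    - apply: (within_comp_continuous hc).
        apply: pair_continuous; [exact: cst_continuous|exact: val_continuous].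
      by move=> t; split; [rewrite /= normr0 ler01|exact: ui_range].
    - by move=> t ->; rewrite (h01 0 _).1 // normr0 ler01.
    - by move=> t ->; rewrite (h01 0 _).2 // normr0 ler01.
  exists (fun q => p (ui q.2)); split.
  - apply: (comp_continuous _ pc).
    exact: comp_continuous (@snd_continuous _ _) (@ui_continuous R).
  - by move=> v _; rewrite p0 ?p1 ?val_ui ?lexx ?ler01 // (v0 v).
  - by move=> v t; rewrite vN => /esym/eqP; rewrite oner_eq0.
have [_ _ _ /(_ n x0 n_gt0) [inj _]] := whe.
have [|||k [kc k0 k1 kx]] := inj (fun q => a (of_cube q)) (fun=> x0).
- split; first exact: (within_comp_continuous ac of_cube_cont of_cube_disc).
  by move=> v /of_cube_boundary; exact: ax.
- by split => //; exact: cst_continuous.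
- exists (fun q => h (cyl_of q)); split.
  + exact: (within_comp_continuous hc cyl_of_cont cyl_of_cyl).
  + by move=> v t t0; rewrite /cyl_of /= t0 (h01 _ (of_cube_disc v)).1.
  + by move=> v t t1; rewrite /cyl_of /= t1 (h01 _ (of_cube_disc v)).2.
  + by move=> v t /of_cube_boundary v1; apply: hx => //; exact: ui_range.
exists (fun p => k (cyl_to p)); split.
- exact: comp_continuous cyl_to_cont kc.
- by move=> v v1; rewrite k0 ?k1 ?val_ui ?lexx ?ler01 // of_cubeK.
- by move=> v t v1 t1; apply: kx; apply/to_cube_boundary => //; rewrite v1.
Qed.

End Cubes.

(** * Collapsing the sphere onto its top face *)

Section Split.
Variables (R : realType) (m : nat).
Local Notation V := 'rV[R]_m.+1.
Local Notation W := 'rV[R]_m.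

Definition wpart (v : V) : W := \row_j v 0 (lift ord0 j).
Definition hpart (v : V) : R := v 0 ord0.
Definition mkv (w : W) (s : R) : V := \row_j oapp (fun k => w 0 k) s (unlift ord0 j).

Lemma hpart_mkv w s : hpart (mkv w s) = s.
Proof. by rewrite /hpart mxE unlift_none. Qed.
Lemma wpart_mkv w s : wpart (mkv w s) = w.
Proof. by apply/rowP => j; rewrite !mxE liftK. Qed.
Lemma mkvK v : mkv (wpart v) (hpart v) = v.
Proof. by apply/rowP => j; rewrite mxE; case: unliftP => [k|] -> //=; rewrite mxE. Qed.

Lemma wpart_cont : continuous wpart.
Proof.
apply: row_continuous => j; rewrite (_ : (fun _ => _) = fun v : V => v 0 (lift ord0 j)).
  exact: coord_continuous.
by apply: funext => v; rewrite mxE.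
Qed.
Lemma hpart_cont : continuous hpart. Proof. exact: coord_continuous. Qed.

Lemma mkv_cont (T : topologicalType) (w : T -> W) (s : T -> R) :
  continuous w -> continuous s -> continuous (fun x => mkv (w x) (s x)).
Proof.
move=> wc sc; apply: row_continuous => j; case: (unliftP ord0 j) => [k|] jE.
  rewrite (_ : (fun _ => _) = fun x => w x 0 k).
    exact: (comp_continuous wc (@coord_continuous _ _ _ 0 k)).
  by apply: funext => x; rewrite mxE jE liftK.
rewrite (_ : (fun _ => _) = s) //.
by apply: funext => x; rewrite mxE jE unlift_none.
Qed.

Lemma rV_norm_split (v : V) r : 0 <= r -> (`|v| <= r) = (`|hpart v| <= r) && (`|wpart v| <= r).
Proof.
move=> r0; rewrite !rV_norm_le //; apply/forallP/andP => [h|[h0 /forallP hw] j].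
  by split; [exact: h | apply/forallP => j; rewrite mxE; exact: h].
by case: (unliftP ord0 j) => [k|] -> //; have := hw k; rewrite mxE.
Qed.

Lemma hpart_le v : `|hpart v| <= `|v|.
Proof. by have := lexx `|v|; rewrite {1}rV_norm_split // => /andP[]. Qed.
Lemma wpart_le v : `|wpart v| <= `|v|.
Proof. by have := lexx `|v|; rewrite {1}rV_norm_split // => /andP[]. Qed.

Lemma norm1_cases v : `|v| = 1 -> [\/ hpart v = 1, hpart v = -1 | `|wpart v| = 1].
Proof.
move=> v1; have v1' : `|v| <= 1 by rewrite v1.
have [/(_ v1) [j]] := rV_norm_eq1 v1'; case: (unliftP ord0 j) => [k|] -> vj _.
  apply: Or33; apply/eqP; rewrite eq_le -{1}v1 wpart_le /= -vj.
  by have := rV_coord_le (wpart v) k; rewrite mxE.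
rewrite -[v 0 ord0]/(hpart v) in vj.
have [h|h] := ger0P (hpart v); [apply: Or31|apply: Or32]; move: vj.
  by rewrite ger0_norm.
by rewrite ltr0_norm // => <-; rewrite opprK.
Qed.

Lemma mkv_norm1 w : `|w| <= 1 -> `|mkv w 1| = 1.
Proof.
move=> w1; apply/eqP; rewrite eq_le rV_norm_split // hpart_mkv wpart_mkv normr1 lexx w1 /=.
by have := hpart_le (mkv w 1); rewrite hpart_mkv normr1.
Qed.

(* [collapse] deforms the identity of the sphere to a map which sends everything but the
   open top face [hpart v = 1] to the centre [bot] of the bottom face. *)
Definition bot : V := mkv 0 (-1).
Definition amp (v : V) : R := (1 - `|wpart v|) * (1 + hpart v) / 2.
Definition apex (v : V) : V := mkv (amp v *: wpart v) (2 * amp v - 1).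
Definition segm (p : V * R) : V := (1 - p.2) *: p.1 + p.2 *: apex p.1.
Definition collapse (p : V * R) : V := `|segm p|^-1 *: segm p.

Lemma amp_cont : continuous amp.
Proof.
apply: contM; last exact: cont_cst.
apply: contM; first by apply: contB; [exact: cont_cst | exact/cont_norm/wpart_cont].
by apply: contD; [exact: cont_cst | exact: hpart_cont].
Qed.

Lemma apex_cont : continuous apex.
Proof.
apply: mkv_cont; first by apply: contZ; [exact: amp_cont | exact: wpart_cont].
apply: contB; last exact: cont_cst.
by apply: contM; [exact: cont_cst | exact: amp_cont].
Qed.

Lemma segm_cont : continuous segm.
Proof.
have c1 : continuous (fst : V * R -> V) by exact: fst_continuous.
have c2 : continuous (snd : V * R -> R) by exact: snd_continuous.
apply: contDv; apply: contZ => //; first by apply: contB => //; exact: cont_cst.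
exact: comp_continuous c1 apex_cont.
Qed.

Lemma hpartD u v : hpart (u + v) = hpart u + hpart v. Proof. by rewrite /hpart mxE. Qed.
Lemma hpartZ c v : hpart (c *: v) = c * hpart v. Proof. by rewrite /hpart mxE. Qed.
Lemma wpartD u v : wpart (u + v) = wpart u + wpart v. Proof. by apply/rowP => j; rewrite !mxE. Qed.
Lemma wpartZ c v : wpart (c *: v) = c *: wpart v. Proof. by apply/rowP => j; rewrite !mxE. Qed.

(** The component [wpart] is only multiplied by a nonnegative factor along the segment. If that
    factor vanishes, then t = 1 and [amp v] = 0, and the height is -1. If [wpart v] = 0, then [v] is
    the centre of the top or of the bottom, which [apex] fixes. *)
Lemma segm_neq0 (p : V * R) : side p -> segm p != 0.
Proof.
case: p => v t [/= v1 /andP[t0 t1]]; apply/eqP => e.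
have h : (1 - t) * hpart v + t * (2 * amp v - 1) = 0.
  have := congr1 hpart e; rewrite /segm hpartD !hpartZ /= hpart_mkv => ->.
  by rewrite /hpart mxE.
have /eqP : ((1 - t) + t * amp v) *: wpart v = 0.
  have := congr1 wpart e; rewrite /segm wpartD !wpartZ /= wpart_mkv scalerA -scalerDl => ->.
  by apply/rowP => j; rewrite !mxE.
have hv : -1 <= hpart v <= 1 by rewrite -ler_norml -v1 hpart_le.
have wv : `|wpart v| <= 1 by rewrite -v1 wpart_le.
have a0 : 0 <= amp v by rewrite /amp; case/andP: hv => *; rewrite !mulr_ge0 ?subr_ge0 //; lra.
rewrite scaler_eq0 => /orP[/eqP c0|/eqP w0].
  have t1' : t = 1.
    have : 0 <= t * amp v by rewrite mulr_ge0.
    lra.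
  by rewrite t1' in h c0; lra.
have aE : amp v = (1 + hpart v) / 2 by rewrite /amp w0 normr0 subr0 mul1r.
have [h1|h1|] := norm1_cases v1; last by rewrite w0 normr0 => /esym/eqP; rewrite oner_eq0.
  by rewrite aE h1 in h; lra.
by rewrite aE h1 in h; lra.
Qed.

Lemma collapse_cont : {within @side R m.+1, continuous collapse}.
Proof.
apply/subspace_continuousP => p sp; have n0 := segm_neq0 sp.
apply: (@cvg_trans _ (collapse @ nbhs p)); first by apply: cvg_fmap2; exact: cvg_within.
apply: cvgZ; last exact: segm_cont.
apply: cvgV; first by rewrite normr_eq0.
exact: (@cont_norm _ _ _ _ segm_cont p).
Qed.

Lemma collapse_norm p : side p -> `|collapse p| = 1.
Proof.
by move=> sp; rewrite /collapse normrZ normfV normr_id mulVf // normr_eq0 segm_neq0.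
Qed.

Lemma collapse0 v : `|v| = 1 -> collapse (v, 0) = v.
Proof. by move=> v1; rewrite /collapse /segm /= subr0 scale1r scale0r addr0 v1 invr1 scale1r. Qed.

Lemma bot_norm : `|bot| = 1.
Proof.
apply/eqP; rewrite eq_le rV_norm_split // hpart_mkv wpart_mkv normrN normr1 normr0 lexx ler01 /=.
by have := hpart_le bot; rewrite hpart_mkv normrN normr1.
Qed.

Lemma collapse1_bot v : `|v| = 1 -> hpart v = -1 \/ `|wpart v| = 1 -> collapse (v, 1) = bot.
Proof.
move=> v1 h; have a0 : amp v = 0.
  by rewrite /amp; case: h => ->; rewrite subrr ?mulr0 !mul0r.
rewrite /collapse /segm /= subrr scale0r scale1r add0r /apex a0 scale0r mulr0 sub0r.
by rewrite -[mkv 0 (-1)]/bot bot_norm invr1 scale1r.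
Qed.

End Split.

(** * Weak homotopy equivalences compress discs *)

Section WheCompress.
Variables (R : realType) (X Y : topologicalType) (i : X -> Y).
Hypothesis whe : weak_homotopy_equivalence R i.

Lemma whe_compress0 (g : 'rV[R]_0 -> Y) (f : 'rV[R]_0 -> X) : compressible i g f.
Proof.
have v0 (v : 'rV[R]_0) : v = 0 by apply/rowP => -[].
have nv (v : 'rV[R]_0) : `|v| <> 1 by rewrite (v0 v) normr0 => /esym/eqP; rewrite oner_eq0.
have [_ _ surj _] := whe; have [x [p [pc p0 p1]]] := surj (g 0).
exists (fun q => p (ui (1 - q.2))), (fun _ => x); split.
- apply/continuous_within/(comp_continuous _ pc).
  apply: (comp_continuous _ (@ui_continuous R)).
  by apply: contB; [exact: cont_cst | exact: snd_continuous].
- exact/continuous_within/cst_continuous.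
- by move=> v _; rewrite p1 ?(v0 v) // subr0 val_ui // ler01 lexx.
- by move=> v /nv.
- by move=> [v t] [_ [/= ->|/nv//]]; rewrite p0 // subrr val_ui // ler01 lexx.
Qed.

(** With its sphere sent to one point, the disc represents an element of a homotopy group of [Y];
    surjectivity of [i] on that group provides the compression. *)
Lemma compress_rel_const m (g : 'rV[R]_m.+1 -> Y) (f : 'rV[R]_m.+1 -> X) (x0 : X) :
  pair_map i g f -> (forall v, `|v| = 1 -> f v = x0) -> compressible i g f.
Proof.
move=> [gc fc gf] fx.
have [|a [h [ac ax hc h01 hx]]] := whe_surj whe (ltn0Sn m) gc (x0 := x0).
  by move=> v v1; rewrite -gf // fx.
exists h, (fun p => a p.1); split.
- exact: continuous_within.
- exact/continuous_within/(comp_continuous (@fst_continuous _ _)).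
- by move=> v v1; rewrite (h01 v v1).1.
- by move=> v v1 /=; rewrite ax ?fx ?v1.
- move=> [v t] [[/= v1 t1] [tE|v1']]; first by rewrite /= tE (h01 v v1).2.
  by rewrite /= hx // ax.
Qed.

(** The map on the sphere is made constant in two moves. First [collapse] sends everything but the
    open top face to [x0]. What remains on the top face is a spheroid of dimension [m] in [X] (a
    point if [m] = 0) which the disc contracts in [Y], so by injectivity it contracts in [X]. Then
    [compress_rel_const] applies. *)
Lemma whe_compress : compress R i.
Proof.
case=> [|m] g f gf; first exact: whe_compress0.
have [g' [gf' hom]] := sphere_deform (@collapse_cont R m) (@collapse_norm R m) (@collapse0 R m) gf.
apply: (compressible_homotopy hom).
move: (collapse_norm (R := R) (m := m)) gf' => cn [gc' fc' gf'].
have [gc fc gfE] := gf.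
pose x0 := f (bot R m); pose q (w : 'rV[R]_m) : 'rV[R]_m.+1 := collapse (mkv w 1, 1).
have side1 w : `|w| <= 1 -> side (mkv w (1 : R), 1) by move=> w1; split; rewrite /= ?mkv_norm1 // ler01 lexx.
have q1 w : `|w| <= 1 -> `|q w| = 1 by move=> w1; exact/cn/side1.
have mkc : continuous (fun w : 'rV[R]_m => mkv w (1 : R)).
  by apply: mkv_cont; [exact: idfun_continuous | exact: cst_continuous].
have q_cont : {within @disc R m, continuous q}.
  apply: (within_comp (@collapse_cont R m)); last exact: side1.
  by apply/continuous_within/pair_continuous => //; exact: cst_continuous.
have qbot w : `|w| = 1 -> q w = bot R m.
  by move=> w1; apply: collapse1_bot; [rewrite mkv_norm1 // w1|right; rewrite wpart_mkv].
have fqc : {within @disc R m, continuous (fun w => f (q w))} by apply: (within_comp fc q_cont).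
(* Inside the disc, [q w] is joined to [bot] by a segment, constant when [w] is on the rim; [g]
   turns these segments into a contraction. *)
pose null (p : 'rV[R]_m * R) := g ((1 - p.2) *: q p.1 + p.2 *: bot R m).
have nullc : {within @cyl R m, continuous null}.
  apply: (within_comp gc) => [|[w t] [/= w1 /andP[t0 t1]]].
    apply/subspace_continuousP => -[w t] [/= w1 t1].
    have qc' : q p.1 @[p --> within (@cyl R m) (nbhs (w, t))] --> q w.
      have /subspace_continuousP h : {within @cyl R m, continuous (fun p => q p.1)}.
        apply: (within_comp q_cont); first exact/continuous_within/fst_cont.
        by move=> ? [].
      exact: (h (w, t)).
    have sc : p.2 @[p --> within (@cyl R m) (nbhs (w, t))] --> t.
      have /subspace_continuousP h := @continuous_within _ _ (@cyl R m) _ (@snd_cont R m).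
      exact: (h (w, t)).
    apply: cvgD; apply: cvgZ => //; last exact: cvg_cst.
    by apply: cvgB => //; exact: cvg_cst.
  rewrite /disc /=; apply: le_trans (ler_normD _ _) _.
  by rewrite (normrZ (1 - t)) (normrZ t) q1 // bot_norm !mulr1 !ger0_norm ?subr_ge0 // subrK.
have fbot : i x0 = g (bot R m) by rewrite gfE // bot_norm.
have [|||k [kc k01 kx]] := whe_inj whe (x0 := x0) fqc _ nullc.
- by move=> w w1; rewrite qbot.
- move=> w w1; rewrite /null /= subr0 subrr !scale1r !scale0r addr0 add0r fbot.
  by rewrite gfE ?q1.
- move=> w t w1 t1; rewrite /null /= qbot // -scalerDl subrK scale1r fbot //.
(* The contraction [k] lives over the top face; over the rest of the sphere it is continued by [x0],
   its value over the rim of that face. *)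
pose kt (p : 'rV[R]_m.+1 * R) := if 1 <= hpart p.1 then k (wpart p.1, p.2) else x0.
have ktc : {within @side R m.+1, continuous kt}.
  have hc : continuous (fun p : 'rV[R]_m.+1 * R => hpart p.1).
    exact: comp_continuous (@fst_cont R m.+1) (@hpart_cont R m).
  have wc : continuous (fun p : 'rV[R]_m.+1 * R => wpart p.1).
    exact: comp_continuous (@fst_cont R m.+1) (@wpart_cont R m).
  have wnc : continuous (fun p : 'rV[R]_m.+1 * R => `|wpart p.1|) by exact: cont_norm.
  apply: (@within_paste _ _ [set p : 'rV[R]_m.+1 * R | 1 <= hpart p.1]
    ([set p : 'rV[R]_m.+1 * R | hpart p.1 <= -1] `|` [set p : 'rV[R]_m.+1 * R | 1 <= `|wpart p.1|])).
  - by apply: closed_le => //; exact: cst_continuous.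
  - by apply: closedU; apply: closed_le => //; exact: cst_continuous.
  - by move=> [v t] [/= /norm1_cases[->|->|->] _]; [left|right; left|right; right] => /=.
  - apply: (@within_eq _ _ _ (fun p => k (wpart p.1, p.2))); first by move=> p [/= h _]; rewrite /kt h.
    apply/continuous_within/(comp_continuous _ kc)/pair_continuous => //; exact: snd_cont.
  - apply: (@within_eq _ _ _ (fun=> x0)); last exact/continuous_within/cst_continuous.
    move=> [v t] [/= h [/= v1 t1]]; rewrite /kt /=; case: ifP => // h1; rewrite kx //.
    case: h => h; first by have := le_trans h1 h; lra.
    by apply/eqP; rewrite eq_le h andbT -v1 wpart_le.
pose ikt p := i (kt p).
have [ic _ _ _] := whe.
have iktc : {within @side R m.+1, continuous ikt} by exact: continuous_comp_within.
have kt0 v : `|v| = 1 -> kt (v, 0) = f (collapse (v, 1)).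
  move=> v1; have w1 : `|wpart v| <= 1 by rewrite -v1 wpart_le.
  rewrite /kt /=; case: ifP => hv.
    have vE : mkv (wpart v) 1 = v.
      have <- : hpart v = 1.
        apply/eqP; rewrite eq_le hv -{1}v1.
        by rewrite (le_trans (ler_norm _) (hpart_le v)).
      exact: mkvK.
    by rewrite (k01 _ w1).1 /q vE.
  rewrite collapse1_bot //; case: (norm1_cases v1) => [h1||]; [|by left|by right].
  by rewrite h1 lexx in hv.
have kt1 v : `|v| = 1 -> kt (v, 1) = x0.
  move=> v1; have w1 : `|wpart v| <= 1 by rewrite -v1 wpart_le.
  by rewrite /kt /=; case: ifP => // _; rewrite (k01 _ w1).2.
have [|e [ec e0 es _]] := box_fill gc' iktc.
  by move=> v v1; rewrite /ikt kt0 // gf'.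
apply: (@compressible_homotopy _ _ _ _ _ _ (fun v => e (v, 1)) _ (fun v => kt (v, 1))).
  exists e, kt; split => //.
  - by move=> v v1; rewrite e0.
  - by move=> v v1; rewrite kt0.
  - by move=> [v t] [/= v1 t1]; rewrite es.
have at1 : continuous (fun v : 'rV[R]_m.+1 => (v, 1 : R)).
  by apply: pair_continuous; [exact: idfun_continuous|exact: cst_continuous].
apply: (compress_rel_const (x0 := x0)); last exact: kt1.
split.
- by apply: (within_comp ec); [exact: continuous_within | move=> v v1; split => //=; rewrite ler01 lexx].
- by apply: (within_comp ktc); [exact: continuous_within | move=> v v1; split => //=; rewrite ler01 lexx].
- by move=> v v1; rewrite es // ler01 lexx.
Qed.

End WheCompress.

(** * Simplicial sets: Eilenberg-Zilber decompositions and lifting *)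

Local Close Scope ring_scope.
Local Close Scope classical_set_scope.

Definition dsurj m n (s : dhom m n) := forall j, exists i, s i = j.

Lemma dcompE m n p (g : dhom n p) (f : dhom m n) i : dcomp g f i = g (f i).
Proof. exact: mk_dhomE. Qed.
Lemma didE n i : did n i = i.
Proof. exact: mk_dhomE. Qed.
Lemma dhomP m n (f g : dhom m n) : (forall i, f i = g i) -> f = g.
Proof. by move=> fg; apply: dhom_eq => i; rewrite fg. Qed.
Lemma dcomp1 m n (f : dhom m n) : dcomp f (did m) = f.
Proof. by apply: dhomP => i; rewrite dcompE didE. Qed.
Lemma d1comp m n (f : dhom m n) : dcomp (did n) f = f.
Proof. by apply: dhomP => i; rewrite dcompE didE. Qed.
Lemma dcompA k m n p (h : dhom n p) (g : dhom m n) (f : dhom k m) :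
  dcomp h (dcomp g f) = dcomp (dcomp h g) f.
Proof. by apply: dhomP => i; rewrite !dcompE. Qed.

Lemma dsurj_comp m n p (g : dhom n p) (f : dhom m n) : dsurj g -> dsurj f -> dsurj (dcomp g f).
Proof. by move=> gs fs j; have [k <-] := gs j; have [i <-] := fs k; exists i; rewrite dcompE. Qed.
Lemma dsurj_left m n p (g : dhom n p) (f : dhom m n) : dsurj (dcomp g f) -> dsurj g.
Proof. by move=> gf j; have [i <-] := gf j; exists (f i); rewrite dcompE. Qed.
Lemma dsurj_id n : dsurj (did n).
Proof. by move=> j; exists j; rewrite didE. Qed.

(** Any choice of preimages is monotone because [s] is, so the section can be made to pass through
    [i]. *)
Lemma dsurj_section m n (s : dhom m n) (i : 'I_m.+1) : dsurj s ->
  exists d : dhom n m, dcomp s d = did n /\ d (s i) = i.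
Proof.
move=> ss; have [f fP] := choice ss.
pose g j := if j == s i then i else f j.
have gP j : s (g j) = j by rewrite /g; case: eqP.
have gm (j k : 'I_n.+1) : j <= k -> g j <= g k.
  move=> jk; have [->//|jk'] := eqVneq j k.
  rewrite leqNgt; apply/negP => /ltnW/(dhom_mono s); rewrite !gP => kj.
  by case/eqP: jk'; apply: val_inj; apply/eqP; rewrite eqn_leq jk.
exists (mk_dhom gm); split; last by rewrite mk_dhomE /g eqxx.
by apply: dhomP => j; rewrite dcompE mk_dhomE gP didE.
Qed.

Lemma dsurj_ex_section m n (s : dhom m n) : dsurj s -> exists d : dhom n m, dcomp s d = did n.
Proof. by move=> /(dsurj_section ord0)[d [sd _]]; exists d. Qed.

(** Some section of [s] passes through each vertex, so the sections determine the surjection. *)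
Lemma dsurj_eq m n (s t : dhom m n) : dsurj s ->
  (forall d : dhom n m, dcomp s d = did n -> dcomp t d = did n) -> s = t.
Proof.
move=> ss h; apply: dhomP => i; have [d [sd di]] := dsurj_section i ss.
by have := congr1 (fun f : dhom n n => f (s i)) (h d sd); rewrite /= dcompE didE di.
Qed.

Lemma dinj_lt m n (d : dhom m n) (i j : 'I_m.+1) : injective d -> i < j -> d i < d j.
Proof.
move=> di ij; rewrite ltn_neqAle dhom_mono 1?ltnW // andbT; apply/negP => /eqP/val_inj/di e.
by rewrite e ltnn in ij.
Qed.

Lemma dinj_le m n (d : dhom m n) (i j : 'I_m.+1) : injective d -> (d i <= d j) = (i <= j).
Proof.
move=> di; apply/idP/idP; last exact: dhom_mono.
by rewrite leqNgt [i <= j]leqNgt; apply: contra; exact: dinj_lt.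
Qed.

Lemma dinj_leq m n (d : dhom m n) : injective d -> m <= n.
Proof. by move=> di; have := leq_card d di; rewrite !card_ord. Qed.

Lemma dinj_id n (d : dhom n n) : injective d -> d = did n.
Proof.
move=> di; have lo k (i : 'I_n.+1) : val i = k -> k <= d i.
  elim: k i => // k IHk i ik; have kn : k < n.+1 by have := ltn_ord i; move: ik => /=; lia.
  by apply: leq_ltn_trans (IHk (Ordinal kn) erefl) _; apply: dinj_lt => //=; rewrite -ik.
have hi k (i : 'I_n.+1) : n - i = k -> d i <= n - k.
  elim: k i => [|k IHk] i ik; first by rewrite subn0 -ltnS.
  have kn : i.+1 < n.+1 by have := ltn_ord i; lia.
  have h : d i < d (Ordinal kn) by apply: dinj_lt => //=.
  by have := IHk (Ordinal kn); rewrite /=; have := ltn_ord i; lia.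
apply: dhom_eq => i; rewrite didE; apply/eqP; rewrite eqn_leq (lo _ i erefl) andbT.
by have := hi _ i erefl; have := ltn_ord i; lia.
Qed.

Lemma dsurj_endo n (s : dhom n n) : dsurj s -> s = did n.
Proof.
move=> ss; apply: dinj_id; have [d sd] := dsurj_ex_section ss.
have dd : d = did n.
  apply: dinj_id => i j e; have := congr1 s e.
  by rewrite -!dcompE sd !didE.
by rewrite dd dcomp1 in sd; rewrite sd => i j; rewrite !didE.
Qed.

Lemma dhom_onto (n : nat) (S : {set 'I_n.+1}) (i0 : 'I_n.+1) : i0 \in S ->
  exists p (d : dhom p n), injective d /\ forall j, (j \in S) <-> exists k, d k = j.
Proof.
move=> i0S; have S0 : 0 < #|S| by apply/card_gt0P; exists i0.
have sz : size (enum S) = #|S|.-1.+1 by rewrite prednK // cardE.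
have srt : sorted ltn (map val (enum S)).
  have : subseq (map val (enum S)) (map val (enum 'I_n.+1)).
    by apply: map_subseq; rewrite [enum 'I_n.+1]enumT; exact: filter_subseq.
  by move/subseq_sorted => -> //; [exact: ltn_trans | rewrite val_enum_ord iota_ltn_sorted].
have nthlt (a b : nat) : a < b -> b < size (enum S) -> nth i0 (enum S) a < nth i0 (enum S) b.
  move=> ab bs; have as' : a < size (enum S) := ltn_trans ab bs.
  have := sorted_ltn_nth ltn_trans 0 srt; move=> /(_ a b); rewrite !inE !size_map => /(_ as' bs ab).
  by rewrite !(nth_map i0).
have fm (j k : 'I_#|S|.-1.+1) : j <= k -> nth i0 (enum S) j <= nth i0 (enum S) k.
  rewrite leq_eqVlt => /orP[/eqP -> //|jk]; apply/ltnW/nthlt => //.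
  by rewrite sz.
exists #|S|.-1, (mk_dhom fm); split.
  move=> j k; rewrite !mk_dhomE => e; apply: val_inj; apply/eqP; rewrite eqn_leq leqNgt [k <= j]leqNgt.
  by apply/andP; split; apply/negP => /nthlt h; have := h; rewrite e ltnn sz ltn_ord => /(_ isT).
move=> j; split=> [jS|[k <-]].
  have jS' : j \in enum S by rewrite mem_enum.
  have h : index j (enum S) < #|S|.-1.+1 by rewrite -sz index_mem.
  by exists (Ordinal h); rewrite mk_dhomE /= nth_index.
by rewrite mk_dhomE -mem_enum mem_nth // sz.
Qed.

Lemma dinj_factor m n p (f : dhom m n) (d : dhom p n) : injective d ->
  (forall i, exists k, d k = f i) -> exists e : dhom m p, f = dcomp d e.
Proof.
move=> di /choice[e eP].
have em (i j : 'I_m.+1) : i <= j -> e i <= e j.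
  by move=> ij; rewrite -(dinj_le _ _ di) !eP dhom_mono.
by exists (mk_dhom em); apply: dhomP => i; rewrite dcompE mk_dhomE eP.
Qed.

Lemma dhom_image m n (f : dhom m n) : exists p (d : dhom p n) (e : dhom m p),
  [/\ f = dcomp d e, injective d & dsurj e].
Proof.
have h : f ord0 \in [set f i | i : 'I_m.+1] by apply: imset_f.
have [p [d [di dP]]] := dhom_onto h.
have [|e fE] := dinj_factor (f := f) di; first by move=> i; apply/dP/imset_f.
exists p, d, e; split => // k.
have /imsetP[i _ fi] : d k \in [set f i | i : 'I_m.+1] by apply/dP; exists k.
by exists i; apply: di; rewrite fi fE dcompE.
Qed.

Section EilenbergZilber.
Variable X : SSet.

Lemma sset_fmap1 n (x : X n) : fmap X (did n : @hom (op Delta) n n) x = x.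
Proof. by rewrite (fmap1 X n). Qed.

Definition nondeg n (x : X n) :=
  forall m (s : dhom n m) (y : X m), dsurj s -> x = fmap X s y -> n <= m.

Lemma ez_exists n (x : X n) : exists m (s : dhom n m) (y : X m),
  [/\ dsurj s, nondeg y & x = fmap X s y].
Proof.
elim/ltn_ind: n x => n IHn x; have [xn|] := pselect (nondeg x).
  by exists n, (did n), x; split => //; [exact: dsurj_id | rewrite sset_fmap1].
move=> /existsNP[m /existsNP[s /existsNP[y /not_implyP[ss /not_implyP[xE /negP]]]]].
rewrite -ltnNge => mn; have [k [t [z [ts zn yE]]]] := IHn m mn y.
exists k, (dcomp t s), z; split => //; first exact: dsurj_comp.
by rewrite sset_fmapM -yE.
Qed.

(** If [d] is a section of [s1], then [y1] is the pullback of [y2] along [s2] after [d]. As [y1] is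
    nondegenerate, the surjective part of this map does not lower the dimension, whence n1 <= n2; by
    symmetry the dimensions agree, the map is the identity, and [s1] and [s2] have the same
    sections. The conclusion is an equality of dependent pairs because the dimensions are part of
    it. *)
Lemma ez_unique m n1 n2 (s1 : dhom m n1) (s2 : dhom m n2) (y1 : X n1) (y2 : X n2) :
  dsurj s1 -> dsurj s2 -> nondeg y1 -> nondeg y2 -> fmap X s1 y1 = fmap X s2 y2 ->
  existT (fun n => (dhom m n * X n)%type) n1 (s1, y1) =
  existT (fun n => (dhom m n * X n)%type) n2 (s2, y2).
Proof.
have key k1 k2 (t1 : dhom m k1) (t2 : dhom m k2) (z1 : X k1) (z2 : X k2) d :
    nondeg z1 -> fmap X t1 z1 = fmap X t2 z2 ->
    dcomp t1 d = did k1 -> z1 = fmap X (dcomp t2 d) z2 /\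
    exists p (e : dhom k1 p) (g : dhom p k2),
      [/\ dcomp t2 d = dcomp g e, dsurj e, injective g & k1 <= p].
  move=> zn tz td; have zE : z1 = fmap X (dcomp t2 d) z2.
    by rewrite sset_fmapM -tz -sset_fmapM td sset_fmap1.
  split => //; have [p [g [e [tE gi es]]]] := dhom_image (dcomp t2 d).
  exists p, e, g; split => //; apply: (zn _ e (fmap X g z2)) => //.
  by rewrite -sset_fmapM -tE.
move=> ss1 ss2 yn1 yn2 e; have le : n1 = n2.
  have [d1 sd1] := dsurj_ex_section ss1; have [d2 sd2] := dsurj_ex_section ss2.
  have [_ [p1 [e1 [g1 [_ _ /dinj_leq gi1 le1]]]]] := key _ _ _ _ _ _ _ yn1 e sd1.
  have [_ [p2 [e2 [g2 [_ _ /dinj_leq gi2 le2]]]]] := key _ _ _ _ _ _ _ yn2 (esym e) sd2.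
  by apply/eqP; rewrite eqn_leq (leq_trans le1 gi1) (leq_trans le2 gi2).
move: s2 y2 ss2 yn2 e; rewrite -{n2}le => s2 y2 ss2 yn2 e.
have h (d : dhom n1 m) : dcomp s1 d = did n1 -> dcomp s2 d = did n1.
  move=> sd; have [_ [p [e1 [g1 [-> es gi np]]]]] := key _ _ _ _ _ _ _ yn1 e sd.
  have pn : p = n1 by apply/eqP; rewrite eqn_leq np (dinj_leq gi).
  move: e1 g1 es gi; rewrite pn => e1 g1 /dsurj_endo -> /dinj_id ->.
  by rewrite dcomp1.
have s12 := dsurj_eq ss1 h.
have [d sd] := dsurj_ex_section ss1.
have [yE _] := key _ _ _ _ _ _ _ yn1 e sd.
by rewrite (h d sd) sset_fmap1 in yE; rewrite s12 yE.
Qed.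

(** A section of [s] exhibits [y] as the image under [f] of a simplex of [X]; injectivity then
    transports the decomposition of [f n x] back to [x]. *)
Lemma nondeg_mono (Y : SSet) (f : hom X Y) n (x : X n) :
  sset_cofibration f -> nondeg x -> forall m (s : dhom n m) (y : Y m),
  dsurj s -> f n x = fmap Y s y -> n <= m.
Proof.
move=> fi xn m s y ss fx; have [d sd] := dsurj_ex_section ss.
have fmapE k l (a : dhom k l) (z : X l) : f k (fmap X a z) = fmap Y a (f l z).
  by have /(congr1 (fun h => h z)) := ntP f (a : @hom (op Delta) l k).
apply: (xn m s (fmap X d x)) => //; apply: (fi n).
by rewrite !fmapE fx -!sset_fmapM dcompA sd d1comp.
Qed.
End EilenbergZilber.

Lemma sset_hom_fmap (X Y : SSet) (f : hom X Y) k l (a : dhom k l) (z : X l) :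
  f k (fmap X a z) = fmap Y a (f l z).
Proof. by have /(congr1 (fun h => h z)) := ntP f (a : @hom (op Delta) l k). Qed.

(** The boundary of the simplex is the sieve of non-surjective operators, and a map from it to [K]
    is a compatible family [b] indexed by that sieve. *)
Definition boundary_lift (K Y : SSet) (p : hom K Y) :=
  forall n (y : Y n) (b : forall m (f : dhom m n), ~ dsurj f -> K m),
  (forall m (f : dhom m n) ns, p m (b m f ns) = fmap Y f y) ->
  (forall m l (f : dhom m n) (g : dhom l m) ns ns', b l (dcomp f g) ns' = fmap K g (b m f ns)) ->
  exists k : K n, p n k = y /\ forall m (f : dhom m n) ns, fmap K f k = b m f ns.

(* A map with the right lifting property against boundary inclusions lifts against every
   monomorphism: enlarge a partial section one nondegenerate simplex at a time. *)
Lemma section_extension (K Y : SSet) (p : hom K Y) (D : forall n, K n -> Prop) :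
  boundary_lift p ->
  (forall m n (a : dhom m n) (k : K n), D n k -> D m (fmap K a k)) ->
  (forall n (k k' : K n), D n k -> D n k' -> p n k = p n k' -> k = k') ->
  exists S : hom Y K, (forall n y, p n (S n y) = y) /\ forall n k, D n k -> S n (p n k) = k.
Proof.
move=> lift Dcl Dinj; pose T := {n : nat & K n}; pose el n (k : K n) : T := existT (fun n => K n) n k.
(* A partial section is recorded by the set of its values. [D] is adjoined in [L] instead of being
   required inside [A], so that the empty chain too has an admissible union. *)
pose L (A : set T) n (k : K n) := A (el n k) \/ D n k.
pose P (A : set T) := (forall m n (a : dhom m n) k, L A n k -> L A m (fmap K a k)) /\
  (forall n k k', L A n k -> L A n k' -> p n k = p n k' -> k = k').
have [F FP Ftot|A [[Acl Ainj] Amax]] := @Zorn_bigcup T P.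
  have LF n k : L (\bigcup_(X in F) X)%classic n k -> D n k \/ exists2 A, F A & A (el n k).
    by case=> [[A FA Ak]|]; [right; exists A|left].
  have FL A n k : F A -> L A n k -> L (\bigcup_(X in F) X)%classic n k.
    by move=> FA [Ak|]; [left; exists A|right].
  split=> [m n a k|n k k'].
    move=> /LF[/Dcl h|[A FA Ak]]; first by right; exact: h.
    by apply: (FL A) => //; apply: (FP A FA).1; left.
  move=> /LF[Dk|[A FA Ak]] /LF[Dk'|[A' FA' Ak']]; first exact: Dinj.
  - by apply: (FP A' FA').2; [right|left].
  - by apply: (FP A FA).2; [left|right].
  - have [h|h] := Ftot A A' FA FA'.
      by apply: (FP A' FA').2; left => //; exact: h.
    by apply: (FP A FA).2; left => //; exact: h.
have Aonto n (y : Y n) : exists k, L A n k /\ p n k = y.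
  elim/ltn_ind: n y => n IHn y; apply: contrapT => noy.
  have over m (f : dhom m n) : ~ dsurj f -> exists k, L A m k /\ p m k = fmap Y f y.
    move=> ns; have [q [d [e [fE di es]]]] := dhom_image f.
    have qn : q < n.
      rewrite ltn_neqAle (dinj_leq di) andbT; apply/negP => /eqP qn; apply: ns.
      by move: d e fE di es; rewrite qn => d e -> /dinj_id ->; rewrite d1comp.
    have [k [Lk pk]] := IHn q qn (fmap Y d y).
    exists (fmap K e k); split; first exact: Acl.
    by rewrite sset_hom_fmap pk -sset_fmapM -fE.
  pose b m (f : dhom m n) (ns : ~ dsurj f) := sval (cid (over m f ns)).
  have bL m f ns : L A m (b m f ns) by rewrite /b; case: cid => k [].
  have bp m f ns : p m (b m f ns) = fmap Y f y by rewrite /b; case: cid => k [].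
  have [|k [pk kb]] := lift n y b bp.
    move=> m l f g ns ns'; apply: Ainj => //; first exact: Acl.
    by rewrite bp sset_hom_fmap bp sset_fmapM.
  pose B : set T := fun t => L A (projT1 t) (projT2 t) \/
    exists (th : dhom (projT1 t) n), projT2 t = fmap K th k.
  have LB m (z : K m) : L B m z -> L A m z \/ exists th : dhom m n, z = fmap K th k.
    by case=> [[|]|]; [left|right|left; right].
  have AB : (A `<` B)%classic.
    split=> [[m z] Az|BA]; first by left; left.
    apply: noy; exists k; split=> //; left; apply: BA; right; exists (did n).
    by rewrite /= sset_fmap1.
  apply: (Amax B AB); split=> [m l a z|m z z'].
    move=> /LB[Az|[th ->]]; first by left; left; exact: Acl.
    by left; right; exists (dcomp th a); rewrite sset_fmapM.
  have nsA (th : dhom m n) : ~ dsurj th -> L A m (fmap K th k) by move=> ns; rewrite (kb _ _ ns).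
  have surjN (th : dhom m n) (w : K m) : L A m w -> p m w = fmap Y th y -> ~ dsurj th.
    move=> Lw pw /dsurj_ex_section[d td]; apply: noy; exists (fmap K d w).
    by split; [exact: Acl | rewrite sset_hom_fmap pw -sset_fmapM td sset_fmap1].
  have pth (th : dhom m n) : p m (fmap K th k) = fmap Y th y by rewrite sset_hom_fmap pk.
  move=> /LB[Lz|[th ->]] /LB[Lz'|[th' ->]].
  - exact: Ainj.
  - rewrite pth => e; apply: Ainj => //; last by rewrite pth.
    by apply: nsA; exact: surjN e.
  - rewrite pth => e; apply: Ainj => //; last by rewrite pth.
    by apply: nsA; apply: (surjN _ _ Lz'); rewrite e.
  - rewrite !pth => e; have [ss|ns] := pselect (dsurj th); last first.
      apply: Ainj; rewrite ?pth //; first exact: nsA.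
      by apply: (nsA); apply: (surjN _ _ (nsA _ ns)); rewrite pth.
    suff -> : th = th' by [].
    (* If [th'] after the section [d] of [th] were not surjective, [over] would give a value above
       its pullback of [y], which is [y] itself. *)
    apply: dsurj_eq => // d td; apply: dsurj_endo; apply: contrapT => ns.
    have [k' [Lk' pk']] := over _ _ ns; apply: noy; exists k'; split => //.
    by rewrite pk' sset_fmapM -e -sset_fmapM td sset_fmap1.
pose S' n (y : Y n) : K n := sval (cid (Aonto n y)).
have SL n y : L A n (S' n y) by rewrite /S'; case: cid => k [].
have Sp n y : p n (S' n y) = y by rewrite /S'; case: cid => k [].
have Snat m n (a : @hom (op Delta) m n) : S' n \o fmap Y a = fmap K a \o S' m.
  apply: funext => y /=; apply: Ainj; [exact: SL|exact/Acl/SL|].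
  by rewrite Sp sset_hom_fmap Sp.
exists (@NatTrans _ _ Y K S' Snat); split => [n y|n k Dk]; first exact: Sp.
by apply: Ainj; [exact: SL|right|rewrite Sp].
Qed.

Local Open Scope classical_set_scope.
Local Open Scope ring_scope.

(** * Supports of points of the simplex *)

Section Support.
Variable R : realType.

Lemma tsimplex_ge0 n (u : tsimplex R n) j : 0 <= val u 0 j.
Proof. by case: (set_valP u). Qed.
Lemma tsimplex_sum n (u : tsimplex R n) : \sum_j val u 0 j = 1.
Proof. by case: (set_valP u). Qed.
Lemma tsimplex_ex n (u : tsimplex R n) : exists j, val u 0 j != 0.
Proof.
apply: contrapT => h; have := tsimplex_sum u; rewrite big1 => [/esym/eqP|j _].
  by rewrite oner_eq0.
by apply/eqP/negPn/negP => uj; apply: h; exists j.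
Qed.

Lemma tmap_neq0 m n (f : 'I_m.+1 -> 'I_n.+1) (u : tsimplex R m) j :
  (val (tmap f u) 0 j != 0) <-> exists2 i, f i = j & val u 0 i != 0.
Proof.
rewrite tmapE; split=> [|[i fi ui]].
  apply: contraPP => h; apply/negP/negPn/eqP; apply: big1 => i /eqP fi.
  by apply/eqP/negPn/negP => ui; apply: h; exists i.
rewrite gt_eqF // (bigD1 i) ?fi //= ltr_wpDr ?sumr_ge0 // => [k _|].
  exact: tsimplex_ge0.
by rewrite lt_neqAle eq_sym ui tsimplex_ge0.
Qed.

Lemma tmap_support n (f : 'I_n.+1 -> 'I_n.+1) (u : tsimplex R n) :
  (forall j, val u 0 j != 0 -> f j = j) -> tmap f u = u.
Proof.
move=> h; apply: tsimplex_eq => j; rewrite tmapE big_mkcond /= (bigD1 j) //=.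
have -> : (if f j == j then val u 0 j else 0) = val u 0 j.
  by have [->|/h ->] := eqVneq (val u 0 j) 0; rewrite ?if_same ?eqxx.
rewrite big1 ?addr0 // => i ij; case: eqP => // fi; apply/eqP/negPn/negP => /h.
by rewrite fi => e; rewrite e eqxx in ij.
Qed.

Lemma tmap_inj m n (d : dhom m n) : injective d -> injective (@tmap R m n d).
Proof.
move=> di u v uv; apply: tsimplex_eq => j.
have e w : val (tmap d w) 0 (d j) = val w 0 j by apply: tmap_last => k; rewrite (inj_eq di).
by rewrite -!e uv.
Qed.

Lemma tmap_dcomp m n p (g : dhom n p) (f : dhom m n) (u : tsimplex R m) :
  tmap (dcomp g f) u = tmap g (tmap f u).
Proof. by rewrite tmap_comp; apply: eq_tmap => i; rewrite dcompE. Qed.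
Lemma tmap_did n (u : tsimplex R n) : tmap (did n) u = u.
Proof. by apply: tmap_id => i; rewrite didE. Qed.

(** This is a property of the image as a whole: it lies in no proper face. Different coordinates may
    be nonzero at different points. *)
Definition interior (T : Type) n (s : T -> tsimplex R n) := forall j, exists t, val (s t) 0 j != 0.

Lemma interior_surj (T : Type) m n (e : dhom m n) (s : T -> tsimplex R m) :
  dsurj e -> interior s -> interior (fun t => tmap e (s t)).
Proof.
move=> es si j; have [i ei] := es j; have [t ti] := si i.
by exists t; apply/tmap_neq0; exists i.
Qed.

(** The vertices with a somewhere nonzero coordinate span the smallest face containing the image.
    The retraction [e] onto it need not be monotone, as [tmap] accepts any map of vertices. *)
Lemma support_face (T : Type) (t0 : T) n (s : T -> tsimplex R n) :
  exists p (d : dhom p n) (e : 'I_n.+1 -> 'I_p.+1),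
    [/\ injective d, cancel d e, forall t, tmap d (tmap e (s t)) = s t
      & interior (fun t => tmap e (s t))].
Proof.
have [j0 j0P] := tsimplex_ex (s t0).
pose S := [set j | `[< exists t, val (s t) 0 j != 0 >]]%SET.
have j0S : j0 \in S by rewrite inE; apply/asboolP; exists t0.
have [p [d [di dP]]] := dhom_onto j0S.
have /choice[e ed] : forall j, exists y : 'I_p.+1, forall k, d k = j -> y = k.
  move=> j.
  have [[k dk]|h] := pselect (exists k, d k = j).
    by exists k => k'; rewrite -dk => /di.
  by exists ord0 => k dk; case: h; exists k.
have de : cancel d e by move=> k; exact: ed.
exists p, d, e; split => // [t|k].
  rewrite tmap_comp; apply: tmap_support => j sj /=.
  have /dP[k <-] : j \in S by rewrite inE; apply/asboolP; exists t.
  by rewrite de.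
have : d k \in S by apply/dP; exists k.
rewrite inE => /asboolP[t tk]; exists t; apply/tmap_neq0; exists (d k) => //.
Qed.

(** By interiority the images of [d1] and of [d2] are both the set of vertices supporting the common
    map, so [d1] and [d2] factor through the same face. *)
Lemma interior_unique (T : Type) n p1 p2 (d1 : dhom p1 n) (d2 : dhom p2 n)
    (s1 : T -> tsimplex R p1) (s2 : T -> tsimplex R p2) :
  interior s1 -> interior s2 -> (forall t, tmap d1 (s1 t) = tmap d2 (s2 t)) ->
  exists p (d : dhom p n) (e1 : dhom p1 p) (e2 : dhom p2 p),
    [/\ d1 = dcomp d e1, d2 = dcomp d e2, dsurj e1, dsurj e2
      & forall t, tmap e1 (s1 t) = tmap e2 (s2 t)].
Proof.
move=> i1 i2 e; have [p [d [e1 [d1E di es1]]]] := dhom_image d1.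
have im2 k : exists i, d2 i = d k.
  have [i ei] := es1 k; have [t ti] := i1 i.
  have /tmap_neq0[j dj _] : val (tmap d2 (s2 t)) 0 (d k) != 0.
    by rewrite -e; apply/tmap_neq0; exists i => //; rewrite d1E dcompE ei.
  by exists j.
have [|e2 d2E] := dinj_factor (f := d2) di.
  move=> i; have [t ti] := i2 i.
  have /tmap_neq0[j dj _] : val (tmap d1 (s1 t)) 0 (d2 i) != 0.
    by rewrite e; apply/tmap_neq0; exists i.
  by exists (e1 j); rewrite -dj d1E dcompE.
exists p, d, e1, e2; split => //.
  move=> k; have [i di2] := im2 k; exists i; apply: di.
  by rewrite -di2 d2E dcompE.
by move=> t; apply: (tmap_inj di); rewrite -!tmap_dcomp -d1E -d2E.
Qed.

Definition bdry n : set (tsimplex R n) := [set u : tsimplex R n | exists j, val u 0 j = 0].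

Lemma bdry_tmap m n (d : dhom m n) (u : tsimplex R m) : ~ dsurj d -> bdry (tmap d u).
Proof.
move=> /existsNP[j dj]; exists j; apply/eqP/negPn/negP => /tmap_neq0[i di _].
by apply: dj; exists i.
Qed.

Lemma bdry_face n (u : tsimplex R n) : bdry u ->
  exists m (f : dhom m n) (ns : ~ dsurj f) v, u = tmap f v.
Proof.
case=> j uj; have [p [d [e [_ _ uE ui]]]] := support_face tt (fun=> u).
exists p, d; have ns : ~ dsurj d.
  move=> /(_ j)[k dk]; have [[]] := ui k; move/eqP; apply; apply/eqP/negPn/negP => uk.
  have /eqP := uj; apply/negP; rewrite -(uE tt); apply/tmap_neq0; by exists k.
by exists ns, (tmap e u); rewrite (uE tt).
Qed.

(** * Gluing maps given on the faces of a simplex *)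

Section BoundaryGlue.
Variables (P Z : topologicalType) (n : nat).
Variable h : forall m (f : dhom m n), ~ dsurj f -> tsimplex R m -> P -> Z.
Hypothesis hP : forall m l (f : dhom m n) (g : dhom l m) ns ns' v,
  h (f := dcomp f g) ns' v = h (f := f) ns (tmap g v).

(** Each point is first reduced to the face that supports it; [interior_unique] then carries both
    values to one and the same face [d]. *)
Lemma boundary_glue_irr m1 m2 (f1 : dhom m1 n) (f2 : dhom m2 n) ns1 ns2 v1 v2 :
  tmap f1 v1 = tmap f2 v2 -> h (f := f1) ns1 v1 = h (f := f2) ns2 v2.
Proof.
move=> fv; have [p1 [d1 [r1 [_ _ vE1 i1]]]] := support_face tt (fun=> v1).
have [p2 [d2 [r2 [_ _ vE2 i2]]]] := support_face tt (fun=> v2).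
have [|p [d [e1 [e2 [E1 E2 s1 s2 eE]]]]] := interior_unique (d1 := dcomp f1 d1) (d2 := dcomp f2 d2) i1 i2.
  by move=> _; rewrite !tmap_dcomp (vE1 tt) (vE2 tt).
have nsd : ~ dsurj d by move=> ds; apply/ns1/(dsurj_left (f := d1)); rewrite E1; exact: dsurj_comp.
have key q m (f : dhom m n) ns (d' : dhom q m) (e : dhom q p) v w :
    tmap d' w = v -> dcomp f d' = dcomp d e -> h (f := f) ns v = h (f := d) nsd (tmap e w).
  move=> <- fd; have ns' : ~ dsurj (dcomp f d') by move/dsurj_left.
  rewrite -(hP ns ns'); move: ns'; rewrite fd => ns'; exact: hP.
by rewrite (key _ _ _ _ _ _ _ _ (vE1 tt) E1) (key _ _ _ _ _ _ _ _ (vE2 tt) E2) (eE tt).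
Qed.

Hypothesis hc : forall m (f : dhom m n) ns,
  continuous (fun q : tsimplex R m * P => h (f := f) ns q.1 q.2).

Lemma boundary_glue (z0 : Z) : exists H : tsimplex R n -> P -> Z,
  (forall m (f : dhom m n) ns v, H (tmap f v) = h (f := f) ns v) /\
  {within [set q : tsimplex R n * P | bdry q.1], continuous (fun q => H q.1 q.2)}.
Proof.
have /choice[H HP] : forall u : tsimplex R n, exists y : P -> Z,
    forall m (f : dhom m n) ns v, u = tmap f v -> y = h (f := f) ns v.
  move=> u; have [[m [f [ns [v uE]]]]|no] := pselect (exists m (f : dhom m n) (ns : ~ dsurj f) v, u = tmap f v).
    by exists (h ns v) => m' f' ns' v' uE'; apply: boundary_glue_irr; rewrite -uE.
  by exists (fun=> z0) => m f ns v uE; case: no; exists m, f, ns, v.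
exists H; split=> [m f ns v|]; first exact: HP.
(* A simplex of dimension 0 has empty boundary; otherwise the boundary is a finite union of closed
   facets. *)
case: n h hP hc H HP => [|n'] h' hP' hc' H HP.
  apply: (@within_eq _ _ _ (fun=> z0)); last exact/continuous_within/cst_continuous.
  move=> [u t] /= [j]; rewrite (ord1 j) => u0; have := tsimplex_sum u.
  by rewrite big_ord1 u0 => /esym/eqP; rewrite oner_eq0.
apply: (@within_paste_fin _ _ _ (fun j : 'I_n'.+2 => [set q : tsimplex R n'.+1 * P | val q.1 0 j = 0])) => //.
  move=> j; rewrite (_ : mkset _ = [set q : tsimplex R n'.+1 * P | val q.1 0 j <= 0]).
    apply: closed_le; last exact: cst_continuous.
    exact: comp_continuous (@fst_continuous _ _) (@simplex_coord_continuous R n'.+1 j).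
  apply/funext => q /=; apply/propext; split=> [->//|qj]; apply/eqP.
  by rewrite eq_le qj tsimplex_ge0.
(* A left inverse of the coface on vertices: it expresses the map on the facet opposite to [j] by a
   formula continuous on the whole simplex. *)
move=> j; pose r (i : 'I_n'.+2) : 'I_n'.+1 := odflt ord0 (unlift j i).
have ns : ~ dsurj (coface j).
  by move=> /(_ j)[i]; rewrite mk_dhomE => e; have := neq_lift j i; rewrite e eqxx.
apply: (@within_eq _ _ _ (fun q => h' _ _ ns (tmap r q.1) q.2)).
  move=> [u t] [/= uj _]; congr (_ t); apply/esym/HP; rewrite tmap_comp; apply/esym/tmap_support.
  move=> i /= ui; rewrite mk_dhomE /r; case: unliftP => [k ->//|ij].
  by rewrite ij uj eqxx in ui.
apply/continuous_within/(comp_continuous (f := fun q : tsimplex R n'.+1 * P => (tmap r q.1, q.2)) _ (hc' _ _ ns)).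
apply: pair_continuous; last exact: snd_continuous.
exact: comp_continuous (@fst_continuous _ _) (@tmap_continuous R _ _ r).
Qed.
End BoundaryGlue.
End Support.

(** * The simplex as a ball *)

(** Only the origin is at issue. Near it [x] divided by [mu x] stays bounded by [C] in norm, while
    [nu x] tends to 0. *)
Lemma radial_cont (R : realType) n (nu mu : 'rV[R]_n -> R) (C : R) :
  continuous nu -> continuous mu -> nu 0 = 0 ->
  (forall x, x != 0 -> mu x != 0) -> (forall x, `|x| <= C * `|mu x|) ->
  continuous (fun x => (nu x / mu x) *: x).
Proof.
move=> nc mc nu0 mu0 bnd x; have [->|x0] := eqVneq x 0; last first.
  have ic : (mu y)^-1 @[y --> x] --> (mu x)^-1 by exact: (cvgV (mu0 x x0) (mc x)).
  exact: (cvgZ (cvgM (nc x) ic) cvg_id).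
have nF := @nbhs_filter _ (0 : 'rV[R]_n).
suff h : `|(nu y / mu y) *: y| @[y --> (0 : 'rV[R]_n)] --> (0 : R).
  by rewrite /continuous_at scaler0; apply/norm_cvg0P; exact: h.
apply: (squeeze_cvgr (f := fun=> 0) (h := fun x => C * `|nu x|)).
- apply: nearW => y; rewrite normr_ge0 /=; have [->|y0] := eqVneq y 0.
    by rewrite scaler0 normr0 nu0 normr0 mulr0.
  have h : `|y| / `|mu y| <= C by rewrite ler_pdivrMr ?normr_gt0 ?mu0.
  by rewrite normrZ normrM normfV -mulrA mulrC [_^-1 * _]mulrC ler_wpM2r.
- exact: cvg_cst.
- rewrite -[X in _ --> X](mulr0 C); apply: cvgM; first exact: cvg_cst.
  rewrite [X in _ --> X](_ : 0 = `|nu 0|); last by rewrite nu0 normr0.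
  by apply: cvg_norm; exact: nc.
Qed.

Section SimplexBall.
Variables (R : realType) (n : nat).
Local Notation V := 'rV[R]_n.
Local Notation N := (n.+1%:R : R).

(* [x] in ['rV_n] stands for the point with barycentric coordinates [(1 + full x i) / (n + 1)] *)
Definition full (x : V) : 'rV[R]_n.+1 := mkv x (- \sum_j x 0 j).
(** The Minkowski functional of the simplex with its barycentre at the origin: nonnegativity of the
    barycentric coordinates means - [full x] <= 1 in each coordinate. *)
Definition gauge (x : V) : R := `|\row_(i < n.+1) Num.max 0 (- full x 0 i)|.
Definition bary (u : tsimplex R n) : V := \row_j (N * val u 0 (lift ord0 j) - 1).

Lemma full_sum x : \sum_i full x 0 i = 0.
Proof.
rewrite big_ord_recl -[full x 0 ord0]/(hpart (full x)) hpart_mkv.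
rewrite [X in _ + X](eq_bigr (fun j => x 0 j)) ?addNr // => j _.
by have := congr1 (fun w : V => w 0 j) (wpart_mkv x (- \sum_j x 0 j)); rewrite mxE.
Qed.

Lemma full_lift x j : full x 0 (lift ord0 j) = x 0 j.
Proof. by rewrite mxE liftK. Qed.

Lemma fullZ c x : full (c *: x) = c *: full x.
Proof.
apply/rowP => i; rewrite !mxE; case: (unliftP ord0 i) => [j|] _ /=; first by rewrite mxE.
by rewrite mulrN mulr_sumr; congr (- _); apply: eq_bigr => j _; rewrite mxE.
Qed.

Lemma full_cont : continuous full.
Proof.
apply: mkv_cont; first exact: idfun_continuous.
have h : continuous (fun x : V => \sum_j x 0 j).
  by apply: sum_continuous => j; exact: coord_continuous.
rewrite (_ : (fun x => _) = (fun x : V => 0 - \sum_j x 0 j)); last by apply: funext => x; rewrite sub0r.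
by apply: contB => //; exact: cont_cst.
Qed.

Lemma gauge_cont : continuous gauge.
Proof.
apply: cont_norm; apply: row_continuous => i.
rewrite (_ : (fun _ => _) = fun x : V => Num.max 0 (0 - full x 0 i)).
  apply: cont_max; first exact: cont_cst.
  apply: contB; first exact: cont_cst.
  exact: comp_continuous full_cont (@coord_continuous _ _ _ 0 i).
by apply: funext => x; rewrite !mxE sub0r.
Qed.

Lemma gauge_ge0 x : 0 <= gauge x. Proof. exact: normr_ge0. Qed.

Lemma gaugeZ c x : 0 <= c -> gauge (c *: x) = c * gauge x.
Proof.
move=> c0; rewrite /gauge fullZ -[in RHS](ger0_norm c0) -normrZ; congr (`|_|).
by apply/rowP => i; rewrite !mxE -mulrN maxr_pMr // mulr0.
Qed.

Lemma gauge0 : gauge 0 = 0.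
Proof. by rewrite -(scale0r 0) gaugeZ // mul0r. Qed.

Lemma gauge_coord x i : - full x 0 i <= gauge x.
Proof.
have := rV_coord_le (\row_(i < n.+1) Num.max 0 (- full x 0 i)) i.
by rewrite -/(gauge x) mxE; apply: le_trans; rewrite (le_trans _ (ler_norm _)) // le_max lexx orbT.
Qed.

Lemma gauge_le x r : 0 <= r -> (gauge x <= r) = [forall i, - full x 0 i <= r].
Proof.
move=> r0; apply/idP/forallP => [h i|h]; first exact: le_trans (gauge_coord x i) h.
rewrite /gauge rV_norm_le //; apply/forallP => i; rewrite mxE ger0_norm ?le_max ?lexx //.
by rewrite ge_max r0 /=; exact: h.
Qed.

(** The coordinates of [full x] sum to 0, so a large positive one is balanced by negative ones,
    which the gauge controls. *)
Lemma gauge_bound x : `|x| <= N * gauge x.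
Proof.
have g0 := gauge_ge0 x.
rewrite rV_norm_le ?mulr_ge0 //; apply/forallP => j; rewrite ler_norml -(full_lift x j).
apply/andP; split.
  rewrite lerNl (le_trans (gauge_coord _ _)) // ler_peMl // ler1n //.
have := full_sum x; rewrite (bigD1 (lift ord0 j)) //= => /eqP; rewrite addr_eq0 => /eqP ->.
rewrite -sumrN (le_trans (ler_sum _ (G := fun=> gauge x) _)) // => [i _|]; first exact: gauge_coord.
rewrite sumr_const -[gauge x *+ _]mulr_natl ler_wpM2r // ler_nat.
by rewrite (leq_trans (max_card _)) // card_ord.
Qed.

Lemma gauge_neq0 x : x != 0 -> gauge x != 0.
Proof.
apply: contra => /eqP g0; rewrite -normr_le0; have := gauge_bound x.
by rewrite g0 mulr0.
Qed.

Lemma full_bary u i : full (bary u) 0 i = N * val u 0 i - 1.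
Proof.
case: (unliftP ord0 i) => [j|] ->; first by rewrite full_lift mxE.
rewrite -[LHS]/(hpart (full (bary u))) hpart_mkv (eq_bigr (fun j => N * val u 0 (lift ord0 j) - 1)).
  rewrite sumrB -mulr_sumr sumr_const card_ord.
  have := tsimplex_sum u; rewrite big_ord_recl => h.
  have -> : \sum_(j < n) val u 0 (lift ord0 j) = 1 - val u 0 ord0 by rewrite -h addrAC subrr add0r.
  by rewrite -natr1; ring.
by move=> j _; rewrite mxE.
Qed.

Lemma gauge_bary_le u : gauge (bary u) <= 1.
Proof.
rewrite gauge_le //; apply/forallP => i; rewrite full_bary opprB lerBlDr lerDl.
by rewrite mulr_ge0 // tsimplex_ge0.
Qed.

Lemma gauge_bary_eq1 u : gauge (bary u) = 1 <-> bdry u.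
Proof.
have Npos : 0 < N by rewrite ltr0n.
split=> [g1|[i ui]]; last first.
  apply/eqP; rewrite eq_le gauge_bary_le /= (le_trans _ (gauge_coord (bary u) i)) //.
  by rewrite full_bary ui mulr0 sub0r opprK.
have : `|\row_(i < n.+1) Num.max 0 (- full (bary u) 0 i)| <= 1 by rewrite -/(gauge _) g1.
move/rV_norm_eq1 => [/(_ g1) [i + _]]; rewrite mxE full_bary opprB => h; exists i.
rewrite ger0_norm ?le_max ?lexx // in h.
have /eqP : N * val u 0 i = 0 by move: h; case: leP => _ h; lra.
by rewrite mulf_eq0 gt_eqF //= => /eqP.
Qed.

Lemma bary_inj : injective bary.
Proof.
move=> u v uv; apply: tsimplex_eq => i; have := congr1 (fun x => full x 0 i) uv.
have Npos : 0 < N by rewrite ltr0n.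
rewrite /= !full_bary => /(congr1 (fun x => (x + 1) / N)); rewrite !subrK.
by rewrite ![N * _]mulrC !mulfK // gt_eqF.
Qed.

Lemma bary_cont : continuous bary.
Proof.
apply: row_continuous => j; rewrite (_ : (fun _ => _) = fun u : tsimplex R n => N * val u 0 (lift ord0 j) - 1).
  apply: contB; last exact: cont_cst.
  by apply: contM; [exact: cont_cst | exact: simplex_coord_continuous].
by apply: funext => u; rewrite mxE.
Qed.

Definition clampv (x : V) : V := (Num.max 1 (gauge x))^-1 *: x.
Lemma clampv_gauge x : gauge (clampv x) <= 1.
Proof.
have h : 0 < Num.max 1 (gauge x) by rewrite lt_max ltr01.
by rewrite /clampv gaugeZ ?invr_ge0 ?(ltW h) // [_^-1 * _]mulrC ler_pdivrMr // mul1r le_max lexx orbT.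
Qed.

Lemma unbary_subproof x :
  std_simplex (\row_i ((1 + full (clampv x) 0 i) / N) : 'rV[R]_n.+1).
Proof.
have Npos : 0 < N by rewrite ltr0n.
split=> [i|].
  rewrite mxE divr_ge0 // -lerBlDl sub0r lerNl.
  exact: le_trans (gauge_coord _ _) (clampv_gauge x).
rewrite (eq_bigr (fun i => (1 + full (clampv x) 0 i) / N)) => [|i _]; last by rewrite mxE.
by rewrite -mulr_suml big_split /= full_sum addr0 sumr_const card_ord divff // gt_eqF.
Qed.
Definition unbary x : tsimplex R n := set_elt (unbary_subproof x).

Lemma unbaryK x : gauge x <= 1 -> bary (unbary x) = x.
Proof.
have Npos : 0 < N by rewrite ltr0n.
move=> g1; apply/rowP => j; rewrite mxE /= mxE mulrC divfK ?gt_eqF // addrC addKr full_lift.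
by rewrite /clampv max_l // invr1 scale1r.
Qed.
Lemma baryK u : unbary (bary u) = u.
Proof. by apply: bary_inj; rewrite unbaryK // gauge_bary_le. Qed.

Lemma unbary_cont : continuous unbary.
Proof.
apply: set_type_continuous; apply: row_continuous => i.
rewrite (_ : (fun _ => _) = fun x : V => (1 + full (clampv x) 0 i) / N); last first.
  by apply: funext => x; rewrite mxE.
apply: contM; last exact: cont_cst.
apply: contD; first exact: cont_cst.
have cc : continuous clampv.
  apply: contZ; last exact: idfun_continuous.
  apply: contV; first by apply: cont_max; [exact: cont_cst|exact: gauge_cont].
  by move=> x; rewrite gt_eqF // lt_max ltr01.
exact: comp_continuous (comp_continuous cc full_cont) (@coord_continuous _ _ _ 0 i).
Qed.

(** A radial rescaling which exchanges the gauge and the norm; at the origin the coefficient is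
    immaterial. *)
Definition to_ball (u : tsimplex R n) : V := (gauge (bary u) / `|bary u|) *: bary u.
Definition of_ball (w : V) : tsimplex R n := unbary ((`|w| / gauge w) *: w).

Lemma to_ball_norm u : `|to_ball u| = gauge (bary u).
Proof.
rewrite /to_ball normrZ normrM normfV normr_id ger0_norm ?gauge_ge0 //.
have [->|x0] := eqVneq (bary u) 0; first by rewrite normr0 mulr0 gauge0.
by rewrite divfK // normr_eq0.
Qed.
Lemma to_ball_disc u : `|to_ball u| <= 1.
Proof. by rewrite to_ball_norm gauge_bary_le. Qed.
Lemma to_ball_sphere u : `|to_ball u| = 1 <-> bdry u.
Proof. by rewrite to_ball_norm; exact: gauge_bary_eq1. Qed.

Lemma gauge_scaled w : gauge ((`|w| / gauge w) *: w) = `|w|.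
Proof.
rewrite gaugeZ ?divr_ge0 ?gauge_ge0 //.
have [->|w0] := eqVneq w 0; first by rewrite gauge0 mulr0 normr0.
by rewrite divfK // gauge_neq0.
Qed.

Lemma of_ballK w : `|w| <= 1 -> to_ball (of_ball w) = w.
Proof.
move=> w1; rewrite /to_ball /of_ball unbaryK ?gauge_scaled //.
have [->|w0] := eqVneq w 0; first by rewrite !scaler0.
have nw : `|w| != 0 by rewrite normr_eq0.
have gw := gauge_neq0 w0.
rewrite normrZ scalerA ger0_norm ?divr_ge0 ?gauge_ge0 // -[RHS]scale1r; congr (_ *: _).
by field; rewrite nw gw.
Qed.

Lemma to_ballK u : of_ball (to_ball u) = u.
Proof.
rewrite /of_ball to_ball_norm -[RHS]baryK; congr unbary.
have [x0|x0] := eqVneq (bary u) 0; first by rewrite /to_ball x0 !scaler0.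
have nx : `|bary u| != 0 by rewrite normr_eq0.
have gx := gauge_neq0 x0.
rewrite /to_ball gaugeZ ?divr_ge0 ?gauge_ge0 // scalerA -[RHS]scale1r; congr (_ *: _).
by field; rewrite nx gx.
Qed.

Lemma of_ball_bdry w : `|w| = 1 -> bdry (of_ball w).
Proof. by move=> w1; apply/to_ball_sphere; rewrite of_ballK // w1. Qed.

Lemma to_ball_cont : continuous to_ball.
Proof.
apply: (comp_continuous bary_cont (g := fun x : V => (gauge x / `|x|) *: x)).
apply: (@radial_cont _ _ _ _ 1) => //.
- exact: gauge_cont.
- by apply: cont_norm; exact: idfun_continuous.
- exact: gauge0.
- by move=> x; rewrite normr_eq0.
- by move=> x; rewrite mul1r normr_id.
Qed.

Lemma of_ball_cont : continuous of_ball.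
Proof.
apply: (comp_continuous _ unbary_cont); apply: (@radial_cont _ _ _ _ N).
- by apply: cont_norm; exact: idfun_continuous.
- exact: gauge_cont.
- exact: normr0.
- exact: gauge_neq0.
- by move=> x; rewrite ger0_norm ?gauge_ge0 // gauge_bound.
Qed.

End SimplexBall.

(** * Deformation retracts of realizations *)

Section Deformation.
Variable R : realType.
Local Notation I := (unit_interval R).
Variables (X Y : SSet) (i : hom X Y).

(* A simplex of [Y] with a homotopy from its characteristic map to a map which factors
   through the realization of [X]. A section of [def_proj] is a deformation of the
   realization of [Y] into that of [X]. *)
Record def_cell n := DefCell {
  dc_base : Y n;
  dc_path : tsimplex R n * I -> realization R Y;
  dc_end : tsimplex R n -> realization R X;
  dc_path_cont : continuous dc_path;
  dc_end_cont : continuous dc_end;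
  dc_path0 : forall u, dc_path (u, ui 0) = rpt dc_base u;
  dc_path1 : forall u, dc_path (u, ui 1) = realization_map i (dc_end u) }.

Lemma def_cell_eq n (a b : def_cell n) : dc_base a = dc_base b ->
  (forall u t, dc_path a (u, t) = dc_path b (u, t)) -> dc_end a =1 dc_end b -> a = b.
Proof.
case: a b => [y h k hc kc h0 h1] [y' h' k' hc' kc' h0' h1'] /= e1 e2 /funext e3.
have {}e2 : h = h' by apply: funext => -[u t].
move: hc kc h0 h1 hc' kc' h0' h1'; rewrite {}e1 {}e2 {}e3 => *.
by congr DefCell; exact: Prop_irrelevance.
Qed.

Definition def_fmap m n (a : dhom m n) (c : def_cell n) : def_cell m.
Proof.
apply: (@DefCell m (fmap Y a (dc_base c)) (fun p => dc_path c (tmap a p.1, p.2))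
  (fun u => dc_end c (tmap a u))).
- apply: (comp_continuous _ (@dc_path_cont n c)); apply: pair_continuous.
    exact: comp_continuous (@fst_continuous _ _) (@tmap_continuous R m n a).
  exact: snd_continuous.
- exact: comp_continuous (@tmap_continuous R m n a) (@dc_end_cont n c).
- by move=> u; rewrite dc_path0 rpt_glue.
- by move=> u; rewrite dc_path1.
Defined.

Definition def_sset : SSet.
Proof.
apply: (@Functor (op Delta) Sets def_cell (fun n m (a : dhom m n) c => def_fmap a c)).
- move=> n; apply: funext => c; apply: def_cell_eq => [|u t|u] /=.
  + exact: sset_fmap1.
  + by rewrite tmap_did.
  + by rewrite tmap_did.
- move=> n m p b a; apply: funext => c; apply: def_cell_eq => [|u t|u] /=.
  + exact: sset_fmapM.
  + by rewrite tmap_dcomp.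
  + by rewrite tmap_dcomp.
Defined.

Definition def_proj : hom def_sset Y :=
  @NatTrans _ _ def_sset Y dc_base (fun n m a => erefl).

Definition def_const n (x : X n) : def_sset n.
Proof.
apply: (@DefCell n (i n x) (fun p => rpt (i n x) p.1) (fun u => rpt x u)).
- exact: (@comp_continuous _ _ _ fst (fun u => rpt (i n x) u) (@fst_continuous _ _) (@rpt_continuous R Y n (i n x))).
- exact: rpt_continuous.
- by [].
- by move=> u; rewrite realization_map_rpt.
Defined.

Lemma def_const_fmap m n (a : dhom m n) (x : X n) :
  fmap def_sset a (def_const x) = def_const (fmap X a x).
Proof.
apply: def_cell_eq => [|u t|u] /=.
- by rewrite sset_hom_fmap.
- by rewrite sset_hom_fmap rpt_glue.
- by rewrite rpt_glue.
Qed.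

(** Strong deformation retraction given simplex by simplex, a form that can be glued degreewise
    along a pushout; [retract_data] recovers the maps of spaces. *)
Definition deformation_retract := exists S : hom Y def_sset,
  (forall n (y : Y n), def_proj n (S n y) = y) /\ forall n (x : X n), S n (i n x) = def_const x.

Section Lift.
Hypothesis comp : compress R (realization_map (R := R) i).
Hypothesis inh : realization R Y -> exists x : realization R X, True.

(* The collar homotopy of [box_fill] and then the one given by [compress] are run one after
   the other, over a time [1 + min 1 (2 - 2|v|)] which shrinks to 1 on the sphere, where the
   prescribed homotopy must be met exactly. *)
Definition stretch n (p : 'rV[R]_n * R) : R := p.2 * (1 + Num.min 1 (2 - 2 * `|p.1|)).

(** The homotopies prescribed on the faces glue to one on the boundary, which [box_fill] extends to
    the whole simplex. At time 1 the boundary has arrived in [X], and the disc so obtained is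
    compressed relative to its sphere. *)
Lemma def_boundary_lift : boundary_lift def_proj.
Proof.
move=> n y b bp bcompat; pose V := 'rV[R]_n.
have pathE m (f : dhom m n) ns (v : tsimplex R m) : dc_path (b m f ns) (v, ui 0) = rpt y (tmap f v).
  by rewrite dc_path0 -rpt_glue -(bp m f ns).
have [u0 _] : exists u : tsimplex R n, True by exists (of_ball 0).
have [x0 _] := inh (rpt y u0).
have [||P [HP Hc]] := @boundary_glue R I (realization R Y) n
  (fun m f ns v t => dc_path (b m f ns) (v, t)) _ _ (rpt y u0).
- by move=> m l f g ns ns' v; apply: funext => t; rewrite (bcompat _ _ _ _ ns).
- move=> m f ns; rewrite (_ : (fun q => _) = dc_path (b m f ns)); first exact: dc_path_cont.
  by apply: funext => -[].
have [||E [EP Ec]] := @boundary_glue R I (realization R X) n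
  (fun m f ns v _ => dc_end (b m f ns) v) _ _ x0.
- by move=> m l f g ns ns' v; apply: funext => t; rewrite (bcompat _ _ _ _ ns).
- move=> m f ns; exact: comp_continuous (@fst_continuous _ _) (@dc_end_cont _ _).
have P0 u : bdry u -> P u (ui 0) = rpt y u.
  by move=> /bdry_face[m [f [ns [v ->]]]]; rewrite HP pathE.
have P1 u : bdry u -> P u (ui 1) = realization_map i (E u (ui 0)).
  by move=> /bdry_face[m [f [ns [v ->]]]]; rewrite HP EP dc_path1.
pose a (v : V) := rpt y (of_ball v).
pose bb (q : V * R) := P (of_ball q.1) (ui q.2).
have ballc : continuous (fun q : V * R => (of_ball q.1, ui q.2 : I)).
  apply: pair_continuous.
    exact: comp_continuous (@fst_continuous _ _) (@of_ball_cont R n).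
  exact: comp_continuous (@snd_continuous _ _) (@ui_continuous R).
have ac : {within @disc R n, continuous a}.
  apply: continuous_within.
  exact: (@comp_continuous _ _ _ (@of_ball R n) (fun u => rpt y u) (@of_ball_cont R n) (@rpt_continuous R Y n y)).
have bbc : {within @side R n, continuous bb}.
  apply: (within_comp Hc (continuous_within ballc)) => -[v t] [/= v1 _].
  exact: of_ball_bdry.
have [|e [ec e0 es _]] := box_fill ac bbc.
  by move=> v v1; rewrite /bb /= P0 //; exact: of_ball_bdry.
pose g v := e (v, 1); pose f v := E (of_ball v) (ui 0).
have at1 : continuous (fun v : V => (v, 1 : R)).
  by apply: pair_continuous; [exact: idfun_continuous|exact: cst_continuous].
have I1 : 0 <= (1 : R) <= 1 by rewrite ler01 lexx.
have gf : pair_map (realization_map i) g f.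
  split.
  - by apply: (within_comp ec (continuous_within at1)).
  - apply: (within_comp Ec (g := fun v : V => (of_ball v, ui 0 : I))).
      apply/continuous_within/pair_continuous; [exact: of_ball_cont|exact: cst_continuous].
    by move=> v v1; exact: of_ball_bdry.
  - by move=> v v1; rewrite /g es // /bb /= P1 //; exact: of_ball_bdry.
have [G [F [Gc Fc G0 F0 FG]]] := comp gf.
pose s (v : V) := Num.min 1 (2 - 2 * `|v|).
have sP v : `|v| <= 1 -> 0 <= s v <= 1.
  by move=> v1; rewrite le_min ler01 ge_min lexx /= andbT; lra.
have sc : continuous s.
  apply: cont_min; first exact: cont_cst.
  apply: contB; first exact: cont_cst.
  by apply: contM; [exact: cont_cst|apply: cont_norm; exact: idfun_continuous].
(* A compression may move the sphere. [sh] sweeps the bottom of the cylinder towards its top and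
   side while holding the sphere at time 0, which turns the compression into one relative to the
   sphere. *)
pose sh (q : V * R) := (pos q, q.2 - depth q).
have shc : continuous sh.
  apply: pair_continuous; first exact: pos_cont.
  by apply: contB; [exact: snd_cont|exact: depth_cont].
have sh_cyl q : cyl q -> cyl (sh q).
  move=> cq; have /andP[d0 dt] := depth_range cq; case: cq => _ /andP[t0 t1].
  by split; [exact: pos_disc | rewrite /=; lra].
(* Origin of 2 - 2|v|: for |v| <= 1/2 the time is 1 and the point ends on the top at 2v; beyond that
   (1 + s)|v| - 1 = (2|v| - 1)(1 - |v|) >= 0, so that it ends on the side. *)
have sh_top v : `|v| <= 1 -> topside (sh (v, s v)).
  move=> v1; have cq : cyl (v, s v) by split => //; exact: sP.
  split; first exact: sh_cyl.
  have /andP[s0 _] := sP v v1.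
  have [/= d0|/= p1] := depth_pos (p := (v, s v)) s0; last by right.
  have [s1|s1] := eqVneq (s v) 1; first by left; rewrite /= d0 s1 subr0.
  right; rewrite /= pos_norm //= min_l //.
  have sE : s v = 2 - 2 * `|v|.
    by move: s1; rewrite /s; case: leP => //; rewrite eqxx.
  have h : 2 - 2 * `|v| < 1.
    by rewrite -sE lt_neqAle s1; case/andP: (sP v v1).
  rewrite sE -subr_ge0.
  have -> : (1 + (2 - 2 * `|v|)) * `|v| - 1 = (2 * `|v| - 1) * (1 - `|v|) by ring.
  by rewrite mulr_ge0 //; lra.
pose h (q : V * R) := if stretch q <= 1 then e (q.1, stretch q)
  else G (sh (q.1, stretch q - 1)).
pose k (v : V) := F (sh (v, s v)).
have strc : continuous (@stretch n).
  apply: contM; first exact: snd_cont.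
  apply: contD; first exact: cont_cst.
  exact: comp_continuous (@fst_cont R n) sc.
have strP q : cyl q -> 0 <= stretch q <= 1 + s q.1.
  move=> [q1 /andP[t0 t1]]; have /andP[s0 s1] := sP _ q1.
  rewrite /stretch -/(s q.1) mulr_ge0 ?addr_ge0 //= ler_piMl // addr_ge0 //.
have hc : {within @cyl R n, continuous h}.
  apply: within_if => //; first exact: cst_continuous.
  - apply: (within_comp ec); first by apply/continuous_within/pair_continuous => //; exact: fst_cont.
    by move=> q [/= q1 cq]; split; [case: cq | case/andP: (strP q cq) => /= -> _].
  - apply: (within_comp Gc).
      apply/continuous_within/(comp_continuous _ shc)/pair_continuous; first exact: fst_cont.
      by apply: contB => //; exact: cst_continuous.
    move=> q [/= q1 cq]; apply: sh_cyl; split; first by case: cq.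
    have := strP q cq; have [/sP] := cq; rewrite /=; lra.
  - move=> q [q1 _] ->; rewrite subrr /sh pos0 // depth0 // subr0 G0 //.
have kc : {within @disc R n, continuous k}.
  apply: (within_comp Fc); last by move=> v; exact: sh_top.
  by apply/continuous_within/(comp_continuous _ shc)/pair_continuous; [exact: idfun_continuous|].
have str0 v : stretch (v, 0) = 0 by rewrite /stretch mul0r.
have str1 v : stretch (v, 1) = 1 + s v by rewrite /stretch mul1r.
have sS v : `|v| = 1 -> s v = 0 by move=> v1; rewrite /s v1 mulr1 subrr min_r.
have h0 v : `|v| <= 1 -> h (v, 0) = rpt y (of_ball v).
  by move=> v1; rewrite /h str0 ler01 e0.
have kS v : `|v| = 1 -> k v = E (of_ball v) (ui 0).
  by move=> v1; rewrite /k sS // /sh pos0 ?depth0 ?v1 // subr0 F0.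
have h1 v : `|v| <= 1 -> h (v, 1) = realization_map i (k v).
  move=> v1; rewrite /h str1 -lerBrDl subrr; case: leP => sv.
    have s0 : s v = 0 by apply/eqP; rewrite eq_le sv; case/andP: (sP v v1).
    have v1' : `|v| = 1 by move: s0; rewrite /s; case: leP => [_ /eqP|]; rewrite ?oner_eq0 //; lra.
    by rewrite s0 addr0 kS // -[e (v, 1)]/(g v); case: gf => _ _ ->.
  by rewrite /= addrAC subrr add0r /k FG //; exact: sh_top.
have hS v t : `|v| = 1 -> 0 <= t <= 1 -> h (v, t) = P (of_ball v) (ui t).
  move=> v1 t1; have st : stretch (v, t) = t by rewrite /stretch -/(s v) sS // addr0 mulr1.
  by rewrite /h st /= es //; case/andP: t1 => _ ->.
have zc : continuous (fun q : tsimplex R n * I => (to_ball q.1, val q.2 : R)).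
  apply: pair_continuous.
    exact: comp_continuous (@fst_continuous _ _) (@to_ball_cont R n).
  exact: comp_continuous (@snd_continuous _ _) (@val_continuous _ _).
have ends : [/\ val (ui 0 : I) = 0 & val (ui 1 : I) = 1] by rewrite !val_ui ?lexx ?ler01.
have [v0 v1] := ends.
have c0 : continuous (fun q : tsimplex R n * I => h (to_ball q.1, val q.2)).
  apply: (within_comp_continuous hc zc) => q; split; [exact: to_ball_disc | exact: ui_range].
have c1 : continuous (fun u : tsimplex R n => k (to_ball u)).
  exact: (within_comp_continuous kc (@to_ball_cont R n) (@to_ball_disc R n)).
have e1 u : h (to_ball u, val (ui 0 : I)) = rpt y u.
  by rewrite v0 h0 ?to_ballK //; exact: to_ball_disc.
have e2 u : h (to_ball u, val (ui 1 : I)) = realization_map i (k (to_ball u)).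
  by rewrite v1 h1 //; exact: to_ball_disc.
exists (@DefCell n y _ _ c0 c1 e1 e2); split => // m d ns.
have faceS (u : tsimplex R m) : `|to_ball (tmap d u)| = 1.
  exact/to_ball_sphere/bdry_tmap.
apply: def_cell_eq => [|u t|u] /=.
- by rewrite -(bp m d ns).
- by rewrite hS ?faceS ?to_ballK ?HP ?ui_val //; exact: ui_range.
- by rewrite kS ?faceS ?to_ballK ?EP.
Qed.

Theorem compress_deformation_retract : sset_cofibration i -> deformation_retract.
Proof.
move=> mono.
have [||S [Sp SD]] := @section_extension def_sset Y def_proj
  (fun n c => exists x : X n, c = def_const x) def_boundary_lift.
- by move=> m n a _ [x ->]; exists (fmap X a x); rewrite def_const_fmap.
- by move=> n _ _ [x ->] [x' ->] /= /mono ->.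
by exists S; split=> // n x; apply: (SD n (def_const x)); exists x.
Qed.
End Lift.

End Deformation.

(** * Retracts and weak homotopy equivalences *)

Section Concat.
Variable R : realType.
Local Notation I := (unit_interval R).

Lemma val_ui0 : val (ui 0 : I) = 0. Proof. by rewrite val_ui ?lexx ?ler01. Qed.
Lemma val_ui1 : val (ui 1 : I) = 1. Proof. by rewrite val_ui ?lexx ?ler01. Qed.
Lemma ui0E (t : I) : val t = 0 -> t = ui 0. Proof. by move=> e; rewrite -(ui_val t) e. Qed.
Lemma ui1E (t : I) : val t = 1 -> t = ui 1. Proof. by move=> e; rewrite -(ui_val t) e. Qed.

(** The last clause keeps track of the values, so that conditions relative to a boundary survive
    concatenation. *)
Lemma homotopy_concat (T Y : topologicalType) (a b : T * I -> Y) :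
  continuous a -> continuous b -> (forall x, a (x, ui 1) = b (x, ui 0)) ->
  exists c : T * I -> Y, [/\ continuous c, forall x, c (x, ui 0) = a (x, ui 0),
    forall x, c (x, ui 1) = b (x, ui 1)
    & forall x t, (exists s, c (x, t) = a (x, s)) \/ (exists s, c (x, t) = b (x, s))].
Proof.
move=> ac bc ab; have vc : continuous (fun p : T * I => val p.2 : R).
  exact: comp_continuous (@snd_continuous _ _) (@val_continuous _ _).
have dc : continuous (fun p : T * I => 2 * val p.2 : R) by apply: contM => //; exact: cst_continuous.
exists (fun p => if val p.2 <= 2^-1 then a (p.1, ui (2 * val p.2)) else b (p.1, ui (2 * val p.2 - 1))).
split.
- apply/withinP/within_if => //; first exact: cst_continuous.
  + apply/continuous_within/(comp_continuous _ ac)/pair_continuous; first exact: fst_continuous.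
    exact: comp_continuous dc (@ui_continuous R).
  + apply/continuous_within/(comp_continuous _ bc)/pair_continuous; first exact: fst_continuous.
    apply: (comp_continuous (f := fun p : T * I => 2 * val p.2 - 1) _ (@ui_continuous R)).
    by apply: contB => //; exact: cst_continuous.
  + by move=> [x t] _ /= ->; rewrite divff // subrr ab.
- by move=> x; rewrite [val _]val_ui0 invr_ge0 ler0n mulr0.
- move=> x; rewrite [val _]val_ui1 mulr1; case: leP => [h|_]; first by exfalso; lra.
  by congr (b (x, ui _)); lra.
- by move=> x t /=; case: ifP => _; [left|right]; eexists.
Qed.

Lemma joined_trans (X : topologicalType) (x y z : X) : joined R x y -> joined R y z -> joined R x z.
Proof.
move=> [p [pc p0 p1]] [q [qc q0 q1]].
have [|||c [cc c0 c1 _]] := @homotopy_concat I X (fun s => p s.2) (fun s => q s.2).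
- exact: comp_continuous (@snd_continuous _ _) pc.
- exact: comp_continuous (@snd_continuous _ _) qc.
- by move=> _ /=; rewrite p1 ?q0 ?val_ui0 ?val_ui1.
exists (fun t => c (ui 0, t)); split.
- apply: (comp_continuous _ cc); apply: pair_continuous; [exact: cst_continuous|exact: idfun_continuous].
- by move=> t /ui0E ->; rewrite c0 p0 // val_ui0.
- by move=> t /ui1E ->; rewrite c1 q1 // val_ui1.
Qed.

Lemma joined_map (X Y : topologicalType) (f : X -> Y) (x y : X) :
  continuous f -> joined R x y -> joined R (f x) (f y).
Proof.
move=> fc [p [pc p0 p1]]; exists (fun t => f (p t)); split.
- exact: comp_continuous pc fc.
- by move=> t /p0 ->.
- by move=> t /p1 ->.
Qed.

Lemma homotopic_trans (X : topologicalType) n (x : X) (a b c : cube R n -> X) :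
  homotopic x a b -> homotopic x b c -> homotopic x a c.
Proof.
move=> [h [hc h0 h1 hx]] [k [kc k0 k1 kx]].
have [|l [lc l0 l1 lP]] := homotopy_concat hc kc.
  by move=> v; rewrite h1 ?k0 ?val_ui0 ?val_ui1.
exists l; split => //.
- by move=> v t /ui0E ->; rewrite l0 h0 // val_ui0.
- by move=> v t /ui1E ->; rewrite l1 k1 // val_ui1.
- by move=> v t vb; have [[s ->]|[s ->]] := lP v t; [exact: hx|exact: kx].
Qed.

Lemma homotopic_map (X Y : topologicalType) (f : X -> Y) n (x : X) (a b : cube R n -> X) :
  continuous f -> homotopic x a b -> homotopic (f x) (f \o a) (f \o b).
Proof.
move=> fc [h [hc h0 h1 hx]]; exists (fun p => f (h p)); split.
- exact: comp_continuous hc fc.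
- by move=> v t /h0 ->.
- by move=> v t /h1 ->.
- by move=> v t /hx ->.
Qed.

(** Spheroids and homotopies in [Y] are pushed into [X] by [r]. As [D] is stationary on [X], base
    points stay put and no change of base point enters. *)
Lemma whe_comp_retract (X Y Z : topologicalType) (i : X -> Y) (w : Y -> Z)
    (D : Y * I -> Y) (r : Y -> X) :
  continuous i -> continuous D -> continuous r ->
  (forall y, D (y, ui 0) = y) -> (forall y, D (y, ui 1) = i (r y)) ->
  (forall x t, D (i x, t) = i x) -> (forall x, r (i x) = x) ->
  weak_homotopy_equivalence R w -> weak_homotopy_equivalence R (w \o i).
Proof.
move=> ic Dc rc D0 D1 Di ri [wc winj wsurj wpi].
have jD y : joined R (i (r y)) y.
  exists (fun t => D (y, ui (1 - val t))); split.
  - apply: (comp_continuous _ Dc); apply: pair_continuous; first exact: cst_continuous.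
    apply: (comp_continuous (f := fun t : I => 1 - val t) _ (@ui_continuous R)).
    by apply: contB; [exact: cst_continuous|exact: val_continuous].
  - by move=> t ->; rewrite subr0 D1.
  - by move=> t ->; rewrite subrr D0.
split.
- exact: comp_continuous ic wc.
- move=> x x' /winj h; rewrite -(ri x) -(ri x'); exact: (joined_map (f := r)).
- move=> z; have [y wy] := wsurj z; exists (r y).
  by apply: joined_trans wy; exact: (joined_map (f := w)).
- move=> n x n0; have [pinj psurj] := wpi n (i x) n0; split.
  + move=> a b [ac ax] [bc bx] h.
    have := pinj (i \o a) (i \o b) _ _ h; case.
    * by split; [exact: comp_continuous ac ic|move=> v /ax /= ->].
    * by split; [exact: comp_continuous bc ic|move=> v /bx /= ->].
    move=> k [kc k0 k1 kx]; exists (fun p => r (k p)); split.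
    * exact: comp_continuous kc rc.
    * by move=> v t /k0 -> /=.
    * by move=> v t /k1 -> /=.
    * by move=> v t /kx ->.
  + move=> c cs; have [a [ac ax] ah] := psurj c cs.
    exists (fun v => r (a v)).
      by split; [exact: comp_continuous ac rc|move=> v /ax ->].
    apply: homotopic_trans ah; apply: (homotopic_map (f := w) (a := fun v => i (r (a v)))) => //.
    exists (fun p => D (a p.1, ui (1 - val p.2))); split.
    * apply: (comp_continuous _ Dc); apply: pair_continuous.
        exact: comp_continuous (@fst_continuous _ _) ac.
      apply: (comp_continuous (f := fun p : cube R n * I => 1 - val p.2) _ (@ui_continuous R)).
      apply: contB; first exact: cst_continuous.
      exact: comp_continuous (@snd_continuous _ _) (@val_continuous _ _).
    * by move=> v t t0 /=; rewrite t0 subr0 D1.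
    * by move=> v t t1 /=; rewrite t1 subrr D0.
    * by move=> v t /ax /= ->; rewrite Di.
Qed.

Lemma realization_map_cont (X Y : SSet) (f : hom X Y) : continuous (realization_map (R := R) f).
Proof.
have [||H [Hc HE]] := @realization_rec R X (realization R Y) (fun n x u => rpt (f n x) u).
- by move=> n x; exact: rpt_continuous.
- by move=> m n a x u; rewrite sset_hom_fmap rpt_glue.
rewrite (_ : realization_map f = H) //; apply: funext; apply: rpt_ind => n x u.
by rewrite realization_map_rpt HE.
Qed.

Lemma retract_data (X Y : SSet) (i : hom X Y) : deformation_retract R i ->
  exists (D : realization R Y * I -> realization R Y) (r : realization R Y -> realization R X),
  [/\ continuous D, continuous r, forall y, D (y, ui 0) = y,
      forall y, D (y, ui 1) = realization_map i (r y) &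
      (forall x t, D (realization_map i x, t) = realization_map i x) /\
      forall x, r (realization_map i x) = x].
Proof.
move=> [S [Sp Si]].
have Sn m n (a : dhom m n) y : S m (fmap Y a y) = def_fmap a (S n y) := sset_hom_fmap S a y.
have [||D [Dc DE]] := @realization_rec_htpy R Y (realization R Y) (fun n y => dc_path (S n y)).
- by move=> n y; exact: dc_path_cont.
- by move=> m n a y u t; rewrite Sn.
have [||r [rc rE]] := @realization_rec R Y (realization R X) (fun n y => dc_end (S n y)).
- by move=> n y; exact: dc_end_cont.
- by move=> m n a y u; rewrite Sn.
exists D, r; split => //; last split.
- by apply: rpt_ind => n y u; rewrite DE dc_path0 -[dc_base _]/(def_proj R i n (S n y)) Sp.
- by apply: rpt_ind => n y u; rewrite DE dc_path1 rE.
- by apply: rpt_ind => n x u t; rewrite realization_map_rpt DE Si.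
- by apply: rpt_ind => n x u; rewrite realization_map_rpt rE Si.
Qed.

Section Glued.
Variables (A A' B Q : SSet) (f : hom A A') (g : hom A B) (i : hom A' Q) (j : hom B Q).

(** The elements of a pushout of sets along an injection [f], in each degree. In this form the
    property passes to fixed points. *)
Definition glued_square := [/\ forall n a, i n (f n a) = j n (g n a),
  forall n q, (exists b, q = j n b) \/ (exists a', q = i n a'),
  forall n, injective (j n),
  forall n a' a'', i n a' = i n a'' -> a' = a'' \/ exists a, a' = f n a
  & forall n a' b, i n a' = j n b -> exists2 a, a' = f n a & b = g n a].

Definition def_push n (c : def_cell R f n) : (forall n a, i n (f n a) = j n (g n a)) -> def_cell R j n.
Proof.
move=> comm; apply: (@DefCell R B Q j n (i n (dc_base c)) (fun p => realization_map i (dc_path c p))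
  (fun u => realization_map g (dc_end c u))).
- exact: comp_continuous (@dc_path_cont _ _ _ _ _ c) (@realization_map_cont _ _ i).
- exact: comp_continuous (@dc_end_cont _ _ _ _ _ c) (@realization_map_cont _ _ g).
- by move=> u; rewrite dc_path0 realization_map_rpt.
- move=> u; rewrite dc_path1; move: (dc_end c u); apply: rpt_ind => m x v.
  by rewrite !realization_map_rpt comm.
Defined.

(** Simplices of [B] receive constant cells, and those of [A'] the images of their cells. The two
    prescriptions agree on the overlap because cells over [A] are constant. *)
Lemma deformation_retract_pushout :
  glued_square -> deformation_retract R f -> deformation_retract R j.
Proof.
move=> [comm cover jinj isep cross] [S [Sp Si]].
have pushconst n a : def_push (def_const R f a) comm = def_const R j (g n a).
  apply: def_cell_eq => [|u t|u] /=; first exact: comm.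
    by rewrite realization_map_rpt comm.
  by rewrite realization_map_rpt.
have ex n (q : Q n) : exists c : def_cell R j n,
    [/\ dc_base c = q, forall b, q = j n b -> c = def_const R j b
      & forall a', q = i n a' -> c = def_push (S n a') comm].
  have inB b : [/\ dc_base (def_const R j b) = j n b,
      forall b', j n b = j n b' -> def_const R j b = def_const R j b'
      & forall a', j n b = i n a' -> def_const R j b = def_push (S n a') comm].
    split=> [//|b' /jinj -> //|a' /esym/cross[a -> ->]].
    by rewrite Si pushconst.
  have [[b ->]|[a' qE]] := cover n q; first by exists (def_const R j b).
  have [[b qb]|nb] := pselect (exists b, q = j n b); first by exists (def_const R j b); rewrite qb.
  exists (def_push (S n a') comm); split=> [|b qb|a'' qE''].
  - by rewrite /= -[dc_base _]/(def_proj R f n (S n a')) Sp.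
  - by case: nb; exists b.
  - have [-> //|[a aE]] := isep n a' a'' (etrans (esym qE) qE'').
    by case: nb; exists (g n a); rewrite qE aE comm.
pose W n (q : Q n) : def_sset R j n := sval (cid (ex n q)).
have Wbase n q : dc_base (W n q) = q by rewrite /W; case: cid => c [].
have Wj n b : W n (j n b) = def_const R j b by rewrite /W; case: cid => c /= [_ h _]; exact: h.
have Wi n a' : W n (i n a') = def_push (S n a') comm.
  by rewrite /W; case: cid => c /= [_ _ h]; exact: h.
have Wnat n m (a : @hom (op Delta) n m) : W m \o fmap Q a = fmap (def_sset R j) a \o W n.
  apply: funext => q /=; have [[b ->]|[a' ->]] := cover n q.
    by rewrite -[fmap Q a _](sset_hom_fmap j) !Wj -def_const_fmap.
  rewrite -[fmap Q a _](sset_hom_fmap i) !Wi sset_hom_fmap.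
  by apply: def_cell_eq => //=; rewrite -sset_hom_fmap.
exists (@NatTrans _ _ Q (def_sset R j) W Wnat); split=> [n q|n b]; [exact: Wbase|exact: Wj].
Qed.
End Glued.
End Concat.

(** * Colimits *)

Local Close Scope ring_scope.
Local Close Scope classical_set_scope.
Section TensorColimits.
Variable B : functor Delta CSet.

Lemma tensor_glue (X : SSet) k m n (a : dhom m n) (x : X n) (y : Bob B m k) :
  tensor (fmap X a x) y = tensor x (Bmap B a k y).
Proof. exact/qclassP/TensorRel. Qed.

Lemma tensor_rec (X : SSet) k (E : Type) (h : forall n, X n -> Bob B n k -> E) :
  (forall m n (a : dhom m n) (x : X n) y, h m (fmap X a x) y = h n x (Bmap B a k y)) ->
  exists H : tensor_level B X k -> E, forall n x y, H (tensor x y) = h n x y.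
Proof.
move=> hP; pose g (q : tensor_pre B X k) := h _ (projT2 q).1 (projT2 q).2.
exists (fun q => g (repr (q : quot (@tensor_rel B X k)))) => n x y.
have gP p q : tensor_rel p q -> g p = g q by case=> *; exact: hP.
by apply: (qclass_compat gP (y := tensor_elt x y)); rewrite /qclass reprK.
Qed.

Variable C : cset.

Definition compat_family (n : nat) (phi : forall k : nat, Bob B n k -> C k) :=
  (forall k l (b : dhom l k) y, phi l (fmap (Bob B n) b y) = fmap C b (phi k y)) /\
  (forall k (y : Bob B n k), phi k (cyc y) = cyc (phi k y)).

(* [cset_map] lives in too large a universe to be an object of [Sets]. *)
Definition nerve_ob (n : nat) := {phi : forall k : nat, Bob B n k -> C k | compat_family phi}.

Lemma nerve_map_subproof m n (a : dhom m n) (phi : nerve_ob n) :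
  compat_family (fun k y => sval phi k (Bmap B a k y)).
Proof.
case: phi => phi [phin phic] /=; split=> [k l b y|k y]; first by rewrite -Bmap_natural phin.
by rewrite (cmap_cyc (Bmap B a)) phic.
Qed.
Definition nerve_map m n (a : dhom m n) (phi : nerve_ob n) : nerve_ob m :=
  exist _ _ (nerve_map_subproof a phi).

Lemma nerve_eq n (phi psi : nerve_ob n) : (forall k y, sval phi k y = sval psi k y) -> phi = psi.
Proof.
case: phi psi => [phi p] [psi q] /= e; apply: eq_exist.
by apply: functional_extensionality_dep => k; apply: funext.
Qed.

Definition nerve : SSet.
Proof.
apply: (@Functor (op Delta) Sets nerve_ob (fun n m (a : dhom m n) phi => nerve_map a phi)).
- move=> n; apply: funext => phi; apply: nerve_eq => k y /=; by rewrite Bmap_id.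
- move=> n m p b a; apply: funext => phi; apply: nerve_eq => k y /=; by rewrite Bmap_comp.
Defined.

Lemma adj_subproof (X : SSet) (w : cset_map (tensor_ob B X) C) n (x : X n) :
  compat_family (fun k y => w k (tensor x y)).
Proof.
split=> [k l b y|k y].
  by rewrite -(@sset_hom_fmap (tensor_ob B X) C w _ _ b (tensor x y)) [in RHS](tensor_fmapE b).
by rewrite -cmap_cyc -[cyc (tensor x y : tensor_ob B X k)]/(tensor_cyc (tensor x y)) tensor_cycE'.
Qed.

Lemma adj_natural (X : SSet) (w : cset_map (tensor_ob B X) C) (n m : op Delta) (a : @hom (op Delta) n m) :
  (fun x : X m => exist _ _ (adj_subproof w x) : nerve m) \o fmap X a =
  fmap nerve a \o (fun x : X n => exist _ _ (adj_subproof w x) : nerve n).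
Proof. by apply: funext => x; apply: nerve_eq => k y /=; rewrite tensor_glue. Qed.

Definition adj (X : SSet) (w : cset_map (tensor_ob B X) C) : hom X nerve :=
  @NatTrans _ _ X nerve (fun n x => exist _ _ (adj_subproof w x)) (@adj_natural X w).

Lemma adj_inj (X : SSet) (w w' : cset_map (tensor_ob B X) C) : adj w = adj w' -> w = w'.
Proof.
move=> e; apply: cset_map_eq => k; apply: funext; apply: tensor_ind => n x y.
exact: (congr1 (fun v : hom X nerve => sval (v n x) k y) e).
Qed.

Lemma adj_surj (X : SSet) (v : hom X nerve) : exists w : cset_map (tensor_ob B X) C, adj w = v.
Proof.
have hP k m n (a : dhom m n) (x : X n) y :
    sval (v m (fmap X a x)) k y = sval (v n x) k (Bmap B a k y).
  by rewrite sset_hom_fmap.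
pose W k := sval (cid (@tensor_rec X k (C k) (fun n x y => sval (v n x) k y) (hP k))).
have WE k n (x : X n) y : W k (tensor x y) = sval (v n x) k y by rewrite /W; case: cid.
have Wn (k l : op Delta) (b : @hom (op Delta) k l) :
    W l \o fmap (tensor_ob B X) b = fmap C b \o W k.
  apply: funext; apply: tensor_ind => n x y /=.
  by rewrite [Z in W l Z](tensor_fmapE b x y) !WE; case: (svalP (v n x)) => ->.
have Wc k (q : tensor_ob B X k) : W k (cyc q) = cyc (W k q).
  move: q; apply: tensor_ind => n x y.
  rewrite -[cyc (tensor x y : tensor_ob B X k)]/(tensor_cyc (tensor x y)) tensor_cycE' !WE.
  by case: (svalP (v n x)) => _ ->.
exists (@CSetMap (tensor_ob B X) C (@NatTrans _ _ (tensor_ob B X) C W Wn) Wc).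
by apply: nattrans_eq => n; apply: funext => x; apply: nerve_eq => k y /=; rewrite WE.
Qed.

Lemma adj_comp (X Y : SSet) (f : hom X Y) (w : cset_map (tensor_ob B Y) C) :
  adj (cset_cmp w (tensor_hom B f)) = adj w \oc f.
Proof.
apply: nattrans_eq => n; apply: funext => x; apply: nerve_eq => k y /=.
by rewrite [tensor_map f _ _]tensor_funE.
Qed.

End TensorColimits.

Lemma tensor_preserves_colimits (B : functor Delta CSet) : preserves_colimits (tensor_functor B).
Proof.
move=> J F l k [kc kuniv]; split.
  by move=> i j e /=; rewrite -[LHS](fmapM (tensor_functor B)) kc.
move=> C c cc; have [|v [vE vuniq]] := kuniv (nerve B C) (fun j => adj (c j)).
  by move=> i j e; rewrite -adj_comp; congr adj; exact: cc.
have [w wE] := adj_surj v.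
exists w; split=> [j|w' w'E].
  by apply: adj_inj; rewrite [LHS]adj_comp wE.
apply: adj_inj; rewrite wE; apply: vuniq => j.
by rewrite -adj_comp; congr adj; exact: w'E.
Qed.
Local Open Scope classical_set_scope.
Local Open Scope ring_scope.

(** * Pushouts of cyclic sets *)

Local Close Scope ring_scope.
Local Close Scope classical_set_scope.
Section CsetPushout.
Variables (A A' B : cset) (f : cset_map A A') (g : cset_map A B).
Hypothesis finj : forall n, injective (f n).

(* The pushout is computed on normal forms: elements of [B], and elements of [A'] which are
   not in the image of [A]. *)
Definition po_normal (n : nat) (z : (B n + A' n)%type) : Prop :=
  if z is inr a' then ~ exists a, a' = f n a else True.
Definition po (n : nat) := {z : (B n + A' n)%type | po_normal z}.

Definition pol n (b : B n) : po n := exist (@po_normal n) (inl b) I.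
Definition por n (a' : A' n) : po n :=
  match pselect (exists a, a' = f n a) with
  | left h => pol (g n (sval (cid h)))
  | right h => exist (@po_normal n) (inr a') h
  end.

Lemma por_image n a : por (f n a) = pol (g n a).
Proof.
rewrite /por; case: pselect => [h|[]]; last by exists a.
by case: cid => a' /= /finj ->.
Qed.

Lemma po_ind n (P : po n -> Prop) : (forall b, P (pol b)) -> (forall a', P (por a')) -> forall p, P p.
Proof.
move=> Pl Pr [[b h|a' h]]; first by case: h; exact: Pl.
by have := Pr a'; rewrite /por; case: pselect => [//|h']; rewrite (Prop_irrelevance h h').
Qed.

Lemma pol_inj n : injective (@pol n).
Proof. by move=> b b' /(congr1 sval) []. Qed.

Lemma por_pol n a' (b : B n) : por a' = pol b -> exists2 a, a' = f n a & b = g n a.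
Proof.
rewrite /por; case: pselect => [h /pol_inj <-|h /(congr1 sval)//].
by exists (sval (cid h)) => //; case: cid.
Qed.

Lemma por_por n (a' a'' : A' n) : por a' = por a'' -> a' = a'' \/ exists a, a' = f n a.
Proof.
rewrite {1}/por; case: pselect => [|h]; first by right.
rewrite /por; case: pselect => [h' /(congr1 sval)//|h' /(congr1 sval) [->]]; by left.
Qed.

Section Rec.
Variables (n : nat) (E : Type) (hB : B n -> E) (hA : A' n -> E).
Definition po_rec (p : po n) : E := match sval p with inl b => hB b | inr a' => hA a' end.
Lemma po_recl b : po_rec (pol b) = hB b. Proof. by []. Qed.
Lemma po_recr : (forall a, hA (f n a) = hB (g n a)) -> forall a', po_rec (por a') = hA a'.
Proof.
move=> h a'; rewrite /por; case: pselect => [ex|//].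
by rewrite po_recl -h; case: cid => a /= <-.
Qed.
End Rec.

Definition po_fmap m n (a : dhom m n) : po n -> po m :=
  po_rec (fun b => pol (fmap B a b)) (fun a' => por (fmap A' a a')).
Definition po_cyc n : po n -> po n :=
  po_rec (fun b => pol (cyc b)) (fun a' => por (cyc a')).

Lemma po_fmapl m n (a : dhom m n) b : po_fmap a (pol b) = pol (fmap B a b).
Proof. by []. Qed.
Lemma po_fmapr m n (a : dhom m n) a' : po_fmap a (por a') = por (fmap A' a a').
Proof.
apply: po_recr => x; rewrite -(@sset_hom_fmap A A' f) -(@sset_hom_fmap A B g).
exact: por_image.
Qed.
Lemma po_cycl n (b : B n) : po_cyc (pol b) = pol (cyc b). Proof. by []. Qed.
Lemma po_cycr n (a' : A' n) : po_cyc (por a') = por (cyc a').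
Proof. by apply: po_recr => x; rewrite -!cmap_cyc por_image. Qed.

Definition po_sset : functor (op Delta) Sets.
Proof.
apply: (@Functor (op Delta) Sets po (fun n m (a : dhom m n) => po_fmap a)).
- move=> n; apply: funext; apply: po_ind => x; rewrite ?po_fmapl ?po_fmapr.
    by rewrite (@sset_fmap1 B).
  by rewrite (@sset_fmap1 A').
- move=> n m p b a; apply: funext; apply: po_ind => x.
    by rewrite /= !po_fmapl (@sset_fmapM B).
  by rewrite /= !po_fmapr (@sset_fmapM A').
Defined.

Lemma po_cyc_iterl n c (b : B n) : iter c (@po_cyc n) (pol b) = pol (iter c (@cyc B n) b).
Proof. by elim: c => //= c ->. Qed.
Lemma po_cyc_iterr n c (a' : A' n) : iter c (@po_cyc n) (por a') = por (iter c (@cyc A' n) a').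
Proof. by elim: c => //= c ->; rewrite po_cycr. Qed.

Definition po_cset : cset.
Proof.
apply: (@CSetPack po_sset po_cyc).
- by move=> n; apply: po_ind => x; rewrite (po_cyc_iterl, po_cyc_iterr) cyc_order.
- move=> n i; apply: po_ind => x; rewrite /face /=.
    by rewrite po_cycl !po_fmapl po_cycl; exact: (congr1 (@pol n) (face_cyc _ x)).
  by rewrite po_cycr !po_fmapr po_cycr; exact: (congr1 (@por n) (face_cyc _ x)).
- move=> n; apply: po_ind => x; rewrite /face /=.
    by rewrite po_cycl !po_fmapl; exact: (congr1 (@pol n) (face_cyc_max x)).
  by rewrite po_cycr !po_fmapr; exact: (congr1 (@por n) (face_cyc_max x)).
- move=> n i; apply: po_ind => x; rewrite /degen /=.
    by rewrite po_cycl !po_fmapl po_cycl; exact: (congr1 (@pol n.+1) (degen_cyc _ x)).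
  by rewrite po_cycr !po_fmapr po_cycr; exact: (congr1 (@por n.+1) (degen_cyc _ x)).
- move=> n; apply: po_ind => x; rewrite /degen /=.
    by rewrite po_cycl !po_fmapl !po_cycl; exact: (congr1 (@pol n.+1) (degen_cyc_max x)).
  by rewrite po_cycr !po_fmapr !po_cycr; exact: (congr1 (@por n.+1) (degen_cyc_max x)).
Defined.

Definition po_inl : cset_map B po_cset :=
  @CSetMap B po_cset (@NatTrans (op Delta) Sets B po_cset pol (fun n m a => erefl))
    (fun _ _ => erefl).

Lemma por_natural (n m : op Delta) (a : @hom (op Delta) n m) :
  (@por m : A' m -> po_cset m) \o fmap A' a = fmap po_cset a \o (@por n : A' n -> po_cset n).
Proof. by apply: funext => x; rewrite /= po_fmapr. Qed.

Definition po_inr : cset_map A' po_cset :=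
  @CSetMap A' po_cset (@NatTrans (op Delta) Sets A' po_cset por por_natural)
    (fun n x => esym (po_cycr x)).

Variables (Q : CSet) (i : @hom CSet A' Q) (j : @hom CSet B Q).
Hypothesis iQ : @is_pushout CSet A A' B Q f g i j.

(** Everything is visible in the model [po_cset]. The comparison [w] from [Q] to it reflects
    equalities, and uniqueness in the universal property makes [V] a left inverse of [w], which
    gives the covering clause. *)
Lemma cset_pushout_glued : [/\ forall n a, i n (f n a) = j n (g n a),
  forall n (q : Q n), (exists b, q = j n b) \/ (exists a', q = i n a'),
  forall n, injective (j n),
  forall n (a' a'' : A' n), i n a' = i n a'' -> a' = a'' \/ exists a, a' = f n a
  & forall n (a' : A' n) (b : B n), i n a' = j n b -> exists2 a, a' = f n a & b = g n a].
Proof.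
have [comm univ] := iQ.
have comm' n a : i n (f n a) = j n (g n a).
  exact: (congr1 (fun h : cset_map A Q => h n a) comm).
have [|w [[wi wj] _]] := univ po_cset po_inr po_inl.
  by apply: cset_map_eq => n; apply: funext => a; exact: por_image.
have wiE n a' : w n (i n a') = por a' := congr1 (fun h : cset_map A' po_cset => h n a') wi.
have wjE n b : w n (j n b) = pol b := congr1 (fun h : cset_map B po_cset => h n b) wj.
pose v n : po n -> Q n := po_rec (j n) (i n).
have vr n a' : v n (por a') = i n a' by apply: po_recr => a; exact: comm'.
have vn (n m : op Delta) (a : @hom (op Delta) n m) : v m \o fmap po_cset a = fmap Q a \o v n.
  apply: funext; apply: po_ind => x /=.
    by rewrite -[RHS](@sset_hom_fmap B Q j).
  by rewrite po_fmapr !vr -[RHS](@sset_hom_fmap A' Q i).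
have vc n (p : po_cset n) : v n (cyc p) = cyc (v n p).
  move: p; apply: po_ind => x; first by rewrite -[RHS](cmap_cyc j).
  by rewrite -[cyc (por x : po_cset n)]/(po_cyc (por x)) po_cycr !vr -[RHS](cmap_cyc i).
pose V : @hom CSet po_cset Q := CSetMap (cmap := @NatTrans _ _ po_cset Q v vn) vc.
have [u [_ uuniq]] := univ Q i j comm.
have vw : V \oc w = idm Q.
  have e1 : u = V \oc w.
    apply: uuniq; split; apply: cset_map_eq => n; apply: funext => x /=.
      by rewrite wiE vr.
    by rewrite wjE.
  have e2 : u = idm Q.
    by apply: uuniq; split; rewrite cmp1m.
  by rewrite -e1 e2.
have vwE n q : v n (w n q) = q := congr1 (fun h : cset_map Q Q => h n q) vw.
split => //.
- move=> n q; rewrite -(vwE n q); move: (w n q); apply: po_ind => x; [left|right]; exists x => //.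
- by move=> n b b' e; apply: pol_inj; rewrite -!wjE e.
- by move=> n a' a'' e; apply: por_por; rewrite -!wiE e.
- by move=> n a' b e; apply: por_pol; rewrite -wiE e wjE.
Qed.

(** A fixed element of [Q] coming from [B] comes from a fixed one as [j] is injective. If it does
    not come from [B], its preimage in [A'] is unique, hence fixed. *)
Lemma Phi_glued r : glued_square (fmap (Phi r) (f : @hom CSet A A'))
  (fmap (Phi r) (g : @hom CSet A B)) (fmap (Phi r) i) (fmap (Phi r) j).
Proof.
have [comm cover jinj isep cross] := cset_pushout_glued.
have fixf n c (a : A n) : iter c (@cyc A' n) (f n a) = f n a -> iter c (@cyc A n) a = a.
  by rewrite -cmap_iter => /finj.
split.
- by move=> n [a aP]; apply: eq_exist => /=; exact: comm.
- move=> n [q qP]; have [[b qb]|[a' qa]] := cover _ q.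
    left; have bP : @cyc_fixed r B n b.
      by apply: jinj; rewrite -[LHS]/(j _ (iter _ _ _)) [LHS](cmap_iter j) -qb; exact: qP.
    by exists (exist _ b bP); apply: eq_exist.
  have [[b qb]|nb] := pselect (exists b, q = j _ b).
    left; have bP : @cyc_fixed r B n b.
      by apply: jinj; rewrite -[LHS]/(j _ (iter _ _ _)) [LHS](cmap_iter j) -qb; exact: qP.
    by exists (exist _ b bP); apply: eq_exist.
  right; have aP : @cyc_fixed r A' n a'.
    have e : i _ a' = i _ (iter n.+1 (@cyc A' _) a') by rewrite [RHS](cmap_iter i) -qa; exact: esym qP.
    have [/esym //|[a aE]] := isep _ _ _ e.
    by case: nb; exists (g _ a); rewrite qa aE comm.
  by exists (exist _ a' aP); apply: eq_exist.
- by move=> n [b bP] [b' bP'] /(congr1 sval) /= /jinj e; apply: eq_exist.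
- move=> n [a' aP] [a'' aP'] /(congr1 sval) /= /isep[e|[a aE]]; first by left; apply: eq_exist.
  have aP0 : @cyc_fixed r A n a by apply: fixf; rewrite -aE.
  by right; exists (exist _ a aP0); apply: eq_exist.
- move=> n [a' aP] [b bP] /(congr1 sval) /= /cross[a aE bE].
  have aP0 : @cyc_fixed r A n a by apply: fixf; rewrite -aE.
  by exists (exist _ a aP0); apply: eq_exist.
Qed.

End CsetPushout.
Local Open Scope classical_set_scope.
Local Open Scope ring_scope.

(** * Simplices of nabla X *)

Section NablaNormalForm.
Variable R : realType.
Local Notation nab := (Bob (nabla_simplex R)).
Local Notation nmap a k := (Bmap (nabla_simplex R) a k).

(* A [k]-simplex of nabla_n is a map on S^1 x Delta^k invariant under rotation, that is, a
   map [ev y] from Delta^k to Delta^n. *)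
Definition ev n k (y : nab n k) (w : tsimplex R k) : tsimplex R n :=
  (y : circle_map (lam R k) (triv R (tsimplex R n))) (circle1 R, w).

Lemma evE n k (y : nab n k) (p : lam R k) :
  (y : circle_map (lam R k) (triv R (tsimplex R n))) p = ev y p.2.
Proof.
case: p => z w; rewrite /ev; have -> : (z, w) = cact z ((circle1 R, w) : lam R k).
  by rewrite /= /lam_act /= circle_mulr1.
exact: cfun_equivariant.
Qed.

Lemma ev_cont n k (y : nab n k) : continuous (ev y).
Proof.
apply: (@comp_continuous _ _ _ (fun w => (circle1 R, w) : lam R k) _ _ (cfun_continuous (c := y))).
by apply: pair_continuous; [exact: cst_continuous|exact: idfun_continuous].
Qed.

Lemma ev_inj n k (y y' : nab n k) : ev y =1 ev y' -> y = y'.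
Proof. by move=> e; apply: circle_map_eq => p; rewrite !evE e. Qed.

Definition of_fun_subproof n k (s : tsimplex R k -> tsimplex R n) (sc : continuous s) :
  continuous (fun p : lam R k => s p.2 : triv R (tsimplex R n)).
Proof. exact: comp_continuous (@snd_continuous _ _) sc. Qed.
Definition of_fun n k (s : tsimplex R k -> tsimplex R n) (sc : continuous s) : nab n k :=
  @CircleMap R (lam R k) (triv R (tsimplex R n)) _ (of_fun_subproof sc) (fun _ _ => erefl).
Lemma ev_of_fun n k s sc w : ev (@of_fun n k s sc) w = s w. Proof. by []. Qed.

Lemma ev_map m n (a : dhom m n) k (y : nab m k) w : ev (nmap a k y) w = tmap a (ev y w).
Proof. by []. Qed.
Lemma ev_fmap n k l (b : dhom l k) (y : nab n k) w : ev (fmap (nab n) b y) w = ev y (tmap b w).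
Proof. by []. Qed.
(** The rotation in the cocyclic operator is invisible to an invariant map; only the permutation of
    vertices remains. *)
Lemma ev_cyc n k (y : nab n k) w : ev (cyc y) w = ev y (tmap (@ordS k.+1) w).
Proof. exact: (evE y (lam_cyc R k (circle1 R, w))). Qed.
Lemma ev_cyc_iter n k c (y : nab n k) w :
  ev (iter c (@cyc (nab n) k) y) w = ev y (tmap (iter c (@ordS k.+1)) w).
Proof.
elim: c w => [|c IHc] w; first by rewrite /= tmap_id.
by rewrite iterS ev_cyc IHc tmap_comp; congr ev; apply: eq_tmap => i /=; rewrite -iterSr.
Qed.

Variable X : SSet.

(* The reduced representative of [x (x) y]: restrict to the smallest face containing the
   image of [y], then divide by the degeneracies of [x]. *)
Definition nf_data k n (x : X n) (y : nab n k) m (x' : X m) (y' : nab m k)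
    p (d : dhom p n) (s : dhom p m) (yp : nab p k) :=
  [/\ y = nmap d k yp /\ interior (ev yp), dsurj s, nondeg x',
      fmap X d x = fmap X s x' & y' = nmap s k yp].
Definition nf k n (x : X n) (y : nab n k) m (x' : X m) (y' : nab m k) :=
  exists p (d : dhom p n) (s : dhom p m) (yp : nab p k), nf_data x y x' y' d s yp.

Lemma nf_exists k n (x : X n) (y : nab n k) : exists m (x' : X m) (y' : nab m k) p
  (d : dhom p n) (s : dhom p m) (yp : nab p k), injective d /\ nf_data x y x' y' d s yp.
Proof.
(* [of_ball 0] merely witnesses that the simplex is inhabited. *)
have [p [d [e [di _ yE yi]]]] := support_face (of_ball (0 : 'rV[R]_k)) (ev y).
have [m [s [x' [ss xn xE]]]] := ez_exists (fmap X d x).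
have sc : continuous (fun w => tmap e (ev y w)).
  exact: comp_continuous (@ev_cont _ _ y) (@tmap_continuous R _ _ e).
pose yp : nab p k := of_fun sc.
exists m, x', (nmap s k yp), p, d, s, yp; split => //; split => //; split => //.
by apply: ev_inj => w; rewrite ev_map ev_of_fun yE.
Qed.

(** By [interior_unique] both reductions pass through one face [d]; the Eilenberg-Zilber
    decomposition of [x] restricted to [d] then determines both. *)
Lemma nf_unique k n (x : X n) (y : nab n k) m1 (x1 : X m1) (y1 : nab m1 k)
    m2 (x2 : X m2) (y2 : nab m2 k) : nf x y x1 y1 -> nf x y x2 y2 ->
  existT (fun m : nat => (X m * nab m k)%type) m1 (x1, y1) =
  existT (fun m : nat => (X m * nab m k)%type) m2 (x2, y2).
Proof.
move=> [p1 [d1 [s1 [z1 [[yE1 i1] ss1 n1 xE1 ->]]]]].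
move=> [p2 [d2 [s2 [z2 [[yE2 i2] ss2 n2 xE2 ->]]]]].
have [|p [d [e1 [e2 [dE1 dE2 es1 es2 eE]]]]] := interior_unique (d1 := d1) (d2 := d2) i1 i2.
  by move=> w; rewrite -!ev_map -yE1 -yE2.
have {}eE : nmap e1 k z1 = nmap e2 k z2 by apply: ev_inj => w; rewrite !ev_map eE.
have [m [s [x' [ss xn xE]]]] := ez_exists (fmap X d x).
have key q n' (d' : dhom q n) (e : dhom q p) (s' : dhom q n') (x'' : X n') :
    d' = dcomp d e -> dsurj e -> dsurj s' -> nondeg x'' -> fmap X d' x = fmap X s' x'' ->
    existT (fun n => (dhom q n * X n)%type) m (dcomp s e, x') =
    existT (fun n => (dhom q n * X n)%type) n' (s', x'').
  move=> dE es ss' xn'' xE''; apply: ez_unique => //; first exact: dsurj_comp.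
  by rewrite sset_fmapM -xE -sset_fmapM -dE.
have k1 := key _ _ _ _ _ _ dE1 es1 ss1 n1 xE1.
have k2 := key _ _ _ _ _ _ dE2 es2 ss2 n2 xE2.
have fin q n' (e : dhom q p) (s' : dhom q n') (x'' : X n') (z : nab q k) :
    existT (fun n => (dhom q n * X n)%type) m (dcomp s e, x') =
    existT (fun n => (dhom q n * X n)%type) n' (s', x'') ->
    existT (fun m : nat => (X m * nab m k)%type) n' (x'', nmap s' k z) =
    existT (fun m : nat => (X m * nab m k)%type) m (x', nmap s k (nmap e k z)).
  move=> E.
  have h : existT (fun m : nat => (X m * nab m k)%type) m (x', nmap (dcomp s e) k z) =
      existT (fun m : nat => (X m * nab m k)%type) n' (x'', nmap s' k z) := congr1 (fun t : {n : nat & (dhom q n * X n)%type} =>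
    existT (fun m : nat => (X m * nab m k)%type) (projT1 t) ((projT2 t).2, nmap (projT2 t).1 k z)) E.
  by rewrite -h Bmap_comp.
by rewrite (fin _ _ _ _ _ z1 k1) (fin _ _ _ _ _ z2 k2) eE.
Qed.

Lemma nf_glue k m n (a : dhom m n) (x : X n) (y : nab m k) l (x' : X l) (y' : nab l k) :
  nf (fmap X a x) y x' y' -> nf x (nmap a k y) x' y'.
Proof.
move=> [p [d [s [z [[-> i] ss xn xE ->]]]]]; exists p, (dcomp a d), s, z; split => //.
  by rewrite Bmap_comp.
by rewrite sset_fmapM.
Qed.

Lemma nf_tensor k n (x : X n) (y : nab n k) m (x' : X m) (y' : nab m k) :
  nf x y x' y' -> tensor x y = tensor x' y'.
Proof.
by move=> [p [d [s [z [[-> _] _ _ xE ->]]]]]; rewrite -!tensor_glue xE.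
Qed.

(** The set of normal forms is invariant under the generating relation: one inclusion is [nf_glue],
    the other follows from existence and uniqueness. *)
Lemma tensor_nf k n1 (x1 : X n1) (y1 : nab n1 k) n2 (x2 : X n2) (y2 : nab n2 k)
    m (x' : X m) (y' : nab m k) :
  tensor x1 y1 = tensor x2 y2 -> nf x1 y1 x' y' -> nf x2 y2 x' y'.
Proof.
pose F (q : tensor_pre (nabla_simplex R) X k) := fun t : {m : nat & (X m * nab m k)%type} =>
  nf (projT2 q).1 (projT2 q).2 (projT2 t).1 (projT2 t).2.
move=> e h; suff E : F (tensor_elt x1 y1) = F (tensor_elt x2 y2).
  by rewrite -[nf _ _ _ _]/(F (tensor_elt x2 y2) (existT _ m (x', y'))) -E.
apply: (qclass_compat _ e) => _ _ [q n a x y]; apply: funext => -[l [z w]].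
rewrite /F /=; apply/propext; split; first exact: nf_glue.
move=> h1; have [l' [z' [w' [p [d [s [yp [_ h2]]]]]]]] := nf_exists (fmap X a x) y.
have h2' : nf (fmap X a x) y z' w' by exists p, d, s, yp.
have E := nf_unique h1 (nf_glue h2').
have := h2'.
by rewrite -[nf _ _ _ _]/((fun t : {m : nat & (X m * nab m k)%type} =>
  nf (fmap X a x) y (projT2 t).1 (projT2 t).2) (existT _ l' (z', w'))) -E.
Qed.

Lemma nf_self k m (x : X m) (y : nab m k) : nondeg x -> interior (ev y) -> nf x y x y.
Proof.
move=> xn yi; exists m, (did m), (did m), y; split => //; last by rewrite Bmap_id.
  by rewrite Bmap_id.
exact: dsurj_id.
Qed.

Lemma nf_reduced k n (x : X n) (y : nab n k) m (x' : X m) (y' : nab m k) :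
  nf x y x' y' -> nondeg x' /\ interior (ev y').
Proof.
by move=> [p [d [s [z [[_ i] ss xn _ ->]]]]]; split => //; exact: interior_surj.
Qed.

(** The cyclic operator sends a reduced pair to a reduced pair with the same [x], so by uniqueness
    of normal forms an equality of classes becomes one of representatives. *)
Lemma tensor_fixed k c (z : tensor_level (nabla_simplex R) X k) :
  iter c (@tensor_cyc _ X k) z = z ->
  exists n (x : X n) (y : nab n k), z = tensor x y /\ iter c (@cyc (nab n) k) y = y.
Proof.
elim/tensor_ind: z => n x y; have [m [x' [y' [p [d [s [yp [_ h]]]]]]]] := nf_exists x y.
have {h} : nf x y x' y' by exists p, d, s, yp.
move=> /[dup] /nf_tensor -> /nf_reduced [xn yi]; rewrite tensor_cyc_iter => e.
exists m, x', y'; split => //.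
have ci : interior (ev (iter c (@cyc (nab m) k) y')).
  move=> j; have [w wj] := yi j.
  (* Interiority survives because the vertices are permuted: the inverse permutation is applied to
     the witness. *)
  pose v : tsimplex R k := tmap (iter c (@ord_pred k.+1)) w.
  exists v; rewrite ev_cyc_iter /v tmap_comp tmap_id // => i /=.
  by elim: c {e v} => //= c IHc; rewrite -iterS iterSr ord_predK.
have E := nf_unique (nf_self xn yi) (tensor_nf e (nf_self xn ci)).
by have [] := eq_from_Tagged E; move=> <-.
Qed.

(* A fixed class has representatives which are themselves fixed, any two of which are linked
   through fixed ones because reduction preserves fixedness. *)
Lemma tensor_fixed_rec k c (E : Type)
    (h : forall n, X n -> forall y : nab n k, iter c (@cyc (nab n) k) y = y -> E) :
  (forall m n (a : dhom m n) (x : X n) (y : nab m k) fy fy',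
    h m (fmap X a x) y fy = h n x (nmap a k y) fy') ->
  exists H : forall z : tensor_level (nabla_simplex R) X k, iter c (@tensor_cyc _ X k) z = z -> E,
    forall n (x : X n) (y : nab n k) fy fz, H (tensor x y) fz = h n x y fy.
Proof.
move=> hP.
have cmapi m n (a : dhom m n) (y : nab m k) :
    nmap a k (iter c (@cyc (nab m) k) y) = iter c (@cyc (nab n) k) (nmap a k y).
  exact: (cmap_iter (Bmap (nabla_simplex R) a)).
have reduce n (x : X n) (y : nab n k) (fy : iter c (@cyc (nab n) k) y = y) m (x' : X m) (y' : nab m k) :
    nf x y x' y' -> exists fy', h n x y fy = h m x' y' fy'.
  have [m' [x'' [y'' [p [d [s [yp [di hd]]]]]]]] := nf_exists x y => hnf.
  have hnf' : nf x y x'' y'' by exists p, d, s, yp.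
  have EE := nf_unique hnf' hnf.
  suff : exists fy', h n x y fy = h m' x'' y'' fy'.
    pose G := fun t : {m : nat & (X m * nab m k)%type} =>
      exists fy', h n x y fy = h (projT1 t) (projT2 t).1 (projT2 t).2 fy'.
    by rewrite -[exists fy', _]/(G (existT _ m' (x'', y''))) EE.
  move: hd => [[yE _] _ _ xE y''E].
  (* [tmap d] is injective, so the restriction [yp] of [y] to its supporting face is fixed as
     well. *)
  have fyp : iter c (@cyc (nab p) k) yp = yp.
    apply: ev_inj => w; apply: (tmap_inj di); rewrite -!ev_map cmapi -yE fy //.
  have fy'' : iter c (@cyc (nab m') k) y'' = y'' by rewrite y''E -cmapi fyp.
  exists fy''; move: fy fy''; rewrite yE y''E => fy fy''.
  by rewrite -(hP _ _ d x yp fyp) -(hP _ _ s x'' yp fyp) xE.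
have pick (z : tensor_level (nabla_simplex R) X k) : iter c (@tensor_cyc _ X k) z = z -> exists v : E,
    forall n (x : X n) (y : nab n k) fy, z = tensor x y -> v = h n x y fy.
  move=> /tensor_fixed[n [x [y [-> fy]]]]; exists (h n x y fy) => n' x' y' fy' e.
  have [m [x0 [y0 [p [d [s [yp [_ hd]]]]]]]] := nf_exists x y.
  have hnf : nf x y x0 y0 by exists p, d, s, yp.
  have [f1 ->] := reduce _ _ _ fy _ _ _ hnf.
  have [f2 ->] := reduce _ _ _ fy' _ _ _ (tensor_nf e hnf).
  by congr h; exact: Prop_irrelevance.
exists (fun z fz => sval (cid (pick z fz))) => n x y fy fz.
by case: cid => v /= /(_ _ _ _ fy erefl).
Qed.
End NablaNormalForm.

Lemma nf_mono (R : realType) (X Y : SSet) (f : hom X Y) k n (x : X n) (y : Bob (nabla_simplex R) n k)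
    m (x' : X m) (y' : Bob (nabla_simplex R) m k) :
  sset_cofibration f -> nf x y x' y' -> nf (f n x) y (f m x') y'.
Proof.
move=> fi [p [d [s [z [yE ss xn xE y'E]]]]]; exists p, d, s, z; split => //.
  by move=> l t w; exact: (nondeg_mono fi xn).
by rewrite -!sset_hom_fmap xE.
Qed.

(** A monomorphism carries normal forms to normal forms, so two classes with the same image have
    normal forms with the same image, and [f] is injective on these. *)
Lemma nabla_mono (R : realType) (X Y : SSet) (f : hom X Y) n :
  sset_cofibration f -> injective (fmap (nabla R) f n).
Proof.
move=> fi; apply: tensor_ind => n1 x1 y1; apply: tensor_ind => n2 x2 y2.
rewrite [LHS]tensor_funE [RHS]tensor_funE => e.
have [m1 [z1 [w1 [p1 [d1 [s1 [v1 [_ h1]]]]]]]] := nf_exists x1 y1.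
have [m2 [z2 [w2 [p2 [d2 [s2 [v2 [_ h2]]]]]]]] := nf_exists x2 y2.
have {}h1 : nf x1 y1 z1 w1 by exists p1, d1, s1, v1.
have {}h2 : nf x2 y2 z2 w2 by exists p2, d2, s2, v2.
have E := nf_unique (tensor_nf e (nf_mono fi h1)) (nf_mono fi h2).
rewrite (nf_tensor h1) (nf_tensor h2).
have m12 : m1 = m2 := existT_inj1 E.
move: z2 w2 h2 E; rewrite -m12 => z2 w2 h2 E'.
by have [/fi -> ->] := @eq_from_Tagged nat _ _ _ _ E'.
Qed.

(** * The join homotopy *)

Local Close Scope ring_scope.
Local Close Scope classical_set_scope.
Section JoinCombinatorics.
Variable r : nat.

Lemma dlift_div m n (f : dhom m n) i : dlift f i %/ n.+1 = i %/ m.+1.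
Proof. by have h := ltn_ord (f (inord (i %% m.+1))); rewrite /dlift addnC divnMDl // (divn_small h) addn0. Qed.
Lemma dlift_mod m n (f : dhom m n) i : dlift f i %% n.+1 = f (inord (i %% m.+1)).
Proof. by have h := ltn_ord (f (inord (i %% m.+1))); rewrite /dlift addnC modnMDl (modn_small h). Qed.

Arguments sd_deg : simpl never.

(** The map pr on vertices. For [r] > 0 it is not monotone, and it acts on topological simplices
    only. *)
Definition mod_ord k (i : 'I_(sd_deg r k).+1) : 'I_k.+1 := Ordinal (ltn_pmod i (ltn0Sn k)).
Lemma sd_degS k : (sd_deg r k).+1 = r.+1 * k.+1. Proof. by []. Qed.
Lemma first_subproof k : k.+1 <= (sd_deg r k).+1.
Proof. by rewrite sd_degS leq_pmull. Qed.
Definition first_ord k (i : 'I_k.+1) : 'I_(sd_deg r k).+1 := widen_ord (first_subproof k) i.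

Lemma sd_mapE m n (f : dhom m n) i : sd_map r f i = dlift f i :> nat.
Proof. by rewrite mk_dhomE. Qed.

Lemma sd_map_comp m n p (g : dhom n p) (f : dhom m n) :
  sd_map r (dcomp g f) = dcomp (sd_map r g) (sd_map r f).
Proof. exact: (fmapM (sd r) g f). Qed.

Lemma mod_sd m n (f : dhom m n) i : mod_ord (sd_map r f i) = f (mod_ord i).
Proof.
apply: val_inj; rewrite /= sd_mapE dlift_mod; congr (nat_of_ord (f _)).
by apply: val_inj; rewrite /= inordK // ltn_pmod.
Qed.

Lemma first_sd m n (f : dhom m n) i : sd_map r f (first_ord i) = first_ord (f i).
Proof. by apply: val_inj; rewrite /= sd_mapE /= dlift_small. Qed.

Lemma sd_inj m n (f : dhom m n) : injective f -> injective (sd_map r f).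
Proof.
move=> fi i j /(congr1 val); rewrite /= !sd_mapE => e; apply: val_inj => /=.
rewrite (divn_eq i m.+1) (divn_eq j m.+1) -!(dlift_div f) e; congr (_ + _).
have := congr1 (modn^~ n.+1) e; rewrite /= !dlift_mod => /val_inj/fi/(congr1 val) /=.
by rewrite !inordK // ltn_pmod.
Qed.

(* t_(r(k+1)-1)^(k+1) acts on vertices by the shift by k + 1. *)
Definition shift k : 'I_(sd_deg r k).+1 -> 'I_(sd_deg r k).+1 := iter k.+1 (@ordS (sd_deg r k).+1).
Arguments shift : clear implicits.
Arguments shift : simpl never.

Lemma shiftE k i : shift k i = (i + k.+1) %% (sd_deg r k).+1 :> nat.
Proof.
rewrite /shift; move: (k.+1) => c; elim: c => [|c IHc] /=; first by rewrite addn0 modn_small.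
by rewrite IHc -addn1 modnDml addn1 addnS.
Qed.

Lemma mod_shift k i : mod_ord (shift k i) = mod_ord i.
Proof.
apply: val_inj; rewrite -[LHS]/((shift k i) %% k.+1) shiftE modn_dvdm ?modnDr //.
by rewrite sd_degS dvdn_mull.
Qed.

Lemma sd_shift m n (f : dhom m n) i : sd_map r f (shift m i) = shift n (sd_map r f i).
Proof.
apply: val_inj; change (sd_map r f (shift m i) = shift n (sd_map r f i) :> nat).
rewrite sd_mapE !shiftE sd_mapE.
have e : dlift f (i + m.+1) = dlift f i + n.+1 by have := dliftD f i 1; rewrite !mul1n.
(* The shift wraps around in the source exactly when it does in the target. *)
have [h|h] := ltnP (i + m.+1) (sd_deg r m).+1.
  rewrite [in LHS]modn_small // e modn_small // -e.
  by have := dlift_lt f r.+1 (i + m.+1); rewrite -!sd_degS h.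
have h2 : i + m.+1 < 2 * (sd_deg r m).+1.
  by have := ltn_ord i; have := first_subproof m; lia.
have eD : dlift f (i + m.+1) = dlift f (i + m.+1 - (sd_deg r m).+1) + (sd_deg r n).+1.
  by have := dliftD f (i + m.+1 - (sd_deg r m).+1) r.+1; rewrite -!sd_degS subnK.
rewrite -e eD modnDr.
have -> : (i + m.+1) %% (sd_deg r m).+1 = i + m.+1 - (sd_deg r m).+1.
  by rewrite -[in LHS](subnK h) modnDr modn_small //; lia.
rewrite modn_small //.
have := dlift_lt f r.+1 (i + m.+1 - (sd_deg r m).+1); rewrite -!sd_degS => ->; lia.
Qed.

Section Join.
Variables k n : nat.
Definition joindim : nat := (k + n).+1.

Lemma inl_subproof1 (i : 'I_k.+1) : i < joindim.+1.
Proof. by have := ltn_ord i; rewrite /joindim; lia. Qed.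
Lemma inl_subproof (i j : 'I_k.+1) : i <= j -> Ordinal (inl_subproof1 i) <= Ordinal (inl_subproof1 j).
Proof. by []. Qed.
Definition join_inl : dhom k joindim := mk_dhom inl_subproof.

Lemma inr_subproof1 (i : 'I_n.+1) : k.+1 + i < joindim.+1.
Proof. by have := ltn_ord i; rewrite /joindim; lia. Qed.
Lemma inr_subproof (i j : 'I_n.+1) : i <= j -> Ordinal (inr_subproof1 i) <= Ordinal (inr_subproof1 j).
Proof. by rewrite /= leq_add2l. Qed.
Definition join_inr : dhom n joindim := mk_dhom inr_subproof.

Lemma join_inl_inj : injective join_inl.
Proof. by move=> i j; rewrite !mk_dhomE => /(congr1 val) /= /val_inj. Qed.
Lemma join_inr_inj : injective join_inr.
Proof. by move=> i j; rewrite !mk_dhomE => /(congr1 val) /= /addnI/val_inj. Qed.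
Lemma join_disj i j : join_inl i <> join_inr j.
Proof. by rewrite !mk_dhomE => /(congr1 val) /=; have := ltn_ord i; lia. Qed.

(** The subdivided join consists of [r.+1] blocks, each a copy of [k] followed by a copy of [n]. The
    vertices of the two kinds are separated by [e1] and [e2], which exhibits the large simplex as
    the join of the two subdivided ones. *)
Definition e1 : 'I_(sd_deg r k).+1 -> 'I_(sd_deg r joindim).+1 := sd_map r join_inl.
Definition e2 : 'I_(sd_deg r n).+1 -> 'I_(sd_deg r joindim).+1 := sd_map r join_inr.
Lemma e1_inj : injective e1. Proof. exact: sd_inj join_inl_inj. Qed.
Lemma e2_inj : injective e2. Proof. exact: sd_inj join_inr_inj. Qed.
Lemma e12_disj i j : e1 i <> e2 j.
Proof.
by move=> /(congr1 (@mod_ord _)); rewrite /e1 /e2 !mod_sd; exact: join_disj.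
Qed.

Definition e12 (s : 'I_(sd_deg r k).+1 + 'I_(sd_deg r n).+1) := match s with inl i => e1 i | inr j => e2 j end.
Lemma e12_bij : bijective e12.
Proof.
apply: inj_card_bij; last by rewrite card_sum !card_ord !sd_degS -mulnDr /joindim; lia.
case=> [i|i] [j|j] /= e.
- by rewrite (e1_inj e).
- by case: (e12_disj e).
- by case: (e12_disj (esym e)).
- by rewrite (e2_inj e).
Qed.
End Join.

Arguments e1 : clear implicits.
Arguments e2 : clear implicits.

Section JoinMap.
Variables (k' k n' n : nat) (th : dhom k' k) (a : dhom n' n).
Definition joinf (i : 'I_(joindim k' n').+1) : 'I_(joindim k n).+1 :=
  if i < k'.+1 then join_inl k n (th (inord i)) else join_inr k n (a (inord (i - k'.+1))).
Lemma joinf_mono (i j : 'I_(joindim k' n').+1) : i <= j -> joinf i <= joinf j.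
Proof.
move=> ij; rewrite /joinf; have jlt : j < (k' + n').+2 := ltn_ord j.
case: ltnP => ik; case: ltnP => jk.
- by apply/dhom_mono/dhom_mono; rewrite !inordK.
- rewrite !mk_dhomE /=; exact: leq_trans (ltnW (ltn_ord (th _))) (leq_addr _ _).
- by have := leq_ltn_trans (leq_trans ik ij) jk; rewrite ltnn.
- by apply/dhom_mono/dhom_mono; rewrite !inordK; lia.
Qed.
Definition join_map : dhom (joindim k' n') (joindim k n) := mk_dhom joinf_mono.

Lemma join_map_inl : dcomp join_map (join_inl k' n') = dcomp (join_inl k n) th.
Proof.
apply: dhomP => i; rewrite !dcompE mk_dhomE /joinf mk_dhomE /= ltn_ord.
by rewrite inord_val.
Qed.
Lemma join_map_inr : dcomp join_map (join_inr k' n') = dcomp (join_inr k n) a.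
Proof.
apply: dhomP => i; rewrite !dcompE mk_dhomE /joinf mk_dhomE /= ltnNge leq_addr /=.
by rewrite addKn inord_val.
Qed.
Lemma sd_join_e1 i : sd_map r join_map (e1 k' n' i) = e1 k n (sd_map r th i).
Proof.
have /(congr1 (fun f : dhom _ _ => f i)) := congr1 (@sd_map r _ _) join_map_inl.
by rewrite !sd_map_comp !dcompE.
Qed.
Lemma sd_join_e2 i : sd_map r join_map (e2 k' n' i) = e2 k n (sd_map r a i).
Proof.
have /(congr1 (fun f : dhom _ _ => f i)) := congr1 (@sd_map r _ _) join_map_inr.
by rewrite !sd_map_comp !dcompE.
Qed.
End JoinMap.

End JoinCombinatorics.
Arguments e1 : clear implicits.
Arguments e2 : clear implicits.
Arguments shift : clear implicits.
Local Open Scope classical_set_scope.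
Local Open Scope ring_scope.

Lemma continuous_at_near (T U : topologicalType) (f g : T -> U) (x : T) :
  (\forall y \near x, f y = g y) -> g @ x --> g x -> f @ x --> f x.
Proof.
move=> fg gc W; rewrite (nbhs_singleton fg) => /gc; rewrite /= !nbhs_simpl /= => gW.
by apply: filterS2 fg gW => y /= ->.
Qed.

(** * The affine join as a continuous map *)

Section JoinTop.
Variables (R : realType) (r : nat).
Local Notation N := (sd_deg r).

Section Fixed.
Variables k n : nat.
Local Notation K := (joindim k n).
Local Notation E1 := (e1 r k n).
Local Notation E2 := (e2 r k n).

Lemma sum12 (F : 'I_(N K).+1 -> R) : \sum_i F i = \sum_i F (E1 i) + \sum_i F (E2 i).
Proof.
rewrite (reindex (e12 (r := r) (k := k) (n := n))) /=; last exact/onW_bij/e12_bij.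
by rewrite big_sumType.
Qed.

Lemma sum12_cond (P : pred 'I_(N K).+1) (F : 'I_(N K).+1 -> R) :
  \sum_(i | P i) F i = \sum_(i | P (E1 i)) F (E1 i) + \sum_(i | P (E2 i)) F (E2 i).
Proof. by rewrite big_mkcond sum12 -!big_mkcond. Qed.

Implicit Type w : tsimplex R (N K).

Definition mass w : R := \sum_i val w 0 (E1 i).
(* The vertices of the join split into [E1] and [E2]; [part1 w] is the normalized projection
   of [w] to the first factor, and is arbitrary where [mass w = 0]. *)
Definition part1d (d : R) w : tsimplex R (N k) :=
  unbary (\row_j ((N k).+1%:R * (val w 0 (E1 (lift ord0 j)) / Num.max d (mass w)) - 1)).
Definition part1 := part1d 0.

Lemma mass_ge0 w : 0 <= mass w.
Proof. by apply: sumr_ge0 => i _; exact: tsimplex_ge0. Qed.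

Lemma mass_sum w : mass w + \sum_i val w 0 (E2 i) = 1.
Proof. by rewrite -[RHS](tsimplex_sum w) sum12. Qed.

Lemma part1E w i : mass w != 0 -> val (part1 w) 0 i = val w 0 (E1 i) / mass w.
Proof.
move=> m0; have mp : 0 < mass w by rewrite lt_neqAle eq_sym m0 mass_ge0.
have uP : std_simplex (\row_i (val w 0 (E1 i) / mass w) : 'rV[R]_(N k).+1).
  split=> [j|]; first by rewrite mxE divr_ge0 ?tsimplex_ge0 // ltW.
  rewrite (eq_bigr (fun i => val w 0 (E1 i) / mass w)) => [|j _]; last by rewrite mxE.
  by rewrite -mulr_suml divff.
pose u : tsimplex R (N k) := set_elt uP.
rewrite (_ : part1 w = u); first by rewrite /= mxE.
rewrite -[RHS]baryK /part1 /part1d max_r ?mass_ge0 //; congr unbary.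
by apply/rowP => j; rewrite !mxE /= ?mxE.
Qed.

Lemma mass_cont : continuous mass.
Proof. by apply: sum_continuous => i; exact: simplex_coord_continuous. Qed.

Lemma part1d_cont d : 0 < d -> continuous (part1d d).
Proof.
move=> d0; apply: (comp_continuous _ (@unbary_cont R (N k))); apply: row_continuous => j.
rewrite (_ : (fun _ => _) = fun w => (N k).+1%:R * (val w 0 (E1 (lift ord0 j)) / Num.max d (mass w)) - 1).
  apply: contB; last exact: cont_cst.
  apply: contM; first exact: cont_cst.
  apply: contM; first exact: simplex_coord_continuous.
  apply: contV; first by apply: cont_max; [exact: cont_cst|exact: mass_cont].
  by move=> w; rewrite gt_eqF // lt_max d0.
by apply: funext => w; rewrite mxE.
Qed.

Variable s : tsimplex R (N k) -> tsimplex R n.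

(* The affine join of [s] with the projection [Delta^(r(n+1)-1) -> Delta^n] induced by
   reduction of the vertices modulo [n + 1]. *)
Definition join_val w : 'rV[R]_n.+1 :=
  \row_l (mass w * val (s (part1 w)) 0 l + \sum_(i | mod_ord i == l) val w 0 (E2 i)).

Lemma join_simplex w : std_simplex (join_val w).
Proof.
split=> [l|].
  rewrite mxE addr_ge0 //; first by rewrite mulr_ge0 ?mass_ge0 ?tsimplex_ge0.
  by apply: sumr_ge0 => i _; exact: tsimplex_ge0.
rewrite (eq_bigr (fun l => mass w * val (s (part1 w)) 0 l +
  \sum_(i | mod_ord i == l) val w 0 (E2 i))) => [|l _]; last by rewrite mxE.
rewrite big_split /= -mulr_sumr tsimplex_sum mulr1 -[RHS](mass_sum w); congr (_ + _).
by rewrite [RHS](partition_big (@mod_ord r n) xpredT).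
Qed.
Definition join_fun w : tsimplex R n := set_elt (join_simplex w).

Lemma join_funE w l : val (join_fun w) 0 l =
  mass w * val (s (part1 w)) 0 l + \sum_(i | mod_ord i == l) val w 0 (E2 i).
Proof. by rewrite /= mxE. Qed.

Lemma tsimplex_le1 m (u : tsimplex R m) j : val u 0 j <= 1.
Proof.
rewrite -(tsimplex_sum u) (bigD1 j) //= lerDl; apply: sumr_ge0 => i _; exact: tsimplex_ge0.
Qed.

Lemma join_fun_cont : continuous s -> continuous join_fun.
Proof.
move=> sc; apply: set_type_continuous; apply: row_continuous => l.
rewrite (_ : (fun _ => _) = fun w => mass w * val (s (part1 w)) 0 l +
  \sum_(i | mod_ord i == l) val w 0 (E2 i)); last by apply: funext => w; rewrite mxE.
apply: contD; last by apply: sum_continuous => i; exact: simplex_coord_continuous.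
(* Where the mass vanishes [part1] is meaningless, but the coordinates of [s] lie in [0, 1], so the
   product is squeezed by the mass. *)
move=> w; have [m0|m0] := eqVneq (mass w) 0.
  have nF := @nbhs_filter _ w.
  have sq : mass x * val (s (part1 x)) 0 l @[x --> w] --> (0 : R).
    apply: (squeeze_cvgr (f := fun=> 0) (h := mass)).
    - apply: nearW => x; rewrite mulr_ge0 ?mass_ge0 ?tsimplex_ge0 //=.
      by rewrite ler_piMr ?mass_ge0 // tsimplex_le1.
    - exact: cvg_cst.
    - by rewrite -m0; exact: mass_cont.
  by rewrite /continuous_at m0 mul0r; exact: sq.
have mp : 0 < mass w by rewrite lt_neqAle eq_sym m0 mass_ge0.
(* Near [w] the mass exceeds half its value at [w], and there [part1] agrees with [part1d d], whose
   denominator is bounded below. *)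
pose d := mass w / 2; have d0 : 0 < d by rewrite divr_gt0.
apply: (@continuous_at_near _ _ _ (fun x => mass x * val (s (part1d d x)) 0 l)).
  have : \forall x \near w, d < mass x.
    apply: (cvgr_gt (mass w) (@mass_cont w)).
    by rewrite /d ltr_pdivrMr // ltr_pMr // ltr1n.
  apply: filterS => x dx; congr (_ * val (s _) 0 l).
  by rewrite /part1 /part1d !max_r ?(ltW dx) // mass_ge0.
have h : continuous (fun x => mass x * val (s (part1d d x)) 0 l).
  apply: contM; first exact: mass_cont.
  exact: comp_continuous (comp_continuous (part1d_cont d0) sc) (@simplex_coord_continuous R n l).
exact: h.
Qed.

Lemma tmap_inj_coord m m' (f : 'I_m.+1 -> 'I_m'.+1) (v : tsimplex R m) i :
  injective f -> val (tmap f v) 0 (f i) = val v 0 i.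
Proof. by move=> fi; apply: tmap_last => j; rewrite (inj_eq fi). Qed.

Lemma join_fun_inl v : join_fun (tmap E1 v) = s v.
Proof.
have c1 i : val (tmap E1 v) 0 (E1 i) = val v 0 i by exact/tmap_inj_coord/e1_inj.
have m1 : mass (tmap E1 v) = 1.
  by rewrite -[RHS](tsimplex_sum v); apply: eq_bigr => i _; exact: c1.
have pE : part1 (tmap E1 v) = v.
  by apply: tsimplex_eq => i; rewrite part1E m1 ?oner_eq0 // divr1 c1.
apply: tsimplex_eq => l; rewrite join_funE m1 pE mul1r big1 ?addr0 // => i _.
rewrite tmapE big1 // => j /eqP e; by case: (e12_disj e).
Qed.

Lemma join_fun_inr v : join_fun (tmap E2 v) = tmap (@mod_ord r n) v.
Proof.
have c2 i : val (tmap E2 v) 0 (E2 i) = val v 0 i by exact/tmap_inj_coord/e2_inj.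
have m1 : mass (tmap E2 v) = 0.
  by apply: big1 => i _; rewrite tmapE big1 // => j /eqP e; case: (e12_disj (esym e)).
apply: tsimplex_eq => l; rewrite join_funE m1 mul0r add0r tmapE.
by apply: eq_bigr => i _; exact: c2.
Qed.
End Fixed.

(** The vertex maps are arbitrary so that one statement covers both uses: simplicial operators, and
    the non-monotone cyclic shift. *)
Lemma join_fun_natural k n k' n' (g : 'I_(N (joindim k' n')).+1 -> 'I_(N (joindim k n)).+1)
    (g1 : 'I_(N k').+1 -> 'I_(N k).+1) (g2 : 'I_(N n').+1 -> 'I_(N n).+1) (f : 'I_n'.+1 -> 'I_n.+1)
    (s : tsimplex R (N k) -> tsimplex R n) (s' : tsimplex R (N k') -> tsimplex R n') w :
  (forall i, g (e1 r k' n' i) = e1 r k n (g1 i)) ->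
  (forall i, g (e2 r k' n' i) = e2 r k n (g2 i)) ->
  (forall v, s (tmap g1 v) = tmap f (s' v)) -> (forall i, mod_ord (g2 i) = f (mod_ord i)) ->
  join_fun s (tmap g w) = tmap f (join_fun s' w).
Proof.
move=> gE1 gE2 sE fE.
have c1 i : val (tmap g w) 0 (e1 r k n i) = \sum_(i' | g1 i' == i) val w 0 (e1 r k' n' i').
  rewrite tmapE sum12_cond [X in _ + X]big1 ?addr0 => [|j /eqP]; last first.
    by rewrite gE2 => e; case: (e12_disj (esym e)).
  by apply: eq_bigl => j; rewrite gE1 (inj_eq (@e1_inj _ _ _)).
have c2 i : val (tmap g w) 0 (e2 r k n i) = \sum_(i' | g2 i' == i) val w 0 (e2 r k' n' i').
  rewrite tmapE sum12_cond [X in X + _]big1 ?add0r => [|j /eqP]; last first.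
    by rewrite gE1 => e; case: (e12_disj e).
  by apply: eq_bigl => j; rewrite gE2 (inj_eq (@e2_inj _ _ _)).
have mE : mass (tmap g w) = mass w.
  rewrite /mass [RHS](partition_big g1 xpredT) //=; apply: eq_bigr => i _; exact: c1.
have pE : mass w != 0 -> part1 (tmap g w) = tmap g1 (part1 w).
  move=> m0; apply: tsimplex_eq => i; rewrite part1E ?mE // c1 tmapE mulr_suml.
  by apply: eq_bigr => j _; rewrite part1E.
apply: tsimplex_eq => l; rewrite join_funE tmapE mE.
rewrite [RHS](eq_bigr (fun l' => mass w * val (s' (part1 w)) 0 l' +
  \sum_(i | mod_ord i == l') val w 0 (e2 r k' n' i))) => [|l' _]; last by rewrite join_funE.
rewrite big_split /=; congr (_ + _).
  have [m0|m0] := eqVneq (mass w) 0.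
    by rewrite m0 mul0r big1 // => i _; rewrite mul0r.
  by rewrite pE // sE tmapE mulr_sumr.
rewrite (eq_bigr (fun i => \sum_(i' | g2 i' == i) val w 0 (e2 r k' n' i'))) => [|i _]; last exact: c2.
transitivity (\sum_(i' | mod_ord (g2 i') == l) val w 0 (e2 r k' n' i')).
  rewrite [RHS](partition_big g2 (fun i => mod_ord i == l)) //=.
  by apply: eq_bigr => i il; apply: eq_bigl => j; case: eqP => [->|]; rewrite ?il ?andbF.
rewrite (partition_big (@mod_ord r n') (fun l' => f l' == l)) => [|i]; last by rewrite fE.
apply: eq_bigr => l' l'l; apply: eq_bigl => j; rewrite fE.
by case: (mod_ord j =P l') => [->|]; rewrite ?l'l ?andbF.
Qed.
End JoinTop.

Section Convex.
Variable R : realType.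
Local Notation I := (unit_interval R).

Lemma conv_subproof n (t : I) (u v : tsimplex R n) :
  std_simplex ((1 - val t) *: val u + val t *: val v : 'rV[R]_n.+1).
Proof.
have /andP[t0 t1] := ui_range t; split=> [j|].
  by rewrite !mxE addr_ge0 ?mulr_ge0 ?tsimplex_ge0 // subr_ge0.
rewrite (eq_bigr (fun j => (1 - val t) * val u 0 j + val t * val v 0 j)) => [|j _]; last by rewrite !mxE.
by rewrite big_split /= -!mulr_sumr !tsimplex_sum !mulr1 subrK.
Qed.
Definition conv n (t : I) (u v : tsimplex R n) : tsimplex R n := set_elt (conv_subproof t u v).

Lemma convE n t (u v : tsimplex R n) j :
  val (conv t u v) 0 j = (1 - val t) * val u 0 j + val t * val v 0 j.
Proof. by rewrite /= !mxE. Qed.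

Lemma tmap_conv m n (f : 'I_m.+1 -> 'I_n.+1) t (u v : tsimplex R m) :
  tmap f (conv t u v) = conv t (tmap f u) (tmap f v).
Proof.
apply: tsimplex_eq => j; rewrite convE !tmapE !mulr_sumr -big_split /=.
by apply: eq_bigr => i _; exact: convE.
Qed.

Lemma conv0 n (u v : tsimplex R n) : conv (ui 0) u v = u.
Proof. by apply: tsimplex_eq => j; rewrite convE val_ui0 subr0 mul1r mul0r addr0. Qed.
Lemma conv1 n (u v : tsimplex R n) : conv (ui 1) u v = v.
Proof. by apply: tsimplex_eq => j; rewrite convE val_ui1 subrr mul1r mul0r add0r. Qed.

Lemma conv_cont (T : topologicalType) n (t : T -> I) (u v : T -> tsimplex R n) :
  continuous t -> continuous u -> continuous v -> continuous (fun x => conv (t x) (u x) (v x)).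
Proof.
move=> tc uc vc; have tc' : continuous (fun x => val (t x) : R).
  exact: comp_continuous tc (@val_continuous _ _).
apply: set_type_continuous; apply: row_continuous => j.
rewrite (_ : (fun _ => _) = fun x => (1 - val (t x)) * val (u x) 0 j + val (t x) * val (v x) 0 j).
  have sc := @simplex_coord_continuous R n j.
  apply: contD; apply: contM => //; first by apply: contB => //; exact: cont_cst.
    exact: comp_continuous uc sc.
  exact: comp_continuous vc sc.
by apply: funext => x; rewrite -convE.
Qed.
End Convex.

(** The homotopies deform a pair for [j] to its image under [rho] followed by [io], and a
    compression for [i] of the middle pair is mapped forward by [io] and [io']. *)
Lemma compress_transfer (R : realType) (X X' Y Y' : topologicalType) (i : X -> X') (j : Y -> Y')
    (io : X -> Y) (io' : X' -> Y') (rho : Y -> X) (rho' : Y' -> X')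
    (H : Y * unit_interval R -> Y) (H' : Y' * unit_interval R -> Y') :
  continuous io -> continuous io' -> continuous rho -> continuous rho' -> continuous H -> continuous H' ->
  (forall p, H (p, ui 0) = p) -> (forall p, H (p, ui 1) = io (rho p)) ->
  (forall p, H' (p, ui 0) = p) -> (forall p, H' (p, ui 1) = io' (rho' p)) ->
  (forall p, j (io p) = io' (i p)) -> (forall p, rho' (j p) = i (rho p)) ->
  (forall p t, H' (j p, t) = j (H (p, t))) -> compress R i -> compress R j.
Proof.
move=> ioc ioc' rc rc' Hc Hc' H0 H1 H0' H1' jio rhoj Hj comp m g h [gc hc gh].
have [|G0 [F0 [Gc Fc G00 F00 FG]]] := comp m (fun v => rho' (g v)) (fun v => rho (h v)).
  split; [exact: continuous_comp_within|exact: continuous_comp_within|].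
  by move=> v v1; rewrite -rhoj gh.
apply: (@compressible_homotopy _ _ _ _ _ _ (fun v => io' (rho' (g v))) _ (fun v => io (rho (h v)))); last first.
  exists (fun p => io' (G0 p)), (fun p => io (F0 p)).
  split; [exact: continuous_comp_within|exact: continuous_comp_within| | |].
  - by move=> v v1; rewrite G00.
  - by move=> v v1; rewrite F00.
  - by move=> p tp; rewrite jio FG.
exists (fun p => H' (g p.1, ui p.2)), (fun p => H (h p.1, ui p.2)).
have tc : continuous (fun p : 'rV[R]_m * R => ui p.2 : unit_interval R).
  exact: comp_continuous (@snd_cont R m) (@ui_continuous R).
split.
- apply: (continuous_comp_within Hc'); apply: within_pair; last exact: continuous_within.
  by apply: (within_comp gc); [exact/continuous_within/fst_cont | move=> ? []].
- apply: (continuous_comp_within Hc); apply: within_pair; last exact: continuous_within.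
  by apply: (within_comp hc); [exact/continuous_within/fst_cont | move=> ? []].
- by move=> v v1; rewrite H0' H1'.
- by move=> v v1; rewrite H0 H1.
- by move=> [v t] [/= v1 _]; rewrite -Hj gh.
Qed.

(** * Comparison of the fixed points of nabla A with A *)

Section FixedPoints.
Variables (R : realType) (r : nat).
Local Notation I := (unit_interval R).
Local Notation N := (sd_deg r).
Local Notation nab := (Bob (nabla_simplex R)).
Local Notation nmap a k := (Bmap (nabla_simplex R) a k).
Local Notation G A := (Phi_ob r (tensor_ob (nabla_simplex R) A)).

Definition nfix n k (y : nab n (N k)) := iter k.+1 (@cyc (nab n) (N k)) y = y.

Lemma nfixP n k (y : nab n (N k)) :
  nfix y <-> forall w, ev y (tmap (shift r k) w) = ev y w.
Proof.
split=> [fy w|h]; first by rewrite -[in RHS]fy ev_cyc_iter.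
by apply: ev_inj => w; rewrite ev_cyc_iter; exact: h.
Qed.

Lemma mod_nfix n : nfix (of_fun (@tmap_continuous R _ _ (@mod_ord r n))).
Proof.
apply/nfixP => w; rewrite !ev_of_fun tmap_comp; apply: eq_tmap => i /=; exact: mod_shift.
Qed.

Definition join_elt n k (y : nab n (N k)) : nab n (N (joindim k n)) :=
  of_fun (join_fun_cont (ev_cont (y := y))).

Lemma join_nfix n k (y : nab n (N k)) : nfix y -> nfix (join_elt y).
Proof.
move=> /nfixP fy; apply/nfixP => w; rewrite !ev_of_fun.
rewrite (@join_fun_natural R r k n k n (shift r _) (shift r k) (shift r n) id (ev y) (ev y) w).
- exact: tmap_id.
- by move=> i; rewrite /e1 sd_shift.
- by move=> i; rewrite /e2 sd_shift.
- by move=> v; rewrite fy tmap_id.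
- exact: mod_shift.
Qed.

Section Elements.
Variable A : SSet.

Lemma mkG_subproof n k (x : A n) (y : nab n (N k)) : nfix y ->
  @cyc_fixed r (tensor_ob (nabla_simplex R) A) k (tensor x y).
Proof.
by move=> fy; rewrite /cyc_fixed -[LHS]/(iter k.+1 (@tensor_cyc _ A (N k)) (tensor x y)) tensor_cyc_iter fy.
Qed.
Definition mkG n k (x : A n) (y : nab n (N k)) (fy : nfix y) : G A k :=
  exist _ (tensor x y) (mkG_subproof x fy).

Lemma mkG_eq n k (x : A n) (y : nab n (N k)) (fy : nfix y) n' (x' : A n') (y' : nab n' (N k)) (fy' : nfix y') :
  tensor x y = tensor x' y' -> mkG x fy = mkG x' fy'.
Proof. by move=> e; apply: eq_exist. Qed.

Lemma mkG_ind k (P : G A k -> Prop) :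
  (forall n (x : A n) (y : nab n (N k)) (fy : nfix y), P (mkG x fy)) -> forall z, P z.
Proof.
move=> h [z zP]; have [n [x [y [zE fy]]]] := tensor_fixed (zP : iter k.+1 (@tensor_cyc _ A (N k)) z = z).
suff -> : exist _ z zP = mkG x fy by exact: h.
exact: eq_exist.
Qed.

Lemma mkG_glue k m n (a : dhom m n) (x : A n) (y : nab m (N k)) (fy : nfix y) (fy' : nfix (nmap a _ y)) :
  mkG (fmap A a x) fy = mkG x fy'.
Proof. by apply: mkG_eq; exact: tensor_glue. Qed.

Lemma nfix_map k m n (a : dhom m n) (y : nab m (N k)) : nfix y -> nfix (nmap a _ y).
Proof. by move=> /nfixP fy; apply/nfixP => w; rewrite !ev_map fy. Qed.

Lemma nfix_fmap n k l (b : dhom l k) (y : nab n (N k)) : nfix y -> nfix (fmap (nab n) (sd_map r b) y).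
Proof.
move=> /nfixP fy; apply/nfixP => w; rewrite !ev_fmap -[RHS]fy !tmap_comp; congr ev.
by apply: eq_tmap => i /=; rewrite sd_shift.
Qed.

Lemma mkG_fmap n k l (b : dhom l k) (x : A n) (y : nab n (N k)) (fy : nfix y) :
  fmap (G A) b (mkG x fy) = mkG x (nfix_fmap b fy).
Proof. by apply: eq_exist; exact: (tensor_fmapE (sd_map r b) x y). Qed.

Lemma mkG_rec k (E : Type) (h : forall n, A n -> forall y : nab n (N k), nfix y -> E) :
  (forall m n (a : dhom m n) (x : A n) (y : nab m (N k)) fy fy',
    h m (fmap A a x) y fy = h n x (nmap a _ y) fy') ->
  exists H : G A k -> E, forall n (x : A n) (y : nab n (N k)) (fy : nfix y), H (mkG x fy) = h n x y fy.
Proof.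
move=> hP; have [H HE] := tensor_fixed_rec hP.
by exists (fun z => H (sval z) (svalP z)) => n x y fy; exact: HE.
Qed.

Lemma iota_natural (n m : op Delta) (a : @hom (op Delta) n m) :
  (fun x : A m => mkG x (mod_nfix m)) \o fmap A a = fmap (G A) a \o (fun x : A n => mkG x (mod_nfix n)).
Proof.
apply: funext => x; apply: etrans _ (esym (mkG_fmap a x (mod_nfix n))).
transitivity (mkG x (nfix_map a (mod_nfix m))); first exact: mkG_glue.
apply: mkG_eq; congr tensor; apply: ev_inj => w.
rewrite ev_map ev_fmap !ev_of_fun !tmap_comp; apply: eq_tmap => i /=.
by rewrite mod_sd.
Qed.
Definition iota : hom A (G A) := @NatTrans (op Delta) Sets A (G A) _ iota_natural.

(** The choice of block does not matter on invariant maps: [shift] permutes the blocks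
    transitively. *)
Definition tfirst k (u : tsimplex R k) : tsimplex R (N k) := tmap (@first_ord r k) u.
Lemma tfirst_cont k : continuous (@tfirst k). Proof. exact: tmap_continuous. Qed.
Lemma tfirst_sd k l (b : dhom l k) u : tfirst (tmap b u) = tmap (sd_map r b) (tfirst u).
Proof. by rewrite /tfirst !tmap_comp; apply: eq_tmap => i /=; rewrite first_sd. Qed.

Lemma rho_exists : exists rho : realization R (G A) -> realization R A,
  continuous rho /\ forall n k (x : A n) (y : nab n (N k)) (fy : nfix y) u,
    rho (rpt (mkG x fy) u) = rpt x (ev y (tfirst u)).
Proof.
have recP k : exists h : G A k -> tsimplex R k -> realization R A,
    forall n (x : A n) (y : nab n (N k)) (fy : nfix y), h (mkG x fy) = fun u => rpt x (ev y (tfirst u)).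
  apply: (mkG_rec (h := fun n x y _ u => rpt x (ev y (tfirst u)))) => m n a x y _ _.
  by apply: funext => u; rewrite rpt_glue ev_map.
pose h k := sval (cid (recP k)).
have hE k n (x : A n) (y : nab n (N k)) (fy : nfix y) u : h k (mkG x fy) u = rpt x (ev y (tfirst u)).
  by rewrite /h; case: cid => h' /= ->.
have [||rho [rc rE]] := @realization_rec R (G A) (realization R A) h.
- move=> k z; elim/mkG_ind: z => n x y fy.
  rewrite (_ : h k _ = fun u => rpt x (ev y (tfirst u))); last by apply: funext => u; rewrite hE.
  have c := comp_continuous (@tfirst_cont k) (@ev_cont R _ _ y).
  exact: (@comp_continuous _ _ _ _ (fun u => rpt x u) c (@rpt_continuous R A n x)).
- move=> k l b z u; elim/mkG_ind: z => n x y fy.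
  by rewrite mkG_fmap !hE ev_fmap tfirst_sd.
by exists rho; split=> // n k x y fy u; rewrite rE hE.
Qed.

(* The straight line, inside the realization of the simplex [x (x) (y * pr)], from the face
   [x (x) y] to the face [x (x) pr = iota x]. *)
Definition join_path n k (x : A n) (y : nab n (N k)) (fy : nfix y) (p : tsimplex R k * I) :
    realization R (G A) :=
  rpt (mkG x (join_nfix fy))
    (conv p.2 (tmap (join_inl k n) p.1) (tmap (join_inr k n) (ev y (tfirst p.1)))).

Lemma join_elt_natural k' k n' n (th : dhom k' k) (a : dhom n' n) (y : nab n (N k)) (y' : nab n' (N k')) :
  (forall v, ev y (tmap (sd_map r th) v) = tmap a (ev y' v)) ->
  fmap (nab n) (sd_map r (join_map th a)) (join_elt y) = nmap a _ (join_elt y').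
Proof.
move=> h; apply: ev_inj => w; rewrite ev_fmap ev_map !ev_of_fun.
apply: (join_fun_natural (g1 := sd_map r th) (g2 := sd_map r a)) => //.
- exact: sd_join_e1.
- exact: sd_join_e2.
- exact: mod_sd.
Qed.

(** With [th] the identity this is independence of the representative x (x) y; with [a] the identity
    it is compatibility with the gluing of the realization. *)
Lemma join_path_natural k' k n' n (th : dhom k' k) (a : dhom n' n) (x : A n)
    (y : nab n (N k)) (fy : nfix y) (y' : nab n' (N k')) (fy' : nfix y') u t :
  (forall v, ev y (tmap (sd_map r th) v) = tmap a (ev y' v)) ->
  join_path (fmap A a x) fy' (u, t) = join_path x fy (tmap th u, t).
Proof.
move=> h.
have E : mkG (fmap A a x) (join_nfix fy') = fmap (G A) (join_map th a) (mkG x (join_nfix fy)).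
  transitivity (mkG x (nfix_map a (join_nfix fy'))); first exact: mkG_glue.
  symmetry; apply: etrans (mkG_fmap (join_map th a) x (join_nfix fy)) _.
  by apply: mkG_eq; rewrite (join_elt_natural h).
have P : tmap (join_map th a) (conv t (tmap (join_inl k' n') u) (tmap (join_inr k' n') (ev y' (tfirst u)))) =
    conv t (tmap (join_inl k n) (tmap th u)) (tmap (join_inr k n) (ev y (tfirst (tmap th u)))).
  by rewrite tmap_conv -!tmap_dcomp join_map_inl join_map_inr !tmap_dcomp tfirst_sd h.
exact: etrans (congr1 (fun z => rpt z _) E) (etrans (rpt_glue (join_map th a) _ _) (congr1 _ P)).
Qed.

Lemma join_path_cont n k (x : A n) (y : nab n (N k)) (fy : nfix y) : continuous (join_path x fy).
Proof.
have c : continuous (fun p : tsimplex R k * I =>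
    conv p.2 (tmap (join_inl k n) p.1) (tmap (join_inr k n) (ev y (tfirst p.1)))).
  apply: conv_cont; first exact: snd_continuous.
    exact: comp_continuous (@fst_continuous _ _) (@tmap_continuous R _ _ _).
  have c1 : continuous (fun p : tsimplex R k * I => ev y (tfirst p.1)).
    have c2 := comp_continuous (@tfirst_cont k) (@ev_cont R _ _ y).
    exact: (comp_continuous (@fst_continuous (tsimplex R k) I) c2).
  exact: (@comp_continuous _ _ _ _ (tmap (join_inr k n)) c1 (@tmap_continuous R _ _ _)).
exact: (@comp_continuous _ _ _ _ (fun u => rpt (mkG x (join_nfix fy)) u) c
  (@rpt_continuous R (G A) _ (mkG x (join_nfix fy)))).
Qed.

Lemma join_path0 n k (x : A n) (y : nab n (N k)) (fy : nfix y) u :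
  join_path x fy (u, ui 0) = rpt (mkG x fy) u.
Proof.
have E : fmap (G A) (join_inl k n) (mkG x (join_nfix fy)) = mkG x fy.
  apply: etrans (mkG_fmap (join_inl k n) x (join_nfix fy)) _; apply: mkG_eq; congr tensor.
  by apply: ev_inj => w; rewrite ev_fmap ev_of_fun; exact: join_fun_inl.
apply: etrans (congr1 (rpt (mkG x (join_nfix fy))) (conv0 _ _)) _.
exact: etrans (esym (rpt_glue (join_inl k n) _ _)) (congr1 (fun z => rpt z u) E).
Qed.

Lemma join_path1 n k (x : A n) (y : nab n (N k)) (fy : nfix y) u :
  join_path x fy (u, ui 1) = rpt (iota n x) (ev y (tfirst u)).
Proof.
have E : fmap (G A) (join_inr k n) (mkG x (join_nfix fy)) = iota n x.
  apply: etrans (mkG_fmap (join_inr k n) x (join_nfix fy)) _; apply: mkG_eq; congr tensor.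
  by apply: ev_inj => w; rewrite ev_fmap !ev_of_fun; exact: join_fun_inr.
apply: etrans (congr1 (rpt (mkG x (join_nfix fy))) (conv1 _ _)) _.
exact: etrans (esym (rpt_glue (join_inr k n) _ _)) (congr1 (fun z => rpt z _) E).
Qed.

Lemma join_homotopy_exists : exists H : realization R (G A) * I -> realization R (G A),
  continuous H /\ forall n k (x : A n) (y : nab n (N k)) (fy : nfix y) u t,
    H (rpt (mkG x fy) u, t) = join_path x fy (u, t).
Proof.
have recP k : exists h : G A k -> tsimplex R k * I -> realization R (G A),
    forall n (x : A n) (y : nab n (N k)) (fy : nfix y), h (mkG x fy) = join_path x fy.
  apply: (mkG_rec (h := fun n x y fy => join_path x fy)) => m n a x y fy fy'.
  apply: funext => -[u t].
  apply: etrans (join_path_natural (th := did k) (a := a) x fy' fy u t _) _; last by rewrite tmap_did.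
  by move=> v; rewrite [sd_map r _](fmap1 (sd r) k) tmap_did ev_map.
pose h k := sval (cid (recP k)).
have hE k n (x : A n) (y : nab n (N k)) (fy : nfix y) : h k (mkG x fy) = join_path x fy.
  by rewrite /h; case: cid.
have [||H [Hc HE]] := @realization_rec_htpy R (G A) (realization R (G A)) h.
- by move=> k z; elim/mkG_ind: z => n x y fy; rewrite hE; exact: join_path_cont.
- move=> k l b z u t; elim/mkG_ind: z => n x y fy.
  rewrite mkG_fmap !hE.
  have := @join_path_natural _ _ _ _ b (did n) x _ fy _ (nfix_fmap b fy) u t.
  by rewrite sset_fmap1; apply=> v; rewrite tmap_did ev_fmap.
by exists H; split=> // n k x y fy u t; rewrite HE hE.
Qed.
End Elements.

Section Transfer.
Variables (A A' : SSet) (f : hom A A').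
Local Notation Gf := (fmap (Phi r) (fmap (nabla R) f)).

Lemma Gf_mkG n k (x : A n) (y : nab n (N k)) (fy : nfix y) : Gf k (mkG x fy) = mkG (f n x) fy.
Proof. by apply: eq_exist; exact: tensor_funE. Qed.

Lemma realization_Gf n k (x : A n) (y : nab n (N k)) (fy : nfix y) (u : tsimplex R k) :
  realization_map Gf (rpt (mkG x fy) u) = rpt (mkG (f n x) fy) u.
Proof. exact: etrans (realization_map_rpt _ _ _) (congr1 (fun z => rpt z u) (Gf_mkG x fy)). Qed.

Lemma realization_iota (p : realization R A) :
  realization_map Gf (realization_map (iota A) p) = realization_map (iota A') (realization_map f p).
Proof.
elim/rpt_ind: p => n x u.
apply: etrans (congr1 (realization_map Gf) (realization_map_rpt (iota A) x u)) _.
apply: etrans (realization_Gf x (mod_nfix n) u) _; apply: esym.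
exact: etrans (congr1 (realization_map (iota A')) (realization_map_rpt f x u)) (realization_map_rpt _ _ _).
Qed.

Lemma rho_natural rho rho' :
  (forall n k (x : A n) (y : nab n (N k)) (fy : nfix y) u, rho (rpt (mkG x fy) u) = rpt x (ev y (tfirst u))) ->
  (forall n k (x : A' n) (y : nab n (N k)) (fy : nfix y) u, rho' (rpt (mkG x fy) u) = rpt x (ev y (tfirst u))) ->
  forall p, rho' (realization_map Gf p) = realization_map f (rho p).
Proof.
move=> rE rE'; apply: rpt_ind => k z u; elim/mkG_ind: z => n x y fy.
apply: etrans (congr1 rho' (realization_Gf x fy u)) _; apply: etrans (rE' _ _ _ _ _ _) _.
apply: esym; exact: etrans (congr1 (realization_map f) (rE _ _ _ _ _ _)) (realization_map_rpt _ _ _).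
Qed.

Lemma join_homotopy_natural H H' :
  (forall n k (x : A n) (y : nab n (N k)) (fy : nfix y) u t, H (rpt (mkG x fy) u, t) = join_path x fy (u, t)) ->
  (forall n k (x : A' n) (y : nab n (N k)) (fy : nfix y) u t, H' (rpt (mkG x fy) u, t) = join_path x fy (u, t)) ->
  forall p t, H' (realization_map Gf p, t) = realization_map Gf (H (p, t)).
Proof.
move=> HE HE'; apply: rpt_ind => k z u; elim/mkG_ind: z => n x y fy t.
apply: etrans (congr1 (fun q => H' (q, t)) (realization_Gf x fy u)) _; apply: etrans (HE' _ _ _ _ _ _ _) _.
apply: esym; exact: etrans (congr1 (realization_map Gf) (HE _ _ _ _ _ _ _)) (realization_Gf _ _ _).
Qed.
End Transfer.

Lemma join_homotopy_data (A : SSet) : exists (rho : realization R (G A) -> realization R A)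
    (H : realization R (G A) * I -> realization R (G A)),
  [/\ continuous rho, continuous H, forall p, H (p, ui 0) = p,
    forall p, H (p, ui 1) = realization_map (iota A) (rho p) &
    (forall n k (x : A n) (y : nab n (N k)) (fy : nfix y) u, rho (rpt (mkG x fy) u) = rpt x (ev y (tfirst u))) /\
    (forall n k (x : A n) (y : nab n (N k)) (fy : nfix y) u t, H (rpt (mkG x fy) u, t) = join_path x fy (u, t))].
Proof.
have [rho [rc rE]] := rho_exists A; have [H [Hc HE]] := join_homotopy_exists A.
exists rho, H; split => //; apply: rpt_ind => k z u; elim/mkG_ind: z => n x y fy.
  exact: etrans (HE _ _ _ _ _ _ _) (join_path0 _ _ _).
apply: etrans (HE _ _ _ _ _ _ _) _; apply: etrans (join_path1 _ _ _) _; apply: esym.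
exact: etrans (congr1 (realization_map (iota A)) (rE _ _ _ _ _ _)) (realization_map_rpt _ _ _).
Qed.

Lemma compress_Phi_nabla (A A' : SSet) (f : hom A A') : compress R (realization_map (R := R) f) ->
  compress R (realization_map (R := R) (fmap (Phi r) (fmap (nabla R) f))).
Proof.
have [rho [H [rc Hc H0 H1 [rE HE]]]] := join_homotopy_data A.
have [rho' [H' [rc' Hc' H0' H1' [rE' HE']]]] := join_homotopy_data A'.
apply: (compress_transfer (@realization_map_cont R _ _ (iota A)) (@realization_map_cont R _ _ (iota A'))
  rc rc' Hc Hc' H0 H1 H0' H1').
- exact: realization_iota.
- exact: rho_natural rE rE'.
- exact: join_homotopy_natural HE HE'.
Qed.
End FixedPoints.

(** * The theorem *)

Lemma realization_map_comp (R : realType) (X Y Z : SSet) (g : hom Y Z) (f : hom X Y) :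
  realization_map (R := R) (g \oc f) = realization_map (R := R) g \o realization_map f.
Proof. by apply: funext; apply: rpt_ind => n x u; rewrite /= !realization_map_rpt. Qed.

Lemma Phi_nabla_retract (R : realType) (A A' : SSet) (f : hom A A') r :
  sset_trivial_cofibration R f -> deformation_retract R (fmap (Phi r) (fmap (nabla R) f)).
Proof.
move=> [fcof whe]; apply: compress_deformation_retract.
- exact/compress_Phi_nabla/whe_compress.
(* A point of the realization of G A' gives one of A' by [rho]; the weak equivalence then yields a
   point of A, sent to G A by [iota]. *)
- move=> p; have [rho _] := rho_exists R r A'; have [_ _ surj _] := whe.
  by have [x _] := surj (rho p); exists (realization_map (iota R r A) x).
- by move=> n [z zP] [z' zP'] /(congr1 sval) /= /(nabla_mono fcof) e; exact: eq_exist.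
Qed.

Theorem lemma1p8 (R : realType) : Reedy_admissible R (nabla R).
Proof.
split=> [|x y f ftriv [Q [i [j [u [iQ _ uj [_ uweq]]]]]] r]; first exact: tensor_preserves_colimits.
have fmono n : injective (fmap (nabla R) (gmap_sset f) n) := nabla_mono (n := n) ftriv.1.
have retract := deformation_retract_pushout (Phi_glued fmono iQ r) (Phi_nabla_retract r ftriv).
have [D [s [Dc sc D0 D1 [Dj sj]]]] := retract_data retract.
rewrite /sset_weq -uj fmapM realization_map_comp.
by have := whe_comp_retract (@realization_map_cont R _ _ _) Dc sc D0 D1 Dj sj (uweq r).
Qed.
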